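(* Let $G$, $H$, $K$ be countable discrete groups, $R$ a commutative ring with unit, $W$ an $R$-module, $\varphi:G\to H$ a coarse map, $L$ a $\mathrm{res}$-invariant $RG$-submodule of $C(G,W)$ and $M$ a $\mathrm{res}$-invariant $RH$-submodule of $C(H,W)$. (i) $D_*(\varphi)$ induces homomorphisms $H_*(\varphi):H_*(G,L)\to H_*(H,\varphi_*L)$. If $\varphi$ is a coarse embedding, $H_*(\varphi)$ is an isomorphism with inverse $H_*(\omega)$. If in addition $L$ is a topological $\mathrm{res}$-invariant module, $D_*(\varphi)$ also induces topological isomorphisms $\bar H_*(\varphi):\bar H_*(G,L)\cong\bar H_*(H,\varphi_*L)$. If $\phi:G\to H$ is a coarse map with $\varphi\sim\phi$, then $H_*(\varphi)=H_*(\phi)$, and $\bar H_*(\varphi)=\bar H_*(\phi)$ in the topological case. If $\psi:H\to K$ is another coarse map, then $H_*(\psi\circ\varphi)=H_*(\psi)\circ H_*(\varphi)$, and $\bar H_*(\psi\circ\varphi)=\bar H_*(\psi)\circ\bar H_*(\varphi)$ in the topological case. (ii) $D^*(\varphi)$ induces homomorphisms $H^*(\varphi):H^*(H,M)\to H^*(G,\varphi^*M)$. If $\varphi$ is a coarse embedding, then $H^*(\varphi):H^*(H,\varphi^{*-1}L)\to H^*(G,L)$ is an isomorphism with inverse $H^*(\omega)$. If in addition $L$ and $M$ are topological $\mathrm{res}$-invariant modules, then $D^*(\varphi)$ also induces continuous homomorphisms $\bar H^*(\varphi):\bar H^*(H,M)\to\bar H^*(G,\varphi^*M)$ and topological isomorphisms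 $\bar H^*(\varphi):\bar H^*(H,\varphi^{*-1}L)\to\bar H^*(G,L)$. If $\phi:G\to H$ is a coarse map with $\varphi\sim\phi$, then $H^*(\varphi)=H^*(\phi)$, and $\bar H^*(\varphi)=\bar H^*(\phi)$ in the topological case. If $\psi:H\to K$ is another coarse map, then $H^*(\psi\circ\varphi)=H^*(\varphi)\circ H^*(\psi)$, and $\bar H^*(\psi\circ\varphi)=\bar H^*(\varphi)\circ\bar H^*(\psi)$ in the topological case. Here ''the topological case'' means that the coefficient modules are topological $\mathrm{res}$-invariant modules and the coarse maps involved are coarse embeddings.
   Context: Coarse notions. $\varphi:G\to H$ is a coarse map if it has finite point preimages and for every $S\subseteq G\times G$ with $\{st^{-1}:(s,t)\in S\}$ finite, $\{\varphi(s)\varphi(t)^{-1}:(s,t)\in S\}$ is finite. It is a coarse embedding if for every $S\subseteq G\times G$, $\{st^{-1}:(s,t)\in S\}$ is finite iff $\{\varphi(s)\varphi(t)^{-1}:(s,t)\in S\}$ is finite. $\varphi\sim\phi$ means $\{\varphi(x)\phi(x)^{-1}:x\in G\}$ is finite. Modules. $C(G,W)$ is the $RG$-module of all functions $G\to W$ with $(g.f)(x)=f(g^{-1}x)$. An $RG$-submodule $L\subseteq C(G,W)$ is $\mathrm{res}$-invariant if $1_A\cdot f\in L$ for all $f\in L$, $A\subseteq G$. For a coarse map $\varphi$: $\varphi_*(f)(y)=\sum_{\varphi(x)=y}f(x)$ and $\varphi^*(f)=f\circ\varphi$; $\varphi_*L$ is the smallest $\mathrm{res}$-invariant $RH$-submodule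 of $C(H,W)$ containing $\{\varphi_*(f):f\in L\}$; $\varphi^*M$ is the smallest $\mathrm{res}$-invariant $RG$-submodule of $C(G,W)$ containing $\{\varphi^*(f):f\in M\}$. For a coarse embedding $\varphi$, $\varphi^{*-1}L=\{f\in C(H,W):\varphi^*(h.f)\in L\text{ for all }h\in H\}$. One has $\psi_*\varphi_*L=(\psi\circ\varphi)_*L$, $\varphi^*\psi^*N=(\psi\circ\varphi)^*N$, $\varphi^*\varphi^{*-1}L=L$, and $\varphi_*L=\phi_*L$, $\varphi^*M=\phi^*M$ if $\varphi\sim\phi$. The map $\omega$. For a coarse embedding $\varphi$, put $Y=\varphi(G)$, choose $X\subseteq G$ such that $\tilde\varphi=\varphi|_X:X\to Y$ is bijective, enumerate $H=\{h_1,h_2,\dots\}$ with $h_1=e$, and put $Y_1=Y$, $Y_j=Y\setminus h_j^{-1}(h_1Y_1\cup\dots\cup h_{j-1}Y_{j-1})$, so $H=\bigsqcup_jh_jY_j$; put $X_j=X\cap\varphi^{-1}(Y_j)$. Define $\omega:H\to G$ by $\omega(y)=\tilde\varphi^{-1}(h_j^{-1}y)$ for $y\in h_jY_j$. Complexes. Let $D_n(L)$ be the set of functions $f:G\times G^n\to W$ with $f(\cdot,\vec g)\in L$ for all $\vec g\in G^n$ and $f(\cdot,\vec g)\neq0$ for only finitely many $\vec g$; let $D^n(L)$ be defined in the same way without the finiteness condition. Define $\delta_n^{(i)}:G\times G^n\to G\times G^{n-1}$ by $\delta_n^{(0)}(x,g_1,\dots,g_n)=(g_1^{-1}x,g_2,\dots,g_n)$,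 $\delta_n^{(i)}(x,g_1,\dots,g_n)=(x,g_1,\dots,g_ig_{i+1},\dots,g_n)$ for $1\le i\le n-1$, $\delta_n^{(n)}(x,g_1,\dots,g_n)=(x,g_1,\dots,g_{n-1})$. The differentials are $d_n=\sum_{i=0}^n(-1)^i(\delta_n^{(i)})_*:D_n(L)\to D_{n-1}(L)$ and $d^n=\sum_{i=0}^{n+1}(-1)^i(\delta_{n+1}^{(i)})^*:D^n(L)\to D^{n+1}(L)$, where $_*$ denotes summation over fibres and $^*$ composition. The map $f\mapsto[(x,\vec g)\mapsto f(\vec g)(x)]$ identifies the bar complexes (finitely supported functions, resp. all functions, $G^n\to L$) with $D_*(L)$, resp. $D^*(L)$; thus $H_n(G,L)=H_n(D_*(L))$ and $H^n(G,L)=H^n(D^*(L))$. For a map $\theta$ between groups (used for $\theta=\varphi$ and $\theta=\omega$) let $\theta^n(x,g_1,\dots,g_n)=(\theta(x_0),\theta(x_0)\theta(x_1)^{-1},\dots,\theta(x_{n-1})\theta(x_n)^{-1})$ with $x_0=x$, $x_i=g_i^{-1}x_{i-1}$. Then $D_n(\varphi)=(\varphi^n)_*:D_n(L)\to D_n(\varphi_*L)$, $D^n(\varphi)=(\varphi^n)^*:D^n(M)\to D^n(\varphi^*M)$, and for coarse embeddings $D_n(\omega)=(\omega^n)_*:D_n(\varphi_*L)\to D_n(L)$, $D^n(\omega)=(\omega^n)^*:D^n(L)\to D^n(\varphi^{*-1}L)$; $H_*(\varphi),H^*(\varphi),H_*(\omega),H^*(\omega)$ are the maps induced on (co)homology.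 Topological setting. $R$ is a topological field. A topological $\mathrm{res}$-invariant $RG$-submodule $L\subseteq C(G,W)$ is a $\mathrm{res}$-invariant submodule with the structure of a topological $R$-vector space such that $f\mapsto1_A\cdot f$ ($A\subseteq G$) and $f\mapsto g.f$ ($g\in G$) are continuous on $L$. For a coarse embedding $\varphi$: $\varphi_*L$ carries the finest topology such that for all $J\ge1$ the map $\bigoplus_{j=1}^J1_{X_j}\cdot L\to\varphi_*L$, $(f_j)_j\mapsto\sum_jh_j.\varphi_*(f_j)$, is continuous. $\varphi^*M$ carries the topology making the bijection $\bigoplus_i1_{\varphi(Z_i)}\cdot M\to\varphi^*M$, $(f_i)_i\mapsto\sum_i1_{Z_i}\cdot\varphi^*(f_i)$, a homeomorphism, where $G=\bigsqcup_iZ_i$ is a finite partition for which there are $g(i)\in G$, $h(i)\in H$ with $g(i)Z_i\subseteq X$ and $\varphi(x)=h(i)\varphi(g(i)x)$ for all $x\in Z_i$, and $Z_1=X$, $g(1)=e$, $h(1)=e$ (such partitions exist, and $\varphi$ is injective on each $Z_i$). $\varphi^{*-1}L$ carries the topology making the bijection $\prod_j1_{X_j}\cdot L\to\prod_j1_{h_jY_j}\cdot\varphi^{*-1}L=\varphi^{*-1}L$, $(f_j)_j\mapsto(h_j.\varphi_*(f_j))_j$, a homeomorphism. (Subspaces carry subspace topologies, finite sums and products the product topology.) Both $D_n(L)$ and $D^n(L)$ carry the topology of pointwise convergence: $f_i\to f$ if and only if $f_i(\cdot,\vec g)\to f(\cdot,\vec g)$ in $L$ for all $\vec g\in G^n$.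 Reduced (co)homology is $\bar H_n(G,L)=\ker(d_n)/\overline{\mathrm{im}(d_{n+1})}$ and $\bar H^n(G,L)=\ker(d^n)/\overline{\mathrm{im}(d^{n-1})}$. *)

(* Defs.v *)
From HB Require Import structures.
From mathcomp Require Import all_boot all_algebra finmap.
From mathcomp Require Import all_classical.
From mathcomp Require Import topology.

Set Implicit Arguments.
Unset Strict Implicit.
Unset Printing Implicit Defensive.

Import GRing.Theory.
Local Open Scope classical_set_scope.
Local Open Scope ring_scope.
Local Open Scope quotient_scope.

Section Submodules.
Variables (R : pzRingType) (V : lmodType R).

Record submod (L : submodClosed V) :=
  Submod { submod_val : V; submodP : submod_val \in L }.

HB.instance Definition _ L := [isSub for @submod_val L].
HB.instance Definition _ L := [Choice of submod L by <:].
HB.instance Definition _ L := [SubChoice_isSubLmodule of submod L by <:].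

Variable L : submodClosed V.
Implicit Types u v : submod L.

Lemma submod_val0 : val (0 : submod L) = 0. Proof. exact: raddf0. Qed.
Lemma submod_valD u v : val (u + v) = val u + val v. Proof. exact: raddfD. Qed.
Lemma submod_valB u v : val (u - v) = val u - val v. Proof. exact: raddfB. Qed.
Lemma submod_valZ a u : val (a *: u) = a *: val u. Proof. exact: linearZ. Qed.
Lemma submod_val_sum I (r : seq I) (F : I -> submod L) :
  val (\sum_(i <- r) F i) = \sum_(i <- r) val (F i).
Proof. exact: raddf_sum. Qed.

Lemma closed_of_linear (P : {pred V}) :
  0 \in P -> (forall a (u v : V), u \in P -> v \in P -> a *: u + v \in P) ->
  GRing.subsemimod_closed P.
Proof.
move=> P0 PZD; split=> [|a u uP]; last by rewrite -[_ *: _]addr0 PZD.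
by split=> // u v uP vP; rewrite -[u]scale1r PZD.
Qed.

End Submodules.

Section Subquotients.
Variables (R : pzRingType) (V : lmodType R) (Z B : submodClosed V).

Definition in_sub : {pred submod Z} := [pred z | val z \in B].

Lemma in_sub_closed : zmod_closed in_sub.
Proof.
split=> [|x y]; rewrite !inE ?submod_val0 ?rpred0// submod_valB -scaleN1r => xB yB.
by rewrite rpredD// rpredZ.
Qed.

HB.instance Definition _ := GRing.isZmodClosed.Build (submod Z) in_sub in_sub_closed.

Definition subquot : Type := Quotient.quot in_sub.

HB.instance Definition _ := GRing.Zmodule.on subquot.
HB.instance Definition _ := EqQuotient.on subquot.
HB.instance Definition _ := ZmodQuotient.on subquot.

Lemma subquotP (x y : submod Z) :
  \pi_subquot x = \pi_subquot y <-> val x - val y \in B.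
Proof.
split=> [/eqP|xy]; first by rewrite -Quotient.idealrBE inE submod_valB.
by apply/eqP; rewrite -Quotient.idealrBE inE submod_valB.
Qed.

Definition subquot_scale (a : R) (c : subquot) : subquot :=
  \pi_subquot (a *: repr c).

Lemma subquot_scaleE a (x : submod Z) :
  subquot_scale a (\pi_subquot x) = \pi_subquot (a *: x).
Proof.
apply/subquotP; rewrite !submod_valZ -scalerBr rpredZ//.
by apply/subquotP; rewrite reprK.
Qed.

Lemma subquot_scalerA a b c :
  subquot_scale a (subquot_scale b c) = subquot_scale (a * b) c.
Proof. by elim/quotW: c => x; rewrite (subquot_scaleE b x) !subquot_scaleE scalerA. Qed.

Lemma subquot_scale1r c : subquot_scale 1 c = c.
Proof. by elim/quotW: c => x; rewrite subquot_scaleE scale1r. Qed.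

Lemma subquot_scalerDr a c d :
  subquot_scale a (c + d) = subquot_scale a c + subquot_scale a d.
Proof.
elim/quotW: c => x; elim/quotW: d => y.
by rewrite -raddfD (subquot_scaleE a x) (subquot_scaleE a y) -raddfD subquot_scaleE scalerDr.
Qed.

Lemma subquot_scalerDl c a b :
  subquot_scale (a + b) c = subquot_scale a c + subquot_scale b c.
Proof. by elim/quotW: c => x; rewrite !subquot_scaleE scalerDl raddfD. Qed.

HB.instance Definition _ := GRing.Zmodule_isLmodule.Build R subquot
  subquot_scalerA subquot_scale1r subquot_scalerDr subquot_scalerDl.

End Subquotients.

(* A topology as a value on a fixed carrier, because the carriers below
   (submodules) receive several topologies; [top_space t] is the corresponding
   library space. *)
Record topology (T : choiceType) := Topology {
  opens : set_system T;
  opensT : opens setT;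
  opensI : setI_closed opens;
  opens_bigU : forall (I : Type) (f : I -> set T),
    (forall i, opens (f i)) -> opens (\bigcup_i f i) }.

Definition top_space (T : choiceType) (t : topology T) : Type := T.

HB.instance Definition _ T (t : topology T) := Choice.on (top_space t).
HB.instance Definition _ T (t : topology T) :=
  isOpenTopological.Build (top_space t)
    (opensT t) (@opensI _ t) (@opens_bigU _ t).

Definition topology_of (T : topologicalType) : topology T :=
  Topology (@openT T) (@openI T) 
    (fun I f oF => @bigcup_open T I setT f (fun i _ => oF i)).

Section FinalTopology.
Variables (I : Type) (S : I -> topologicalType) (T : choiceType).
Variable f : forall i, S i -> T.

Definition final_opens : set_system T :=
  [set U | forall i, open (@f i @^-1` U)].

Lemma final_opensT : final_opens setT.
Proof. by move=> i; rewrite preimage_setT; exact: openT. Qed.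

Lemma final_opensI : setI_closed final_opens.
Proof. by move=> U V oU oV i; rewrite preimage_setI; apply: openI. Qed.

Lemma final_opens_bigU (J : Type) (U : J -> set T) :
  (forall j, final_opens (U j)) -> final_opens (\bigcup_j U j).
Proof.
by move=> oU i; rewrite preimage_bigcup; apply: bigcup_open => j _; apply: oU.
Qed.

(* the finest topology making every [f i] continuous *)
Definition final_topology : topology T :=
  Topology final_opensT final_opensI final_opens_bigU.

End FinalTopology.

Lemma top_space_openE (T : choiceType) (t : topology T) (U : set T) :
  open (U : set (top_space t)) = opens t U.
Proof. by []. Qed.

Section SeparatelyContinuous.
Variables (R : pzRingType) (V : lmodType R).

Definition separately_continuous (t : topology V) : Prop :=
  (forall v, continuous (fun u : top_space t => (u : V) + v : top_space t)) /\
  (forall a, continuous (fun u : top_space t => a *: (u : V) : top_space t)).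

Variables (t : topology V) (tc : separately_continuous t) (B : submodClosed V).

Definition closure_pred of separately_continuous t : {pred V} :=
  [pred v | `[< closure (fun u : top_space t => (u : V) \in B) v >]].

Lemma closure_predP v :
  v \in closure_pred tc <-> closure (fun u : top_space t => (u : V) \in B) v.
Proof. by split=> [/asboolP|?]; last exact/asboolP. Qed.

Lemma closure_pred_closed : GRing.subsemimod_closed (closure_pred tc).
Proof.
have [tD tZ] := tc.
have stable (f : V -> V) : continuous (f : top_space t -> top_space t) ->
    (forall v, v \in B -> f v \in closure_pred tc) ->
    forall v, v \in closure_pred tc -> f v \in closure_pred tc.
  move=> cf fB v /closure_predP clv; apply/closure_predP => U Ufv.
  have oU : nbhs (f v : top_space t) (interior U) by exact: nbhs_interior.
  have [u [/= Bu Ufu]] := clv _ (cf v _ oU).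
  by have /closure_predP := fB u Bu; apply.
have BS v : v \in B -> v \in closure_pred tc.
  by move=> Bv; apply/closure_predP/subset_closure.
split; first split.
- exact/BS/rpred0.
- move=> u v Bu Bv; apply: (stable (fun w => w + v) (tD v)) => // w Bw.
  rewrite addrC; apply: (stable (fun w' => w' + w) (tD w)) => // w' Bw'.
  by apply: BS; rewrite rpredD.
- move=> a v; apply: (stable (fun w => a *: w) (tZ a)) => w Bw.
  by apply: BS; rewrite rpredZ.
Qed.

HB.instance Definition _ :=
  GRing.isSubmodClosed.Build R V (closure_pred tc) closure_pred_closed.

Definition closure_submod : submodClosed V := closure_pred tc.

End SeparatelyContinuous.

Section FinalSeparatelyContinuous.
Variables (R : pzRingType) (V : lmodType R).
Variables (I : Type) (S : I -> topologicalType) (f : forall i, S i -> V).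

Lemma final_separately_continuous :
  (forall v i, exists j (k : S i -> S j),
     continuous k /\ forall s, f s + v = f (k s)) ->
  (forall a i, exists k : S i -> S i,
     continuous k /\ forall s, a *: f s = f (k s)) ->
  separately_continuous (final_topology f).
Proof.
move=> fD fZ; split=> [v|a]; apply/continuousP => U oU.
  suff: opens (final_topology f) [set u | U (u + v)] by [].
  move=> i; have [j [k [/continuousP ck fk]]] := fD v i.
  have := ck _ (oU j); congr (open _).
  by apply/seteqP; split=> s /=; rewrite fk.
suff: opens (final_topology f) [set u | U (a *: u)] by [].
move=> i; have [k [/continuousP ck fk]] := fZ a i.
have := ck _ (oU i); congr (open _).
by apply/seteqP; split=> s /=; rewrite fk.
Qed.

End FinalSeparatelyContinuous.

Section SubquotTopology.
Variables (R : pzRingType) (V : lmodType R) (t : topology V).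
Variables (Z B : submodClosed V).

Definition sub_space : Type :=
  initial_topology (val : submod Z -> top_space t).
HB.instance Definition _ := Topological.on sub_space.

(* [subquot Z B] with the quotient of the subspace topology of [Z] *)
Definition subquot_space : topologicalType :=
  quotient_topology (subquot Z B : quotType sub_space).

End SubquotTopology.

Section Coarse.
Variables G H : groupType.
Local Open Scope group_scope.

Definition coarse_map (phi : G -> H) : Prop :=
  (forall y, finite_set (phi @^-1` [set y])) /\
  (forall S : set (G * G), finite_set [set s.1 * s.2^-1 | s in S] ->
     finite_set [set phi s.1 * (phi s.2)^-1 | s in S]).

Definition coarse_embedding (phi : G -> H) : Prop :=
  forall S : set (G * G), finite_set [set s.1 * s.2^-1 | s in S] <->
    finite_set [set phi s.1 * (phi s.2)^-1 | s in S].

Definition coarsely_equal (phi phi' : G -> H) : Prop :=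
  finite_set [set phi x * (phi' x)^-1 | x in [set: G]].

End Coarse.

Section Functions.
Variables (R : pzRingType) (W : lmodType R).

(* [theta_* f]; a fibre that meets the support of [f] in an infinite set gets
   the value 0, which does not happen in the uses below *)
Definition pushf (A B : choiceType) (theta : A -> B) (f : A -> W) : B -> W :=
  fun b => \sum_(a \in theta @^-1` [set b]) f a.

Definition pullf (A B : Type) (theta : A -> B) (f : B -> W) : A -> W :=
  f \o theta.

(* [1_A . f] *)
Definition restr (T : Type) (A : set T) (f : T -> W) : T -> W :=
  fun x => if x \in A then f x else 0.

Definition translate (G : groupType) (g : G) (f : G -> W) : G -> W :=
  fun x => f (g^-1 * x)%g.

End Functions.

Section ResModules.
Variables (R : pzRingType) (W : lmodType R).

Record resmod (G : groupType) := ResMod {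
  resmod_sub :> submodClosed (G -> W);
  resmod_translate : forall g f, f \in resmod_sub -> translate g f \in resmod_sub;
  resmod_restr : forall A f, f \in resmod_sub -> restr A f \in resmod_sub }.

Section Functoriality.
Variables (G H : groupType) (phi : G -> H).

Section Push.
Variable L : resmod G.

Definition push_pred : {pred H -> W} :=
  [pred f | `[< forall N : resmod H,
                  (forall f', f' \in L -> pushf phi f' \in N) -> f \in N >]].

Lemma push_predP f : f \in push_pred <->
  forall N : resmod H, (forall f', f' \in L -> pushf phi f' \in N) -> f \in N.
Proof. by split=> [/asboolP|?]; last exact/asboolP. Qed.

Lemma push_pred_closed : GRing.subsemimod_closed push_pred.
Proof.
split; first split.
- by apply/push_predP => N _; exact: rpred0.
- by move=> f g /push_predP fP /push_predP gP; apply/push_predP => N LN;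
    rewrite rpredD ?fP ?gP.
- by move=> a f /push_predP fP; apply/push_predP => N LN; rewrite rpredZ ?fP.
Qed.

HB.instance Definition _ :=
  GRing.isSubmodClosed.Build R (H -> W) push_pred push_pred_closed.

Lemma push_translate h f : f \in push_pred -> translate h f \in push_pred.
Proof.
by move=> /push_predP fP; apply/push_predP => N LN; apply/resmod_translate/fP.
Qed.

Lemma push_restr A f : f \in push_pred -> restr A f \in push_pred.
Proof.
by move=> /push_predP fP; apply/push_predP => N LN; apply/resmod_restr/fP.
Qed.

Definition push : resmod H := ResMod push_translate push_restr.

Lemma pushf_push f : f \in L -> pushf phi f \in push.
Proof. by move=> fL; apply/push_predP => N; apply. Qed.

End Push.

Section Pull.
Variable M : resmod H.

Definition pull_pred : {pred G -> W} :=
  [pred f | `[< forall N : resmod G,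
                  (forall f', f' \in M -> pullf phi f' \in N) -> f \in N >]].

Lemma pull_predP f : f \in pull_pred <->
  forall N : resmod G, (forall f', f' \in M -> pullf phi f' \in N) -> f \in N.
Proof. by split=> [/asboolP|?]; last exact/asboolP. Qed.

Lemma pull_pred_closed : GRing.subsemimod_closed pull_pred.
Proof.
split; first split.
- by apply/pull_predP => N _; exact: rpred0.
- by move=> f g /pull_predP fP /pull_predP gP; apply/pull_predP => N LN;
    rewrite rpredD ?fP ?gP.
- by move=> a f /pull_predP fP; apply/pull_predP => N LN; rewrite rpredZ ?fP.
Qed.

HB.instance Definition _ :=
  GRing.isSubmodClosed.Build R (G -> W) pull_pred pull_pred_closed.

Lemma pull_translate h f : f \in pull_pred -> translate h f \in pull_pred.
Proof.
by move=> /pull_predP fP; apply/pull_predP => N LN; apply/resmod_translate/fP.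
Qed.

Lemma pull_restr A f : f \in pull_pred -> restr A f \in pull_pred.
Proof.
by move=> /pull_predP fP; apply/pull_predP => N LN; apply/resmod_restr/fP.
Qed.

Definition pull : resmod G := ResMod pull_translate pull_restr.

Lemma pullf_pull f : f \in M -> pullf phi f \in pull.
Proof. by move=> fL; apply/pull_predP => N; apply. Qed.

End Pull.

Section PullInverse.
Variable L : resmod G.

Definition pullinv_pred : {pred H -> W} :=
  [pred f | `[< forall h, pullf phi (translate h f) \in L >]].

Lemma pullinv_predP f :
  f \in pullinv_pred <-> forall h, pullf phi (translate h f) \in L.
Proof. by split=> [/asboolP|?]; last exact/asboolP. Qed.

Lemma pullinv_pred_closed : GRing.subsemimod_closed pullinv_pred.
Proof.
split; first split.
- by apply/pullinv_predP => h; exact: rpred0.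
- move=> f g /pullinv_predP fP /pullinv_predP gP; apply/pullinv_predP => h.
  by rewrite (_ : pullf _ _ = pullf phi (translate h f)
                              + pullf phi (translate h g)) ?rpredD.
- move=> a f /pullinv_predP fP; apply/pullinv_predP => h.
  by rewrite (_ : pullf _ _ = a *: pullf phi (translate h f)) ?rpredZ.
Qed.

HB.instance Definition _ :=
  GRing.isSubmodClosed.Build R (H -> W) pullinv_pred pullinv_pred_closed.

Lemma pullinv_translate h f :
  f \in pullinv_pred -> translate h f \in pullinv_pred.
Proof.
move=> /pullinv_predP fP; apply/pullinv_predP => k.
suff -> : translate k (translate h f) = translate (k * h)%g f by [].
by apply/funext => x; rewrite /translate invgM mulgA.
Qed.

Lemma pullinv_restr A f : f \in pullinv_pred -> restr A f \in pullinv_pred.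
Proof.
move=> /pullinv_predP fP; apply/pullinv_predP => h.
have -> : pullf phi (translate h (restr A f)) =
    restr [set x | A (h^-1 * phi x)%g] (pullf phi (translate h f)).
  by apply/funext => x; rewrite /pullf /restr /translate /=; congr (if _ then _ else _);
     apply/idP/idP; rewrite !inE.
exact: resmod_restr.
Qed.

Definition pullinv : resmod H := ResMod pullinv_translate pullinv_restr.

End PullInverse.

End Functoriality.
End ResModules.

Arguments resmod {R} W G.

Section SimplexMaps.
Local Open Scope group_scope.

(* [delta_{n+1}^{(i)}]; the tuple is indexed from 0, so its j-th entry is
   the (j+1)-st group element of the mathematical notation *)
Definition face (G : groupType) (n : nat) (i : 'I_n.+2)
    (p : G * n.+1.-tuple G) : G * n.-tuple G :=
  (if i == 0 :> nat then (thead p.2)^-1 * p.1 else p.1,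
   [tuple if (j.+1 < i)%N then nth 1 p.2 j
          else if j.+1 == i :> nat then nth 1 p.2 j * nth 1 p.2 j.+1
          else nth 1 p.2 j.+1 | j < n]).

(* [x_k], where [x_0 = x] and [x_k = g_k^-1 x_(k-1)] *)
Definition vertex (G : groupType) (n : nat) (p : G * n.-tuple G) (k : nat) : G :=
  foldl (fun x g => g^-1 * x) p.1 (take k p.2).

(* [theta^n] *)
Definition simplex_map (G H : groupType) (theta : G -> H) (n : nat)
    (p : G * n.-tuple G) : H * n.-tuple H :=
  (theta p.1,
   [tuple theta (vertex p j) * (theta (vertex p j.+1))^-1 | j < n]).

End SimplexMaps.

Section Complexes.
Variables (R : comPzRingType) (W : lmodType R) (G : groupType).

Definition chain_d n (f : G * n.+1.-tuple G -> W) : G * n.-tuple G -> W :=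
  fun q => \sum_(i < n.+2) (-1) ^+ i *: pushf (face i) f q.

Definition cochain_d n (f : G * n.-tuple G -> W) : G * n.+1.-tuple G -> W :=
  fun p => \sum_(i < n.+2) (-1) ^+ i *: pullf (face i) f p.

Definition slice n (f : G * n.-tuple G -> W) (g : n.-tuple G) : G -> W :=
  fun x => f (x, g).

Variable L : resmod W G.

Section Degree.
Variable n : nat.

Definition chain_pred : {pred G * n.-tuple G -> W} :=
  [pred f | `[< (forall g, slice f g \in L) /\
                finite_set [set g | slice f g != 0] >]].

Definition cochain_pred : {pred G * n.-tuple G -> W} :=
  [pred f | `[< forall g, slice f g \in L >]].

Lemma chain_predP f : f \in chain_pred <->
  (forall g, slice f g \in L) /\ finite_set [set g | slice f g != 0].
Proof. by split=> [/asboolP|?]; last exact/asboolP. Qed.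

Lemma cochain_predP f : f \in cochain_pred <-> forall g, slice f g \in L.
Proof. by split=> [/asboolP|?]; last exact/asboolP. Qed.

Lemma chain_pred_closed : GRing.subsemimod_closed chain_pred.
Proof.
split; first split.
- apply/chain_predP; split=> [g|]; first exact: rpred0.
  by apply: (sub_finite_set _ (@finite_set0 _)) => g /=; rewrite eqxx.
- move=> f f' /chain_predP[fL fin] /chain_predP[fL' fin'].
  apply/chain_predP; split=> [g|].
    by rewrite (_ : slice _ g = slice f g + slice f' g) ?rpredD.
  have /sub_finite_set : [set g | slice (f + f') g != 0] `<=`
      [set g | slice f g != 0] `|` [set g | slice f' g != 0].
    move=> g /=; have [f0 h|] := eqVneq (slice f g) 0; last by left.
    right; apply: contra_neq h => f'0.
    by rewrite (_ : slice _ g = slice f g + slice f' g)// f0 f'0 addr0.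
  by apply; rewrite finite_setU.
- move=> a f /chain_predP[fL fin]; apply/chain_predP; split=> [g|].
    by rewrite (_ : slice _ g = a *: slice f g) ?rpredZ.
  apply: sub_finite_set fin => g /=; apply: contra_neq => f0.
  by rewrite (_ : slice _ g = a *: slice f g)// f0 scaler0.
Qed.

HB.instance Definition _ :=
  GRing.isSubmodClosed.Build R _ chain_pred chain_pred_closed.

Lemma cochain_pred_closed : GRing.subsemimod_closed cochain_pred.
Proof.
split; first split.
- by apply/cochain_predP => g; exact: rpred0.
- move=> f f' /cochain_predP fL /cochain_predP fL'; apply/cochain_predP => g.
  by rewrite (_ : slice _ g = slice f g + slice f' g) ?rpredD.
- move=> a f /cochain_predP fL; apply/cochain_predP => g.
  by rewrite (_ : slice _ g = a *: slice f g) ?rpredZ.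
Qed.

HB.instance Definition _ :=
  GRing.isSubmodClosed.Build R _ cochain_pred cochain_pred_closed.

(* [D_n(L)] and [D^n(L)] *)
Definition chains : lmodType R := submod chain_pred.
Definition cochains : lmodType R := submod cochain_pred.

Lemma chain_slice (f : chains) g : slice (val f) g \in L.
Proof. by have /chain_predP[fL _] := submodP f; exact: fL. Qed.

Lemma cochain_slice (f : cochains) g : slice (val f) g \in L.
Proof. by have /cochain_predP := submodP f; exact. Qed.

Lemma chain_fin (f : chains) : finite_set [set g | slice (val f) g != 0].
Proof. by have /chain_predP[_] := submodP f. Qed.

End Degree.

Lemma pushf_face_linear n (i : 'I_n.+2) a (f f' : chains n.+1) :
  pushf (face i) (val (a *: f + f')) =
  a *: pushf (face i) (val f) + pushf (face i) (val f').
Proof.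
apply/funext => -[y h].
set x := fun g : n.+1.-tuple G => if i == 0 :> nat then (thead g * y)%g else y.
set S := [set g | slice (val f) g != 0] `|` [set g | slice (val f') g != 0].
have finS : finite_set S by rewrite finite_setU; split; exact: chain_fin.
set P := face i @^-1` [set (y, h)].
set Q := P `&` [set (x g, g) | g in S].
have finQ : finite_set Q.
  by apply: sub_finite_set (finite_image (fun g => (x g, g)) finS); exact: subIsetr.
have sumQ (u : G * n.+1.-tuple G -> W) : (forall p, ~ S p.2 -> u p = 0) ->
    pushf (face i) u (y, h) = \sum_(p \in Q) u p.
  move=> uS; apply/esym/fsbig_widen; first exact: subIsetl.
  move=> p [Pp nQp]; rewrite /preimage /=; apply: uS => Sp; apply: nQp; split=> //.
  exists p.2 => //; rewrite /x; move: Pp; rewrite /P /preimage /face /=.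
  by case: (p) => p1 p2 [] /= <- _; case: (i == 0 :> nat); rewrite ?mulVKg.
have S0 p (k : chains n.+1) : slice (val k) p.2 = 0 -> val k p = 0.
  by move/(congr1 (fun e => e p.1)); rewrite /slice -surjective_pairing.
have nS p : ~ S p.2 -> slice (val f) p.2 = 0 /\ slice (val f') p.2 = 0.
  by move=> /not_orP[/negP/negPn/eqP ? /negP/negPn/eqP ?].
rewrite (_ : (_ + _) _ = a *: pushf (face i) (val f) (y, h) +
                         pushf (face i) (val f') (y, h))//.
rewrite (sumQ (val f)); last by move=> p /nS[/S0].
rewrite (sumQ (val f')); last by move=> p /nS[_ /S0].
rewrite (sumQ (val (a *: f + f'))); last first.
  move=> p /nS[? ?]; rewrite submod_valD submod_valZ.
  by rewrite (_ : (_ + _) p = a *: val f p + val f' p)// !S0// scaler0 addr0.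
rewrite submod_valD submod_valZ !fsbig_finite// scaler_sumr -big_split.
by apply: eq_bigr.
Qed.

Lemma chain_d_linear n a (f f' : chains n.+1) :
  chain_d (val (a *: f + f')) = a *: chain_d (val f) + chain_d (val f').
Proof.
apply/funext => q; rewrite /chain_d.
rewrite (_ : (_ + _) q = a *: chain_d (val f) q + chain_d (val f') q)//.
rewrite /chain_d scaler_sumr -big_split /=; apply: eq_bigr => i _.
rewrite pushf_face_linear.
rewrite (_ : (_ + _) q = a *: pushf (face i) (val f) q
                         + pushf (face i) (val f') q)//.
by rewrite scalerDr !scalerA mulrC.
Qed.

Lemma cochain_d_linear n a (f f' : G * n.-tuple G -> W) :
  cochain_d (a *: f + f') = a *: cochain_d f + cochain_d f'.
Proof.
apply/funext => q; rewrite /cochain_d.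
rewrite (_ : (_ + _) q = a *: cochain_d f q + cochain_d f' q)//.
rewrite /cochain_d scaler_sumr -big_split /=; apply: eq_bigr => i _.
rewrite (_ : pullf _ _ q = a *: pullf (face i) f q + pullf (face i) f' q)//.
by rewrite scalerDr !scalerA mulrC.
Qed.

Section Homology.
Variable n : nat.

(* the convention is [D_(-1)(L) = 0], so that every 0-chain is a cycle and
   only 0 is a 0-coboundary *)
Definition is_cycle : (G * n.-tuple G -> W) -> Prop :=
  match n with
  | 0 => fun _ => True
  | m.+1 => fun f => chain_d f = 0
  end.

Definition is_coboundary : (G * n.-tuple G -> W) -> Prop :=
  match n with
  | 0 => fun f => f = 0
  | m.+1 => fun f => exists b : cochains m, f = cochain_d (val b)
  end.

Definition cycle_pred : {pred chains n} := [pred f | `[< is_cycle (val f) >]].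
Definition boundary_pred : {pred chains n} :=
  [pred f | `[< exists b : chains n.+1, val f = chain_d (val b) >]].
Definition cocycle_pred : {pred cochains n} :=
  [pred f | `[< cochain_d (val f) = 0 >]].
Definition coboundary_pred : {pred cochains n} :=
  [pred f | `[< is_coboundary (val f) >]].

End Homology.

Arguments cycle_pred : clear implicits.
Arguments boundary_pred : clear implicits.
Arguments cocycle_pred : clear implicits.
Arguments coboundary_pred : clear implicits.

Lemma cycle_predP n f : f \in cycle_pred n <-> is_cycle (val f).
Proof. by split=> [/asboolP|?]; last exact/asboolP. Qed.
Lemma boundary_predP n (f : chains n) :
  f \in boundary_pred n <-> exists b : chains n.+1, val f = chain_d (val b).
Proof. by split=> [/asboolP|?]; last exact/asboolP. Qed.
Lemma cocycle_predP n f : f \in cocycle_pred n <-> cochain_d (val f) = 0.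
Proof. by split=> [/asboolP|?]; last exact/asboolP. Qed.
Lemma coboundary_predP n f : f \in coboundary_pred n <-> is_coboundary (val f).
Proof. by split=> [/asboolP|?]; last exact/asboolP. Qed.

Lemma chain_d0 n : chain_d (val (0 : chains n.+1)) = 0.
Proof.
have := chain_d_linear (-1) (0 : chains n.+1) 0.
by rewrite scaler0 addr0 scaleN1r addNr.
Qed.

Lemma cochain_d0 n : cochain_d (0 : G * n.-tuple G -> W) = 0.
Proof.
have := cochain_d_linear (-1) (0 : G * n.-tuple G -> W) 0.
by rewrite scaler0 addr0 scaleN1r addNr.
Qed.

Lemma cycle_pred_closed n : GRing.subsemimod_closed (cycle_pred n).
Proof.
apply: closed_of_linear => [|a f f'].
  by apply/cycle_predP; case: n => [//|n]; exact: chain_d0.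
move=> /cycle_predP Zf /cycle_predP Zf'; apply/cycle_predP.
case: n f f' Zf Zf' => [//|n] f f' /= df df'.
by rewrite chain_d_linear df df' scaler0 addr0.
Qed.

HB.instance Definition _ n :=
  GRing.isSubmodClosed.Build R _ (cycle_pred n) (cycle_pred_closed n).

Lemma boundary_pred_closed n : GRing.subsemimod_closed (boundary_pred n).
Proof.
apply: closed_of_linear => [|a f f'].
  by apply/boundary_predP; exists 0; rewrite chain_d0.
move=> /boundary_predP[b fb] /boundary_predP[b' fb']; apply/boundary_predP.
by exists (a *: b + b'); rewrite chain_d_linear -fb -fb'.
Qed.

HB.instance Definition _ n :=
  GRing.isSubmodClosed.Build R _ (boundary_pred n) (boundary_pred_closed n).

Lemma cocycle_pred_closed n : GRing.subsemimod_closed (cocycle_pred n).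
Proof.
apply: closed_of_linear => [|a f f'].
  by apply/cocycle_predP; exact: cochain_d0.
move=> /cocycle_predP df /cocycle_predP df'; apply/cocycle_predP.
by rewrite submod_valD submod_valZ cochain_d_linear df df' scaler0 addr0.
Qed.

HB.instance Definition _ n :=
  GRing.isSubmodClosed.Build R _ (cocycle_pred n) (cocycle_pred_closed n).

Lemma coboundary_pred_closed n : GRing.subsemimod_closed (coboundary_pred n).
Proof.
apply: closed_of_linear => [|a f f'].
  apply/coboundary_predP; case: n => [//|n]; exists 0.
  by rewrite [RHS]cochain_d0.
move=> /coboundary_predP Bf /coboundary_predP Bf'; apply/coboundary_predP.
rewrite submod_valD submod_valZ.
case: n f f' Bf Bf' => [|n] f f' /= => [-> ->|[b ->] [b' ->]].
  by rewrite scaler0 addr0.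
by exists (a *: b + b'); rewrite submod_valD submod_valZ cochain_d_linear.
Qed.

HB.instance Definition _ n :=
  GRing.isSubmodClosed.Build R _ (coboundary_pred n) (coboundary_pred_closed n).

Definition homology n : lmodType R := subquot (cycle_pred n) (boundary_pred n).
Definition cohomology n : lmodType R :=
  subquot (cocycle_pred n) (coboundary_pred n).

End Complexes.

Arguments cycle_pred {R W G} L n _.
Arguments boundary_pred {R W G} L n _.
Arguments cocycle_pred {R W G} L n _.
Arguments coboundary_pred {R W G} L n _.

(* The auxiliary choices behind [omega] and the topologies.  The enumeration of
   [H] may have repetitions, so that a finite [H] is covered as well; a repeated
   [h_j] gives an empty [Y_j]. *)
Record choices (G H : groupType) (phi : G -> H) := Choices {
  section_set : set G;
  section_bij : set_bij section_set (range phi) phi;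
  enumeration : nat -> H;
  enumeration0 : enumeration 0 = 1%g;
  enumeration_surj : forall y, exists j, enumeration j = y }.

Section Pieces.
Variables (G H : groupType) (phi : G -> H) (E : choices phi).
Local Notation X := (section_set E).
Local Notation h := (enumeration E).

(* [covered j] is the union of the [h_i Y_i] for [i < j] *)
Fixpoint covered (j : nat) : set H :=
  if j is i.+1 then
    covered i `|` [set (h i * y)%g | y in
      range phi `\` [set y | covered i (h i * y)%g]]
  else set0.

(* [Y_j] and [X_j] *)
Definition Ypiece (j : nat) : set H :=
  range phi `\` [set y | covered j (h j * y)%g].
Definition Xpiece (j : nat) : set G := section_set E `&` phi @^-1` Ypiece j.

(* the [j] with [y] in [h_j Y_j] *)
Definition piece_index (y : H) : nat := xget 0%N [set j | Ypiece j ((h j)^-1 * y)%g].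

Definition omega (y : H) : G :=
  xget 1%g [set x | X x /\ phi x = ((h (piece_index y))^-1 * y)%g].

Lemma coveredP J y :
  covered J y <-> exists2 j, (j < J)%N & Ypiece j ((h j)^-1 * y)%g.
Proof.
elim: J => [|J IH] /=; first by split=> // -[].
split=> [[/IH[j jJ Yj]|[y' Yy' <-]]|[j]].
- by exists j => //; rewrite ltnS ltnW.
- by exists J => //; rewrite mulKg.
- rewrite ltnS leq_eqVlt => /predU1P[->|jJ] Yj.
    by right; exists ((h J)^-1 * y)%g => //; rewrite mulVKg.
  by left; apply/IH; exists j.
Qed.

Lemma covered_mono i j y : (i <= j)%N -> covered i y -> covered j y.
Proof.
move=> ij /coveredP[k ki Yk]; apply/coveredP; exists k => //.
exact: leq_trans ki ij.
Qed.

Lemma range_covered j y : range phi ((h j)^-1 * y)%g -> covered j.+1 y.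
Proof.
move=> Yy; have [?|nc] := pselect (covered j y); first by left.
by apply/coveredP; exists j => //; split=> //=; rewrite mulVKg.
Qed.

Lemma Ypiece_uniq i j y :
  Ypiece i ((h i)^-1 * y)%g -> Ypiece j ((h j)^-1 * y)%g -> i = j.
Proof.
wlog: i j / (i < j)%N => [hw Yi Yj|ij Yi [_] /=].
  by case: (ltngtP i j) => // ij; [exact: hw|apply/esym/hw].
by rewrite mulVKg => -[]; apply/coveredP; exists i.
Qed.

Lemma Ypiece_ex y : exists j, Ypiece j ((h j)^-1 * y)%g.
Proof.
have [k hk] := enumeration_surj E (y * (phi 1)^-1)%g.
have /coveredP[j _ Yj] : covered k.+1 y.
  by apply: range_covered; rewrite hk invgM invgK mulgVK; exists 1%g.
by exists j.
Qed.

Lemma piece_indexP y :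
  Ypiece (piece_index y) ((h (piece_index y))^-1 * y)%g.
Proof. exact: (xgetPex 0%N (Ypiece_ex y)). Qed.

Lemma piece_indexE j y : Ypiece j ((h j)^-1 * y)%g -> piece_index y = j.
Proof. by move=> Yj; apply: Ypiece_uniq Yj; exact: piece_indexP. Qed.

Lemma Ypiece_Xpiece j y : Ypiece j y -> exists2 x, Xpiece j x & phi x = y.
Proof.
move=> Yj; have [_ _ surj] := section_bij E.
by have [x Xx xy] := surj _ Yj.1; exists x => //; split=> //=; rewrite xy.
Qed.

Lemma Xpiece_ex y : exists j x, Xpiece j x /\ y = (h j * phi x)%g.
Proof.
have [x Xx xy] := Ypiece_Xpiece (piece_indexP y).
by exists (piece_index y), x; split=> //; rewrite xy mulVKg.
Qed.

Lemma section_inj x x' : X x -> X x' -> phi x = phi x' -> x = x'.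
Proof.
by have [_ inj _] := section_bij E => Xx Xx'; apply: inj; rewrite inE.
Qed.

End Pieces.

Section CoarseFacts.
Variables (G H : groupType) (phi : G -> H).

Definition coarse_fibre (c : H) : set G :=
  [set (p.1 * p.2^-1)%g | p in [set p | phi p.1 = (c * phi p.2)%g]].

Lemma coarse_fibre_finite c :
  coarse_embedding phi -> finite_set (coarse_fibre c).
Proof.
move=> emb; apply/emb; apply: (sub_finite_set _ (finite_set1 c)).
by move=> _ [p /= pc <-]; rewrite pc mulgK.
Qed.

Definition coarse_shift (g : G) : set H :=
  [set (phi (g * x) * (phi x)^-1)%g | x in [set: G]].

Lemma coarse_shift_finite g :
  coarse_embedding phi -> finite_set (coarse_shift g).
Proof.
move=> emb; have := (emb [set p | p.1 = (g * p.2)%g]).1.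
have fin1 : finite_set [set (s.1 * s.2^-1)%g | s in [set p : G * G | p.1 = (g * p.2)%g]].
  apply: (sub_finite_set _ (finite_set1 g)) => _ [p /= pc <-].
  by rewrite pc mulgK.
move=> /(_ fin1); apply: sub_finite_set => _ [x _ <-].
by exists ((g * x)%g, x).
Qed.

End CoarseFacts.

Section Piecewise.
Variables (R : pzRingType) (W : lmodType R).

Lemma restr_in T (A : set T) (f : T -> W) x : A x -> restr A f x = f x.
Proof. by move=> Ax; rewrite /restr mem_set. Qed.

Lemma restr_out T (A : set T) (f : T -> W) x : ~ A x -> restr A f x = 0.
Proof. by move=> Ax; rewrite /restr memNset. Qed.

Lemma restrD T (A : set T) (f g : T -> W) :
  restr A (f + g) = restr A f + restr A g.
Proof.
apply/funext => x; rewrite (_ : (_ + _) x = restr A f x + restr A g x)//.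
by rewrite /restr; case: ifP => // _; rewrite addr0.
Qed.

Lemma restrZ T (A : set T) a (f : T -> W) : restr A (a *: f) = a *: restr A f.
Proof.
apply/funext => x; rewrite (_ : (_ *: _) x = a *: restr A f x)//.
by rewrite /restr; case: ifP => // _; rewrite scaler0.
Qed.

Lemma restr_id T (A : set T) (f : T -> W) : restr A (restr A f) = restr A f.
Proof. by apply/funext => x; rewrite /restr; case: ifP => // ->. Qed.

Lemma resmod_piecewise (G : groupType) (N : resmod W G) (S : set (G -> W)) F :
  finite_set S -> (forall f, S f -> f \in N) ->
  (forall x, F x = 0 \/ exists2 f, S f & F x = f x) -> F \in N.
Proof.
move=> /finite_seqP[s ->]; elim: s F => [|f s IH] F sN sF.
  suff -> : F = 0 by exact: rpred0.
  by apply/funext => x; have [->//|[]] := sF x.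
set A := [set x | F x = f x].
have -> : F = restr A f + restr (~` A) F.
  apply/funext => x; rewrite (_ : (_ + _) x = restr A f x + restr (~` A) F x)//.
  have [Ax|nAx] := pselect (A x).
    by rewrite restr_in// restr_out ?addr0// => -[].
  by rewrite restr_out// restr_in// add0r.
rewrite rpredD//; first by apply/resmod_restr/sN; rewrite /= mem_head.
apply: IH => [f' sf'|x]; first by apply: sN; rewrite /= in_cons sf' orbT.
have [Ax|nAx] := pselect (A x); first by left; rewrite restr_out// => -[].
rewrite restr_in//; have [|[f']] := sF x; first by left.
by rewrite /= in_cons => /predU1P[->//|sf'] ?; right; exists f'.
Qed.

Lemma pushf_inj_in (A B : choiceType) (phi : A -> B) (X : set A) F x :
  {in X &, injective phi} -> X x -> pushf phi (restr X F) (phi x) = F x :> W.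
Proof.
move=> inj Xx; rewrite /pushf -(fsbig_widen [set x]).
- by rewrite fsbig_set1 restr_in.
- by move=> _ ->.
- move=> x' [/= x'x nx']; apply: restr_out => Xx'; apply: nx'.
  by apply: inj; rewrite ?inE.
Qed.

Lemma pushf_out (A B : choiceType) (phi : A -> B) (F : A -> W) y :
  (forall x, phi x = y -> F x = 0) -> pushf phi F y = 0.
Proof. by move=> F0; rewrite /pushf fsbig1. Qed.

End Piecewise.

Section Assembly.
Variables (R : pzRingType) (W : lmodType R) (G H : groupType).
Variables (phi : G -> H) (emb : coarse_embedding phi) (E : choices phi).
Local Notation h := (enumeration E).

Lemma Xpiece_inj j : {in Xpiece E j &, injective phi}.
Proof. by move=> x x'; rewrite !inE => -[Xx _] [Xx' _]; exact: section_inj Xx Xx'. Qed.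

(* the j-th component of a function on [H], as a function on [X_j] *)
Definition component (j : nat) (F : H -> W) : G -> W :=
  restr (Xpiece E j) (pullf phi (translate (h j)^-1%g F)).

Lemma component_in j F x : Xpiece E j x -> component j F x = F (h j * phi x)%g.
Proof. by move=> Xx; rewrite /component restr_in// /pullf /translate /= invgK. Qed.

Lemma component_out j F x : ~ Xpiece E j x -> component j F x = 0.
Proof. exact: restr_out. Qed.

Lemma component_linear j a F F' :
  component j (a *: F + F') = a *: component j F + component j F'.
Proof.
apply/funext => x.
rewrite (_ : (_ + _) x = a *: component j F x + component j F' x)//.
have [Xx|nXx] := pselect (Xpiece E j x); first by rewrite !component_in.
by rewrite !component_out// scaler0 addr0.
Qed.

Lemma Xpiece_Ypiece j x : Xpiece E j x -> Ypiece E j ((h j)^-1 * (h j * phi x))%g.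
Proof. by move=> [_ Yx]; rewrite mulKg. Qed.

(* [h_j . phi_*] of the j-th component is the restriction to [h_j Y_j] *)
Lemma push_componentE j F :
  translate (h j) (pushf phi (component j F)) =
  restr [set y | Ypiece E j ((h j)^-1 * y)%g] F.
Proof.
apply/funext => y; rewrite /translate.
have [Yy|nYy] := pselect (Ypiece E j ((h j)^-1 * y)%g).
  rewrite restr_in//; have [x Xx xy] := Ypiece_Xpiece Yy.
  rewrite -xy /component pushf_inj_in//; last exact: Xpiece_inj.
  by rewrite /pullf /translate /= invgK xy mulVKg.
rewrite restr_out// pushf_out// => x xy; rewrite component_out// => -[_ /=].
by rewrite /preimage /= xy.
Qed.

Lemma covered_translate k J : exists J', forall y,
  covered E J (k^-1 * y)%g -> covered E J' y.
Proof.
elim: J => [|J [J' cJ]]; first by exists 0%N.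
have [l hl] := enumeration_surj E (k * h J)%g.
exists (maxn J' l.+1) => y /coveredP[j].
rewrite ltnS leq_eqVlt => /predU1P[->|jJ] Yj.
  apply: (@covered_mono _ _ _ _ l.+1); first exact: leq_maxr.
  apply: range_covered; rewrite hl invgM -mulgA.
  by case: Yj.
apply: (@covered_mono _ _ _ _ J'); first exact: leq_maxl.
by apply: cJ; apply/coveredP; exists j.
Qed.

Section Push.
Variable L : resmod W G.

Definition assembled_pred : {pred H -> W} :=
  [pred F | `[< (exists J, forall y, F y != 0 -> covered E J y) /\
                (forall j, component j F \in L) >]].

Lemma assembled_predP F : F \in assembled_pred <->
  (exists J, forall y, F y != 0 -> covered E J y) /\
  (forall j, component j F \in L).
Proof. by split=> [/asboolP|?]; last exact/asboolP. Qed.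

Lemma assembled_closed : GRing.subsemimod_closed assembled_pred.
Proof.
apply: closed_of_linear => [|a F F'].
  apply/assembled_predP; split; first by exists 0%N => y; rewrite eqxx.
  move=> j; rewrite (_ : component j 0 = 0) ?rpred0//.
  by apply/funext => x; rewrite /component /restr; case: ifP.
move=> /assembled_predP[[J FJ] FL] /assembled_predP[[J' FJ'] FL'].
apply/assembled_predP; split; last first.
  by move=> j; rewrite component_linear rpredD// rpredZ.
exists (maxn J J') => y.
rewrite (_ : (_ + _) y = a *: F y + F' y)//.
have [->|/FJ/covered_mono] := eqVneq (F y) 0; last first.
  by move=> + _; apply; exact: leq_maxl.
rewrite scaler0 add0r => /FJ'/covered_mono; apply; exact: leq_maxr.
Qed.

HB.instance Definition _ :=
  GRing.isSubmodClosed.Build R _ assembled_pred assembled_closed.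

Lemma assembled_translate k F :
  F \in assembled_pred -> translate k F \in assembled_pred.
Proof.
move=> /assembled_predP[[J FJ] FL]; apply/assembled_predP; split.
  have [J' cJ'] := covered_translate k J.
  by exists J' => y /FJ/cJ'.
move=> l; pose c j := ((h j)^-1 * (k^-1 * h l))%g.
apply: (@resmod_piecewise _ _ _ _ (\bigcup_(j in `I_J)
   [set translate e^-1%g (component j F) | e in coarse_fibre phi (c j)])).
- apply: bigcup_finite; first exact: finite_II.
  by move=> j _; apply: finite_image; exact: coarse_fibre_finite.
- by move=> _ [j _ [e _ <-]]; exact: resmod_translate.
- move=> x; have [Xx|nXx] := pselect (Xpiece E l x); last first.
    by left; rewrite component_out.
  rewrite component_in// /translate.
  have [->|/FJ/coveredP[j jJ Yj]] := eqVneq (F (k^-1 * (h l * phi x))%g) 0.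
    by left.
  right; have [x' Xx' x'E] := Ypiece_Xpiece Yj.
  exists (translate (x' * x^-1)^-1%g (component j F)).
    exists j => //; exists (x' * x^-1)%g => //; exists (x', x) => //=.
    by rewrite x'E /c !mulgA.
  rewrite /translate invgK mulgVK component_in// x'E.
  by rewrite mulVKg.
Qed.

Lemma assembled_restr A F : F \in assembled_pred -> restr A F \in assembled_pred.
Proof.
move=> /assembled_predP[[J FJ] FL]; apply/assembled_predP; split.
  exists J => y; have [Ay|nAy] := pselect (A y); first by rewrite restr_in// => /FJ.
  by rewrite restr_out// eqxx.
move=> j; have -> : component j (restr A F) =
    restr [set x | A (h j * phi x)%g] (component j F); last first.
  exact/resmod_restr/FL.
apply/funext => x; have [Xx|nXx] := pselect (Xpiece E j x); last first.
  rewrite component_out//; have [Ax|nAx] := pselect (A (h j * phi x)%g).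
    by rewrite restr_in// component_out.
  by rewrite restr_out.
rewrite component_in//; have [Ax|nAx] := pselect (A (h j * phi x)%g).
  by rewrite !restr_in// component_in.
by rewrite !restr_out.
Qed.

Definition assembled : resmod W H := ResMod assembled_translate assembled_restr.

Lemma pushf_assembled f : f \in L -> pushf phi f \in assembled.
Proof.
move=> fL; apply/assembled_predP; split.
  exists 1%N => y; have [Yy _|nYy] := pselect (range phi y).
    by apply: range_covered; rewrite enumeration0 invg1 mul1g.
  by rewrite pushf_out ?eqxx// => x xy; case: nYy; exists x.
move=> j; set c := h j.
have finD := coarse_fibre_finite c emb.
pose B e := [set x | Xpiece E j x /\ phi (e * x)%g = (c * phi x)%g].
have -> : component j (pushf phi f) =
    \sum_(e <- fset_set (coarse_fibre phi c)) restr (B e) (translate e^-1%g f).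
  apply/funext => x; rewrite fct_sumE.
  have [Xx|nXx] := pselect (Xpiece E j x); last first.
    by rewrite component_out// big1// => e _; rewrite restr_out// => -[].
  rewrite component_in// -/c /pushf -fsbig_finite//.
  rewrite (@reindex_fsbig _ _ _ _ _ (fun e => (e * x)%g)
    (coarse_fibre phi c `&` [set e | phi (e * x)%g = (c * phi x)%g])).
    rewrite fsbig_mkcondr; apply: eq_fsbigr => e _.
    rewrite /restr (_ : (x \in B e) = (e \in [set e | phi (e * x)%g = (c * phi x)%g])).
      by case: ifP => // _; rewrite /translate invgK.
    by apply/idP/idP; rewrite !inE => // -[].
  split=> [e [_]//|e e' _ _ /mulIg//|x' /= x'E].
  exists (x' * x^-1)%g; last by rewrite mulgVK.
  by split; [exists (x', x)|rewrite /= mulgVK].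
by apply: rpred_sum => e _; apply/resmod_restr/resmod_translate.
Qed.

Lemma push_assembled F : F \in push phi L -> F \in assembled.
Proof. by move=> /push_predP; apply; exact: pushf_assembled. Qed.

End Push.

Section PullInverse.
Variable L : resmod W G.

(* the function equal to [h_j . phi_*(f_j)] on [h_j Y_j] *)
Definition glue (f : nat -> G -> W) : H -> W :=
  fun y => translate (h (piece_index E y)) (pushf phi (f (piece_index E y))) y.

Lemma glueE (f : nat -> G -> W) j x :
  (forall j, restr (Xpiece E j) (f j) = f j) -> Xpiece E j x ->
  glue f (h j * phi x)%g = f j x.
Proof.
move=> fX Xx; rewrite /glue (piece_indexE (Xpiece_Ypiece Xx)) /translate mulKg.
by rewrite -[in LHS]fX pushf_inj_in//; exact: Xpiece_inj.
Qed.

Lemma glue_pullinv (f : nat -> G -> W) :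
  (forall j, restr (Xpiece E j) (f j) = f j) -> (forall j, f j \in L) ->
  glue f \in pullinv phi L.
Proof.
move=> fX fL; apply/pullinv_predP => k.
have [l hl] := enumeration_surj E k^-1%g.
pose c j := ((h j)^-1 * h l)%g.
apply: (@resmod_piecewise _ _ _ _ (\bigcup_(j in `I_l.+1)
   [set translate e^-1%g (f j) | e in coarse_fibre phi (c j)])).
- apply: bigcup_finite; first exact: finite_II.
  by move=> j _; apply: finite_image; exact: coarse_fibre_finite.
- by move=> _ [j _ [e _ <-]]; exact: resmod_translate.
- move=> x; right; rewrite /pullf /translate /= -hl.
  have /coveredP[j jl Yj] : covered E l.+1 (h l * phi x)%g.
    by apply: range_covered; rewrite mulKg; exists x.
  have [x' Xx' x'E] := Ypiece_Xpiece Yj.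
  exists (translate (x' * x^-1)^-1%g (f j)).
    exists j => //; exists (x' * x^-1)%g => //; exists (x', x) => //=.
    by rewrite x'E /c mulgA.
  rewrite /translate invgK mulgVK -(glueE fX Xx') x'E.
  by rewrite mulVKg.
Qed.

Lemma pullinv_component F : F \in pullinv phi L ->
  (forall j, component j F \in L) /\ glue (component^~ F) = F.
Proof.
move=> /pullinv_predP FL; split=> [j|]; first exact/resmod_restr/FL.
have cX j : restr (Xpiece E j) (component j F) = component j F.
  by apply/funext => x; rewrite /component /restr; case: ifP => // ->.
apply/funext => y; have [x Xx xy] := Ypiece_Xpiece (piece_indexP E y).
have -> : y = (h (piece_index E y) * phi x)%g by rewrite xy mulVKg.
by rewrite glueE// component_in.
Qed.

End PullInverse.
End Assembly.

(* A finite partition of [G] into pieces on which [phi] is, up to translations,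
   its restriction to the section; the pieces may be empty. *)
Record section_partition (G H : groupType) (phi : G -> H) (E : choices phi) := SectionPartition {
  pieces : nat;
  piece : 'I_pieces.+1 -> set G;
  piece_trivIset : trivIset setT piece;
  piece_cover : \bigcup_i piece i = setT;
  shiftG : 'I_pieces.+1 -> G;
  shiftH : 'I_pieces.+1 -> H;
  piece_section : forall i x, piece i x -> section_set E (shiftG i * x)%g;
  piece_shift : forall i x, piece i x ->
    phi x = (shiftH i * phi (shiftG i * x))%g;
  piece0 : piece ord0 = section_set E;
  shiftG0 : shiftG ord0 = 1%g;
  shiftH0 : shiftH ord0 = 1%g }.

Arguments piece {G H phi E} _ _ _.
Arguments shiftG {G H phi E} _ _.
Arguments shiftH {G H phi E} _ _.

Section Partitioned.
Variables (R : pzRingType) (W : lmodType R) (G H : groupType).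
Variables (phi : G -> H) (emb : coarse_embedding phi) (E : choices phi).
Variables (P : section_partition E) (M : resmod W H).

Lemma piece_inj i : {in piece P i &, injective phi}.
Proof.
move=> x x'; rewrite !inE => Zx Zx'.
rewrite (piece_shift Zx) (piece_shift Zx') => /mulgI.
move/(section_inj (piece_section Zx) (piece_section Zx')); exact: mulgI.
Qed.

Lemma piece_ex x : exists i, piece P i x.
Proof.
have [i _ Zi] : (\bigcup_i piece P i) x by rewrite piece_cover.
by exists i.
Qed.

Definition spread i (F : G -> W) : H -> W := pushf phi (restr (piece P i) F).

Lemma spread_in i F x : piece P i x -> spread i F (phi x) = F x.
Proof. by move=> Zx; rewrite /spread pushf_inj_in//; exact: piece_inj. Qed.

Lemma spread_out i F y : ~ (phi @` piece P i) y -> spread i F y = 0.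
Proof.
move=> nZ; rewrite /spread pushf_out// => x xy; rewrite restr_out// => Zx.
by apply: nZ; exists x.
Qed.

Definition spread_pred : {pred G -> W} :=
  [pred F | `[< forall i, spread i F \in M >]].

Lemma spread_predP F : F \in spread_pred <-> forall i, spread i F \in M.
Proof. by split=> [/asboolP|?]; last exact/asboolP. Qed.

Lemma spread_closed : GRing.subsemimod_closed spread_pred.
Proof.
apply: closed_of_linear => [|a F F' /spread_predP FM /spread_predP FM'].
  apply/spread_predP => i; rewrite (_ : spread i 0 = 0) ?rpred0//.
  apply/funext => y; rewrite /spread pushf_out// => x _.
  by rewrite /restr; case: ifP.
apply/spread_predP => i.
rewrite (_ : spread _ _ = a *: spread i F + spread i F') ?rpredD ?rpredZ//.
apply/funext => y; rewrite (_ : (_ + _) y = a *: spread i F y + spread i F' y)//.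
have [[x Zx <-]|nZ] := pselect ((phi @` piece P i) y).
  by rewrite !spread_in.
by rewrite !spread_out// scaler0 addr0.
Qed.

HB.instance Definition _ :=
  GRing.isSubmodClosed.Build R _ spread_pred spread_closed.

Lemma spread_translate g F : F \in spread_pred -> translate g F \in spread_pred.
Proof.
move=> /spread_predP FM; apply/spread_predP => i.
apply: (@resmod_piecewise _ _ _ _ (\bigcup_(k in [set: 'I_(pieces P).+1])
   [set translate c^-1%g (spread k F) | c in coarse_shift phi g^-1%g])).
- apply: bigcup_finite; first exact: finite_finset.
  by move=> k _; apply: finite_image; exact: coarse_shift_finite.
- by move=> _ [k _ [c _ <-]]; exact: resmod_translate.
- move=> y; have [[x Zx <-]|nZ] := pselect ((phi @` piece P i) y); last first.
    by left; rewrite spread_out.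
  right; have [k Zk] := piece_ex (g^-1 * x)%g.
  exists (translate (phi (g^-1 * x) * (phi x)^-1)^-1%g (spread k F)).
    by exists k => //; exists (phi (g^-1 * x) * (phi x)^-1)%g => //; exists x.
  by rewrite spread_in// /translate invgK mulgVK spread_in.
Qed.

Lemma spread_restr A F : F \in spread_pred -> restr A F \in spread_pred.
Proof.
move=> /spread_predP FM; apply/spread_predP => i.
rewrite (_ : spread _ _ = restr (phi @` (piece P i `&` A)) (spread i F)).
  exact: resmod_restr.
apply/funext => y; have [[x Zx <-]|nZ] := pselect ((phi @` piece P i) y).
  rewrite spread_in//; have [Ax|nAx] := pselect (A x).
    by rewrite !restr_in ?spread_in//; exists x.
  rewrite !restr_out// => -[x' [Zx' Ax'] x'x]; apply: nAx.
  by rewrite -(@piece_inj i x' x) ?inE.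
by rewrite /restr !spread_out//; case: ifP.
Qed.

Definition spreadable : resmod W G := ResMod spread_translate spread_restr.

Lemma pull_spread F : F \in pull phi M ->
  (forall i, spread i F \in M) /\
  F = \sum_i restr (piece P i) (pullf phi (spread i F)).
Proof.
move=> /pull_predP FM.
have /spread_predP FS : F \in spreadable.
  apply: FM => f fM; apply/spread_predP => i.
  have -> : spread i (pullf phi f) = restr (phi @` piece P i) f; last first.
    exact: resmod_restr.
  apply/funext => y; have [[x Zx <-]|nZ] := pselect ((phi @` piece P i) y).
    by rewrite spread_in// restr_in//; exists x.
  by rewrite spread_out// restr_out.
split=> //; apply/funext => x; rewrite fct_sumE.
have [i Zi] := piece_ex x; rewrite (bigD1 i)//= restr_in// /pullf /= spread_in//.
rewrite big1 ?addr0// => k /eqP ki; rewrite restr_out// => Zk; apply: ki.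
by apply: (@piece_trivIset _ _ _ _ P) => //; exists x.
Qed.

End Partitioned.

Lemma continuous_into_prod (X : topologicalType) (I : Type)
    (K : I -> topologicalType) (g : X -> prod_topology K) :
  (forall i, continuous (fun x => g x i)) -> continuous g.
Proof.
move=> cg x; apply/cvg_sup => i.
exact: (@continuous_comp_initial _ _ _ (fun f : prod_topology K => f i) g (cg i)).
Qed.

Lemma continuous_proj (I : eqType) (K : I -> topologicalType) (i : I) :
  continuous (fun f : prod_topology K => f i).
Proof. exact: (@proj_continuous I K i). Qed.

Lemma continuous_compose (X Y Z : topologicalType) (f : X -> Y) (g : Y -> Z) :
  continuous f -> continuous g -> continuous (g \o f).
Proof. by move=> cf cg x; apply: continuous_comp; [exact: cf|exact: cg]. Qed.

Section TopologicalModules.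
Variables (R : pzRingType) (W : lmodType R).

(* A [res]-invariant module with a topology.  Only separate continuity of the
   operations is built in: it is what makes the closure of a submodule a
   submodule, and it holds for the finest topology on [push phi L], which
   need not be a vector space topology. *)
Record topmod (G : groupType) := TopMod {
  topmod_mod :> resmod W G;
  topmod_top : topology (submod topmod_mod);
  topmod_separately : separately_continuous topmod_top }.

Definition topmod_space (G : groupType) (L : topmod G) : Type :=
  top_space (topmod_top L).
HB.instance Definition _ G (L : topmod G) := Topological.on (topmod_space L).

Section Cut.
Variables (G : groupType) (L : topmod G) (A : set G).

(* [1_A . L], with the subspace topology *)
Definition cut : set (topmod_space L) :=
  [set f | exists g : submod L, val (f : submod L) = restr A (val g)].

Definition cut_space : topologicalType := set_type cut.

Definition cut_val (u : cut_space) : submod L := set_val u.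

Lemma cut_restr (u : cut_space) : restr A (val (cut_val u)) = val (cut_val u).
Proof.
by have [g ->] := set_mem (valP u); rewrite restr_id.
Qed.

Lemma cut_in (f : submod L) : restr A (val f) = val f ->
  (f : topmod_space L) \in cut.
Proof. by move=> fA; rewrite inE; exists f. Qed.

Lemma cutD_in (u v : cut_space) :
  (cut_val u + cut_val v : topmod_space L) \in cut.
Proof.
by apply: cut_in; rewrite submod_valD restrD !cut_restr.
Qed.

Lemma cutZ_in a (u : cut_space) : (a *: cut_val u : topmod_space L) \in cut.
Proof.
by apply: cut_in; rewrite submod_valZ restrZ cut_restr.
Qed.

Definition cutD (u v : cut_space) : cut_space :=
  exist (fun f => f \in cut) _ (cutD_in u v).
Definition cutZ a (u : cut_space) : cut_space :=
  exist (fun f => f \in cut) _ (cutZ_in a u).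

Lemma cut_val_continuous :
  continuous (cut_val : cut_space -> topmod_space L).
Proof. exact: initial_continuous. Qed.

Lemma cutD_continuous v : continuous (fun u => cutD u v).
Proof.
apply: continuous_comp_initial.
exact: continuous_compose cut_val_continuous ((topmod_separately L).1 (cut_val v)).
Qed.

Lemma cutZ_continuous a : continuous (cutZ a).
Proof.
apply: continuous_comp_initial.
exact: continuous_compose cut_val_continuous ((topmod_separately L).2 a).
Qed.

End Cut.
Section CutProduct.
Variables (G : groupType) (L : topmod G) (I : eqType) (A : I -> set G).

Definition cut_prod : topologicalType :=
  prod_topology (fun i => cut_space L (A i)).

Lemma cut_prodD_continuous (u : cut_prod) :
  continuous (fun s : cut_prod => (fun i => cutD (s i) (u i)) : cut_prod).
Proof.
apply: continuous_into_prod => i.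
exact: (continuous_compose (@continuous_proj _
  (fun i => cut_space L (A i)) i) (@cutD_continuous _ L (A i) (u i))).
Qed.

Lemma cut_prodZ_continuous a :
  continuous (fun s : cut_prod => (fun i => cutZ a (s i)) : cut_prod).
Proof.
apply: continuous_into_prod => i.
exact: (continuous_compose (@continuous_proj _
  (fun i => cut_space L (A i)) i) (@cutZ_continuous _ L (A i) a)).
Qed.

End CutProduct.

Section CutFinal.
Variables (G : groupType) (L : topmod G) (I : eqType) (A : I -> set G).
Variables (V : lmodType R) (f : cut_prod L A -> V).

Lemma cut_final_separately_continuous :
  (forall s u, f (fun i => cutD (s i) (u i)) = f s + f u) ->
  (forall a s, f (fun i => cutZ a (s i)) = a *: f s) ->
  (forall v, exists s, v = f s) ->
  separately_continuous (final_topology (fun _ : unit => f)).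
Proof.
move=> fD fZ fsurj; apply: final_separately_continuous => [v []|a []].
  have [u ->] := fsurj v; exists tt, (fun s i => cutD (s i) (u i)).
  by split=> [|s]; [exact: cut_prodD_continuous|rewrite fD].
exists (fun s i => cutZ a (s i)).
by split=> [|s]; [exact: cut_prodZ_continuous|rewrite fZ].
Qed.

End CutFinal.
End TopologicalModules.
Arguments topmod {R} W G.
Arguments cut {R W G} L A _.

Section InducedTopologies.
Variables (R : pzRingType) (W : lmodType R) (G H : groupType).
Variables (phi : G -> H) (emb : coarse_embedding phi) (E : choices phi).
Local Notation h := (enumeration E).

Section Push.
Variable L : topmod W G.

Lemma push_term_in j (f : submod L) :
  translate (h j) (pushf phi (val f)) \in push phi L.
Proof. exact/resmod_translate/pushf_push/submodP. Qed.

Definition push_term j (f : submod L) : submod (push phi L) :=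
  Submod (push_term_in j f).

Definition push_source (J : nat) : topologicalType :=
  cut_prod L (fun j : 'I_J.+1 => Xpiece E j).

(* [(f_j)_j |-> sum_j h_j . phi_*(f_j)] *)
Definition push_sum (J : nat) (f : push_source J) : submod (push phi L) :=
  \sum_(j < J.+1) push_term j (cut_val (f j)).

Definition push_top : topology (submod (push phi L)) := final_topology push_sum.

Lemma push_term_component j (F : H -> W) (f : submod L) :
  val f = component E j F ->
  val (push_term j f) = restr [set y | Ypiece E j ((h j)^-1 * y)%g] F.
Proof. by move=> fF; rewrite -push_componentE -fF. Qed.

Lemma pushf_Xpiece_linear j a (f g : G -> W) :
  restr (Xpiece E j) f = f -> restr (Xpiece E j) g = g ->
  pushf phi (a *: f + g) = a *: pushf phi f + pushf phi g.
Proof.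
move=> fX gX; apply/funext => y.
rewrite (_ : (_ + _) y = a *: pushf phi f y + pushf phi g y)//.
have [[x Xx <-]|nX] := pselect ((phi @` Xpiece E j) y).
  rewrite -fX -gX -restrZ -restrD.
  by rewrite !(pushf_inj_in _ (@Xpiece_inj _ _ _ E j)).
have out f' : restr (Xpiece E j) f' = f' -> pushf phi f' y = 0.
  by move=> <-; apply: pushf_out => x xy; rewrite restr_out// => Xx;
    apply: nX; exists x.
by rewrite !out ?scaler0 ?addr0// restrD restrZ fX gX.
Qed.

Lemma push_term_linear j a (u v : cut_space L (Xpiece E j)) :
  push_term j (a *: cut_val u + cut_val v) =
  a *: push_term j (cut_val u) + push_term j (cut_val v).
Proof.
apply: val_inj; rewrite submod_valD submod_valZ.
rewrite [LHS](_ : _ =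
  translate (h j) (pushf phi (val (a *: cut_val u + cut_val v))))//.
by rewrite submod_valD submod_valZ (@pushf_Xpiece_linear j) ?cut_restr.
Qed.

Lemma push_termZ j a (u : cut_space L (Xpiece E j)) :
  push_term j (a *: cut_val u) = a *: push_term j (cut_val u).
Proof.
have t0 : push_term j 0 = 0.
  by have := push_term_linear (-1) u u; rewrite !scaleN1r !addNr.
have := push_term_linear a u (cutZ 0 u).
by rewrite (_ : cut_val (cutZ 0 u) = 0 *: cut_val u)// scale0r t0 !addr0.
Qed.

Lemma component_in_L j (v : submod (push phi L)) : component E j (val v) \in L.
Proof.
by have /assembled_predP[_] := push_assembled emb E (submodP v); exact.
Qed.

Lemma component_in_cut j (v : submod (push phi L)) :
  (Submod (component_in_L j v) : topmod_space L) \in cut L (Xpiece E j).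
Proof. by apply: cut_in; rewrite restr_id. Qed.

Definition component_cut (v : submod (push phi L)) j :
    cut_space L (Xpiece E j) :=
  exist (fun f => f \in cut L (Xpiece E j)) _ (component_in_cut j v).

Lemma push_sum_surj (v : submod (push phi L)) :
  exists J0, forall J, (J0 <= J)%N ->
    v = push_sum (fun j : 'I_J.+1 => component_cut v j).
Proof.
have /assembled_predP[[J0 vJ0] _] := push_assembled emb E (submodP v).
exists J0 => J J0J; apply: val_inj; rewrite /push_sum submod_val_sum.
apply/funext => y; rewrite fct_sumE.
under eq_bigr => j _ do rewrite (@push_term_component _ (val v))//.
have [vy|vy] := eqVneq (val v y) 0.
  by rewrite [LHS]vy big1// => j _; rewrite /restr; case: ifP.
have /coveredP[j0 j0J Yj0] := vJ0 _ vy.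
have j0J' : (j0 < J.+1)%N by rewrite ltnS ltnW// (leq_trans j0J).
rewrite (bigD1 (Ordinal j0J'))//= restr_in// big1 ?addr0// => j /eqP jj0.
rewrite restr_out// => Yj; apply: jj0; apply: val_inj.
exact: Ypiece_uniq Yj Yj0.
Qed.

Lemma push_sum_widen J J' (s : push_source J) : (J <= J')%N ->
  push_sum s = \sum_(j < J'.+1) (if pselect ((j : nat) < J.+1)%N is left jJ
                                 then push_term j (cut_val (s (Ordinal jJ)))
                                 else 0).
Proof.
move=> JJ'; pose F j := if pselect (j < J.+1)%N is left jJ
                        then push_term j (cut_val (s (Ordinal jJ))) else 0.
have -> : push_sum s = \sum_(j < J.+1) F j.
  apply: eq_bigr => j _; rewrite /F; case: pselect => [jJ|/(_ (ltn_ord j))//].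
  by rewrite (_ : Ordinal jJ = j)//; exact: val_inj.
rewrite (big_ord_widen J'.+1 F)//.
rewrite big_mkcond; apply: eq_bigr => j _; rewrite /F.
by case: pselect => jJ; [rewrite jJ|case: ifP].
Qed.

Lemma push_separately_continuous : separately_continuous push_top.
Proof.
apply: final_separately_continuous => [v J|a J].
  have [J0 vE] := push_sum_surj v; set J' := maxn J0 J.
  pose k (s : push_source J) : push_source J' := fun j : 'I_J'.+1 =>
    if pselect ((j : nat) < J.+1)%N is left jJ
    then cutD (s (Ordinal jJ)) (component_cut v j) else component_cut v j.
  exists J', k; split.
    apply: continuous_into_prod => j; rewrite /k; case: pselect => jJ.
      exact: (continuous_compose (@continuous_proj _
        (fun j : 'I_J.+1 => cut_space L (Xpiece E j)) (Ordinal jJ))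
        (@cutD_continuous _ _ _ L (Xpiece E j) (component_cut v j))).
    exact: (@cst_continuous _ _ (component_cut v j)).
  move=> s; rewrite (push_sum_widen s (leq_maxr J0 J)) [in LHS](vE J') ?leq_maxl//.
  rewrite /push_sum -big_split; apply: eq_bigr => j _ /=; rewrite /k.
  case: pselect => jJ; last by rewrite add0r.
  have := push_term_linear 1 (s (Ordinal jJ)) (component_cut v j).
  by rewrite !scale1r.
exists (fun s j => cutZ a (s j)); split.
  exact: cut_prodZ_continuous.
move=> s; rewrite /push_sum scaler_sumr; apply: eq_bigr => j _.
exact/esym/push_termZ.
Qed.

Definition push_topmod : topmod W H := TopMod push_separately_continuous.

End Push.

Section PullInverse.
Variable L : topmod W G.

Definition pullinv_source : topologicalType := cut_prod L (Xpiece E).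

Lemma pullinv_glue_in (f : pullinv_source) :
  glue E (fun j => val (cut_val (f j))) \in pullinv phi L.
Proof.
apply: (glue_pullinv emb) => j; first exact: cut_restr.
exact: submodP.
Qed.

Definition pullinv_glue (f : pullinv_source) : submod (pullinv phi L) :=
  Submod (pullinv_glue_in f).

(* [pullinv_glue] is a bijection, so this is the topology that makes it a
   homeomorphism *)
Definition pullinv_top : topology (submod (pullinv phi L)) :=
  final_topology (fun _ : unit => pullinv_glue).

Lemma pullinv_glueE (f : pullinv_source) j x : Xpiece E j x ->
  val (pullinv_glue f) (h j * phi x)%g = val (cut_val (f j)) x.
Proof. by move=> Xx; apply: glueE => // i; exact: cut_restr. Qed.

Lemma pullinv_separately_continuous : separately_continuous pullinv_top.
Proof.
apply: cut_final_separately_continuous => [s u|a s|v].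
- apply: val_inj; rewrite submod_valD; apply/funext => y.
  have [j [x [Xx ->]]] := Xpiece_ex E y.
  rewrite (_ : (_ + _) (h j * phi x)%g = val (pullinv_glue s) (h j * phi x)%g
    + val (pullinv_glue u) (h j * phi x)%g)//.
  by rewrite !pullinv_glueE.
- apply: val_inj; rewrite submod_valZ; apply/funext => y.
  have [j [x [Xx ->]]] := Xpiece_ex E y.
  rewrite (_ : (_ *: _) (h j * phi x)%g
    = a *: val (pullinv_glue s) (h j * phi x)%g)//.
  by rewrite !pullinv_glueE.
- have [vL vE] := pullinv_component E (submodP v).
  have vcut j : (Submod (vL j) : topmod_space L) \in cut L (Xpiece E j).
    by apply: cut_in; rewrite restr_id.
  exists (fun j => exist (fun f => f \in cut L (Xpiece E j)) _ (vcut j)).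
  by apply: val_inj; rewrite -[LHS]vE.
Qed.

Definition pullinv_topmod : topmod W H := TopMod pullinv_separately_continuous.

End PullInverse.

Section Pull.
Variables (P : section_partition E) (M : topmod W H).

Definition pull_source : topologicalType :=
  cut_prod M (fun i => phi @` piece P i).

Lemma pull_term_in i (f : submod M) :
  restr (piece P i) (pullf phi (val f)) \in pull phi M.
Proof. exact/resmod_restr/pullf_pull/submodP. Qed.

Definition pull_term i (f : submod M) : submod (pull phi M) :=
  Submod (pull_term_in i f).

(* [(f_i)_i |-> sum_i 1_(Z_i) . phi^*(f_i)] *)
Definition pull_sum (f : pull_source) : submod (pull phi M) :=
  \sum_i pull_term i (cut_val (f i)).

(* [pull_sum] is a bijection, so this is the topology that makes it a
   homeomorphism *)
Definition pull_top : topology (submod (pull phi M)) :=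
  final_topology (fun _ : unit => pull_sum).

Lemma pull_separately_continuous : separately_continuous pull_top.
Proof.
apply: cut_final_separately_continuous => [s u|a s|v].
- rewrite /pull_sum -big_split; apply: eq_bigr => i _; apply: val_inj.
  by rewrite submod_valD -[RHS]restrD.
- rewrite /pull_sum scaler_sumr; apply: eq_bigr => i _; apply: val_inj.
  by rewrite submod_valZ -[RHS]restrZ.
- have [vM vE] := pull_spread emb P (submodP v).
  have vcut i : (Submod (vM i) : topmod_space M) \in cut M (phi @` piece P i).
    apply: cut_in; apply/funext => y.
    have [Zy|nZ] := pselect ((phi @` piece P i) y); first by rewrite restr_in.
    by rewrite restr_out//= spread_out.
  exists (fun i => exist (fun f => f \in cut M (phi @` piece P i)) _ (vcut i)).
  by apply: val_inj; rewrite /pull_sum submod_val_sum -[RHS]vE.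
Qed.

Definition pull_topmod : topmod W G := TopMod pull_separately_continuous.

End Pull.
End InducedTopologies.

Section ReducedHomology.
Variables (R : comPzRingType) (W : lmodType R) (G : groupType) (L : topmod W G).
Variable n : nat.

Definition slices : Type := prod_topology (fun _ : n.-tuple G => topmod_space L).
HB.instance Definition _ := Topological.on slices.

Definition chain_slices (f : chains L n) : slices :=
  fun g => Submod (chain_slice f g).
Definition cochain_slices (f : cochains L n) : slices :=
  fun g => Submod (cochain_slice f g).

(* pointwise convergence *)
Definition chain_top : topology (chains L n) :=
  topology_of (initial_topology chain_slices).
Definition cochain_top : topology (cochains L n) :=
  topology_of (initial_topology cochain_slices).

Lemma slices_separately_continuous (V : lmodType R) (s : V -> slices) :
  (forall u v, s (u + v) = fun g => (s u g : submod L) + s v g) ->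
  (forall a u, s (a *: u) = fun g => a *: (s u g : submod L)) ->
  separately_continuous (topology_of (initial_topology s)).
Proof.
move=> sD sZ; set T := initial_topology s.
have cT (f : V -> V) (k : n.-tuple G -> topmod_space L -> topmod_space L) :
    (forall g, continuous (k g)) -> (forall u, s (f u) = fun g => k g (s u g)) ->
    continuous (f : top_space (topology_of T) -> top_space (topology_of T)).
  move=> ck fk; suff : continuous (f : T -> T).
    by move=> /continuousP cf; apply/continuousP => A; exact: cf.
  apply: continuous_comp_initial; rewrite (_ : s \o f = fun u g => k g (s u g)).
    apply: continuous_into_prod => g.
    apply: (@continuous_compose T _ _ (fun u => s u g) (k g)) => //.
    apply: (@continuous_compose T slices _ s (fun e => e g)).
      exact: initial_continuous.
    exact: continuous_proj.
  by apply/funext => u; rewrite /= fk.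
split=> [v|a].
  apply: (cT _ (fun g u => (u : submod L) + s v g)) => // g.
  exact: (topmod_separately L).1.
apply: (cT _ (fun g u => a *: (u : submod L))) => // g.
exact: (topmod_separately L).2.
Qed.

Lemma chain_separately_continuous : separately_continuous chain_top.
Proof.
by apply: slices_separately_continuous => *; apply/funext => g; exact: val_inj.
Qed.

Lemma cochain_separately_continuous : separately_continuous cochain_top.
Proof.
by apply: slices_separately_continuous => *; apply/funext => g; exact: val_inj.
Qed.

Definition closed_boundaries : submodClosed (chains L n) :=
  closure_submod chain_separately_continuous (boundary_pred L n).
Definition closed_coboundaries : submodClosed (cochains L n) :=
  closure_submod cochain_separately_continuous (coboundary_pred L n).

Definition rhomology : lmodType R :=
  subquot (cycle_pred L n) closed_boundaries.
Definition rcohomology : lmodType R :=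
  subquot (cocycle_pred L n) closed_coboundaries.

Definition rhomology_space : topologicalType :=
  subquot_space chain_top (cycle_pred L n) closed_boundaries.
Definition rcohomology_space : topologicalType :=
  subquot_space cochain_top (cocycle_pred L n) closed_coboundaries.

End ReducedHomology.

Section InducedMaps.
Variables (R : pzRingType) (W : lmodType R) (A B : Type).
Variables (C : submodClosed (A -> W)) (C' : submodClosed (B -> W)).
Variables (Z N : submodClosed (submod C)) (Z' N' : submodClosed (submod C')).

(* [T], defined on functions, maps [Z] into [Z'] and [F] is the map it induces
   from [Z / N] to [Z' / N'] *)
Definition induces (T : (A -> W) -> (B -> W))
    (F : subquot Z N -> subquot Z' N') : Prop :=
  forall z : submod Z, exists2 z' : submod Z',
    val (val z') = T (val (val z)) & F (\pi z) = \pi z'.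

(* The coset of functions that a class is.  Classes with coefficients in two
   equal modules given by different constructions, such as
   [push psi (push phi L)] and [push (psi \o phi) L], are compared by it. *)
Definition coset (c : subquot Z N) : set (A -> W) :=
  [set val (val z) | z in [set z : submod Z | \pi z = c]].

End InducedMaps.

Section TopologicalNotions.

Definition topological_isomorphism (S T : topologicalType) (F : S -> T) : Prop :=
  exists2 F' : T -> S, cancel F F' /\ cancel F' F & continuous F /\ continuous F'.

Variables (R : comPzRingType) (tR : topology R).
Local Notation TR := (top_space tR).

Definition topological_field : Prop :=
  [/\ (1 : R) != 0 /\ (forall x : R, x != 0 -> exists y, x * y = 1),
      continuous (fun p : TR * TR => (p.1 : R) + p.2 : TR),
      continuous (fun p : TR * TR => (p.1 : R) * p.2 : TR),
      continuous (fun x : TR => - (x : R) : TR) &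
      forall inv : R -> R, (forall x, x != 0 -> x * inv x = 1) ->
        {within [set x : TR | (x : R) != 0], continuous (inv : TR -> TR)}].

Variables (W : lmodType R) (G : groupType) (L : topmod W G).
Local Notation TL := (topmod_space L).

Definition submod_translate (g : G) (f : submod L) : submod L :=
  Submod (resmod_translate g (submodP f)).
Definition submod_restr (A : set G) (f : submod L) : submod L :=
  Submod (resmod_restr A (submodP f)).

Definition topological_resmod : Prop :=
  [/\ continuous (fun p : TL * TL => (p.1 : submod L) + p.2 : TL),
      continuous (fun p : TR * TL => (p.1 : R) *: (p.2 : submod L) : TL),
      forall A, continuous (submod_restr A : TL -> TL) &
      forall g, continuous (submod_translate g : TL -> TL)].

End TopologicalNotions.

(* Main.v *)
Require Import Defs.
From HB Require Import structures.
From mathcomp Require Import all_boot all_algebra finmap.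
From mathcomp Require Import all_classical.
From mathcomp Require Import topology zify.

(* A point (x, g_1, ..., g_n) is the simplex with vertices x_0 = x and
   x_i = g_i^-1 x_(i-1), on which a map theta acts vertex by vertex.  As soon as
   theta is controlled and proper on the supports of the coefficients (for
   homology), or controlled on a family of sets that detects membership in the
   coefficients (for cohomology), it induces a map of complexes, and the prism
   over a simplex is a homotopy between the maps induced by two close maps.
   This applies to close coarse maps, and to omega, which is controlled on
   finite unions of the h_j Y_j only: omega o phi is close to the identity, and
   so is phi o omega on such unions.

   In cohomology all these maps are continuous.  In homology D_n(omega) is not
   continuous for pointwise convergence when n > 0, because infinitely many
   slices may be mapped to the same one.  However, reduced homology vanishes in
   positive degrees: if the group is infinite, appending to the simplices of a
   chain c the vertex k^-1 x_n, with k far away, gives a chain whose boundary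
   agrees up to sign with c on any prescribed finite set of slices; if the group
   is finite, coning off to a point contracts the complex.  There remains degree
   0, where phi_* : L -> phi_* L and omega_* are continuous.  The topologies of
   phi_* L, of phi'_* L and of iterated push-forwards are not compared directly:
   a cycle is in the closure of the boundaries if and only if its image under
   omega is so in D_0(L), which does not depend on the choices. *)

Set Implicit Arguments.
Unset Strict Implicit.
Unset Printing Implicit Defensive.

Import GRing.Theory.
Local Open Scope classical_set_scope.
Local Open Scope ring_scope.
Local Open Scope quotient_scope.

(** * Finite distance and push-forwards *)

(** Displacements are written [f x * (g x)^-1] because coefficient modules are stable under left
    translations and restrictions. If two maps have finitely many displacements on a set, this set
    splits into finitely many pieces on which the maps differ by a left translation, and
    push-forwards and pull-backs along one map can be rebuilt from those along the other. The family
    [bor] records the sets on which such finiteness is required: the supports of the coefficients in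
    homology; in cohomology all subsets of G, or the subsets of finite unions of the h_j Y_j in H,
    which suffice because membership in [pullinv] is decided on each h_j Y_j. The topology of
    [push_topmod] is final. Maps out of it are easy to control if they are additive with values in a
    module with continuous operations; maps into it are easy to control only if all supports stay in
    one finite union of the h_j Y_j. Its own addition is not known to be jointly continuous, so a
    map between push-forwards is replaced, up to a boundary on cycles, by one that passes through
    the original L. *)

Section Near.
Variables (A : Type) (B : groupType).
Implicit Types (S : set A) (f g h : A -> B).
Local Open Scope group_scope.

Definition near_on S f g : Prop := finite_set [set f x * (g x)^-1 | x in S].

Lemma near_refl S f : near_on S f f.
Proof.
apply: (sub_finite_set _ (finite_set1 1)) => _ [x _ <-] /=.
by rewrite mulgV.
Qed.

Lemma near_sym S f g : near_on S f g -> near_on S g f.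
Proof.
move=> /(finite_image (fun y => y^-1)); apply: sub_finite_set => _ [x Sx <-].
by exists (f x * (g x)^-1); [exists x|rewrite invgM invgK].
Qed.

Lemma near_trans S f g h : near_on S f g -> near_on S g h -> near_on S f h.
Proof.
move=> fg /(finite_image2 (fun x y => x * y) fg); apply: sub_finite_set.
move=> _ [x Sx <-]; exists (f x * (g x)^-1); first by exists x.
by exists (g x * (h x)^-1); [exists x|rewrite mulgA mulgVK].
Qed.

Lemma near_sub S S' f g : S `<=` S' -> near_on S' f g -> near_on S f g.
Proof. by move=> SS'; apply/sub_finite_set/image_subset. Qed.

Lemma near_eq S f f' g : (forall x, S x -> f x = f' x) -> near_on S f g ->
  near_on S f' g.
Proof.
move=> ff'; apply: sub_finite_set => _ [x Sx <-].
by exists x => //; rewrite ff'.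
Qed.

Lemma near_shift S f b : near_on S (fun x => b * f x) f.
Proof.
apply: (sub_finite_set _ (finite_set1 b)) => _ [x _ <-] /=.
by rewrite mulgK.
Qed.

Lemma near_bigcup S f g (T : nat -> set A) n :
  (forall x, S x -> exists2 j, (j < n)%N & T j x) ->
  (forall j, near_on (T j) f g) -> near_on S f g.
Proof.
move=> cov nT; apply: sub_finite_set (bigcup_finite (finite_II n) (fun j _ => nT j)).
by move=> _ [x Sx <-]; have [j jn Tx] := cov x Sx; exists j => //; exists x.
Qed.

End Near.

Lemma near_comp (A A' : Type) (B : groupType) (k : A' -> A) S (f g : A -> B) :
  near_on (k @` S) f g -> near_on S (f \o k) (g \o k).
Proof.
apply: sub_finite_set => _ [x Sx <-].
by exists (k x) => //; exists x.
Qed.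

Section Pushforward.
Variables (R : pzRingType) (W : lmodType R).

Definition supp (T : Type) (u : T -> W) : set T := [set x | u x != 0].

Lemma suppN T (u : T -> W) x : ~ supp u x -> u x = 0.
Proof. by move=> /negP/negPn/eqP. Qed.

Section Single.
Variables (A B : choiceType) (K : A -> B).
Implicit Types (S : set A) (u v : A -> W).

Definition proper_on S : Prop := forall b, finite_set (S `&` K @^-1` [set b]).

Lemma proper_on_sub S S' : S `<=` S' -> proper_on S' -> proper_on S.
Proof. by move=> SS' p b; apply: sub_finite_set (p b); exact: setSI. Qed.

(** Since [pushf] is 0 by default on a fibre with infinite support, its values are computed by
    exhibiting a finite part of the fibre that carries the support; [D] may be larger than the
    support. *)
Lemma pushfE u b (D : {fset A}) :
  (forall a, a \in D -> K a = b) -> (forall a, K a = b -> supp u a -> a \in D) ->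
  pushf K u b = \sum_(a <- D) u a.
Proof.
move=> DK KD; rewrite /pushf -(fsbig_widen [set` D]).
- by rewrite fsbig_finite ?set_fsetK.
- by move=> a /= /DK.
- by move=> a [/= Ka nD]; apply: contrapT => ua; apply/nD/KD => //; apply/eqP.
Qed.

Lemma pushf_proper u b : proper_on (supp u) ->
  pushf K u b = \sum_(a <- fset_set (supp u `&` K @^-1` [set b])) u a.
Proof.
move=> p; apply: pushfE => a; rewrite in_fset_set//.
  by rewrite inE => -[].
by move=> Ka ua; rewrite inE.
Qed.

Lemma pushf_linear a u v : proper_on (supp u) -> proper_on (supp v) ->
  pushf K (a *: u + v) = a *: pushf K u + pushf K v.
Proof.
move=> pu pv; apply/funext => b.
have fD : finite_set ((supp u `|` supp v) `&` K @^-1` [set b]).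
  by rewrite setIUl finite_setU.
have E w : supp w `<=` supp u `|` supp v -> pushf K w b =
    \sum_(x <- fset_set ((supp u `|` supp v) `&` K @^-1` [set b])) w x.
  move=> sw; apply: pushfE => x; rewrite in_fset_set//.
    by rewrite inE => -[].
  by move=> Kx /sw wx; rewrite inE.
rewrite (_ : (_ + _) b = a *: pushf K u b + pushf K v b)//.
rewrite (E u); last by left.
rewrite (E v); last by right.
rewrite E; last first.
  move=> x wx; apply: contrapT => /not_orP[nu nv]; move: wx.
  rewrite /supp /= (_ : (_ + _) x = a *: u x + v x)//.
  by rewrite (suppN nu) (suppN nv) scaler0 addr0 eqxx.
by rewrite scaler_sumr -big_split.
Qed.

Lemma pushf0 : pushf K (0 : A -> W) = 0.
Proof. by apply/funext => b; rewrite pushf_out. Qed.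

Lemma supp_linear S a u v : supp u `<=` S -> supp v `<=` S ->
  supp (a *: u + v) `<=` S.
Proof.
move=> uS vS x wx; apply: contrapT => nSx; move: wx; apply/negP/negPn/eqP.
rewrite (_ : (_ + _) x = a *: u x + v x)//.
have nu : ~ supp u x by move=> /uS.
have nv : ~ supp v x by move=> /vS.
by rewrite (suppN nu) (suppN nv) scaler0 addr0.
Qed.

Lemma proper_linear a u v : proper_on (supp u) -> proper_on (supp v) ->
  proper_on (supp (a *: u + v)).
Proof.
move=> pu pv; apply: (@proper_on_sub _ (supp u `|` supp v)).
  by apply: supp_linear; [left|right].
by move=> b; rewrite setIUl finite_setU.
Qed.

Lemma proper0 : proper_on (supp (0 : A -> W)).
Proof.
move=> b; apply: (sub_finite_set _ (@finite_set0 _)) => a [+ _].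
by rewrite /supp /= eqxx.
Qed.

(** Both conclusions are proved together: additivity at the head of the list uses that the sum over
    the tail has a proper support. *)
Lemma pushf_sum I (r : seq I) (P : pred I) (c : I -> R) (F : I -> A -> W) :
  (forall i, proper_on (supp (F i))) ->
  pushf K (\sum_(i <- r | P i) c i *: F i) =
    \sum_(i <- r | P i) c i *: pushf K (F i) /\
  proper_on (supp (\sum_(i <- r | P i) c i *: F i)).
Proof.
move=> pF; elim: r => [|i r [IH p]].
  by rewrite !big_nil pushf0; split=> //; exact: proper0.
rewrite !big_cons; case: ifP => // _; rewrite pushf_linear// IH; split=> //.
exact: proper_linear.
Qed.

Lemma pushf_supp u b :
  pushf K u b = \sum_(a \in K @^-1` [set b] `&` supp u) u a.
Proof.
apply/esym/fsbig_widen; first exact: subIsetl.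
by move=> a [/= Ka na]; apply: suppN => ua; apply: na.
Qed.

End Single.

Lemma pushf_id (T : choiceType) (f : T -> W) : pushf id f = f.
Proof.
apply/funext => y.
rewrite (@pushfE _ _ _ _ _ [fset y]%fset) ?big_seq_fset1// => x.
  by rewrite inE => /eqP.
by move=> <- _; rewrite inE.
Qed.

Lemma eq_pushf (A B : choiceType) (K K' : A -> B) (u : A -> W) :
  (forall a, supp u a -> K a = K' a) -> pushf K u = pushf K' u.
Proof.
move=> KK'; apply/funext => b; rewrite !pushf_supp.
suff -> : K @^-1` [set b] `&` supp u = K' @^-1` [set b] `&` supp u by [].
by apply/seteqP; split=> a [/= Ka ua]; split=> //=; rewrite -Ka KK'.
Qed.

Lemma proper_comp (A B C : choiceType) (K : A -> B) (K' : B -> C) S :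
  proper_on (K' \o K) S -> proper_on K S.
Proof.
by move=> p b; apply: sub_finite_set (p (K' b)) => a [Sa /= <-].
Qed.

(** Properness of the composite is enough: the fibres of [K] lie inside those of [K' \o K], and a
    finite fibre of the composite has a finite image under [K]. *)
Lemma pushf_comp (A B C : choiceType) (K : A -> B) (K' : B -> C) u :
  proper_on (K' \o K) (supp u) -> pushf (K' \o K) u = pushf K' (pushf K u) :> (C -> W).
Proof.
move=> p; apply/funext => c; have pK := proper_comp p.
rewrite (pushf_proper _ p); set D := fset_set _.
have DP a : (a \in D) = `[< supp u a /\ K' (K a) = c >].
  by rewrite /D in_fset_set//; apply/idP/asboolP; rewrite inE.
(* The intermediate points are the images of [D]: above any other point of the fibre of [K'] the
   function [u] vanishes. *)
rewrite (@pushfE _ _ K' _ _ [fset K a | a in D]%fset).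
- rewrite (partition_big_imfset _ K)/=.
  apply: eq_big_seq => b /imfsetP[/= a0 + ->]; rewrite DP => /asboolP[_ Ka0].
  rewrite (@pushfE _ _ K _ _ [fset a in D | K a == K a0]%fset) ?big_fset//=.
  - by move=> a; rewrite !inE => /andP[_ /eqP].
  - move=> a Ka ua; rewrite !inE DP Ka eqxx andbT; apply/asboolP; split=> //.
- by move=> b /imfsetP[/= a + ->]; rewrite DP => /asboolP[].
- move=> b K'b; apply: contraPT => bD; apply/negP/negPn/eqP.
  apply: pushf_out => a Ka; apply: suppN => ua; move/negP: bD; apply.
  by apply/imfsetP; exists a => //=; rewrite DP; apply/asboolP; rewrite Ka.
Qed.

End Pushforward.

(** * Simplices and prisms *)

Section Simplices.
Local Open Scope group_scope.
Variable A : groupType.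
Implicit Types (v w : nat -> A).

(** The bar coordinates of a sequence of vertices. The sequence is indexed by all of [nat], although
    only its terms up to [n] count, so that reindexing is arithmetic without ordinals. *)
Definition simplex_of n v : A * n.-tuple A :=
  (v 0, [tuple v j * (v j.+1)^-1 | j < n]).

Lemma vertex0 n (p : A * n.-tuple A) : vertex p 0 = p.1.
Proof. by rewrite /vertex take0. Qed.

Lemma vertexS n (p : A * n.-tuple A) k : (k < n)%N ->
  vertex p k.+1 = (nth 1 p.2 k)^-1 * vertex p k.
Proof.
by move=> kn; rewrite /vertex (take_nth 1) ?size_tuple// foldl_rcons.
Qed.

(** For [x] = 1 this shows that each vertex of (y, g) is a left translate of y by an element that
    depends on [g] only. Hence control under fixed left translations governs all vertices at
    once. *)
Lemma vertexM n (x y : A) (g : n.-tuple A) k :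
  vertex (x * y, g) k = vertex (x, g) k * y.
Proof.
rewrite /vertex /=; elim: (take k g) x => //= a s IH x.
by rewrite mulgA IH.
Qed.

Lemma vertex_simplex_of n v k : (k <= n)%N -> vertex (simplex_of n v) k = v k.
Proof.
elim: k => [|k IH] kn; first by rewrite vertex0.
rewrite vertexS// IH ?(ltnW kn)// (nth_map (Ordinal kn)) ?size_enum_ord//.
by rewrite nth_enum_ord// invgM invgK mulgVK.
Qed.

Lemma simplex_of_vertex n (p : A * n.-tuple A) : simplex_of n (vertex p) = p.
Proof.
case: p => x g; congr (_, _); first exact: vertex0.
apply: eq_from_tnth => j; rewrite tnth_mktuple vertexS// invgM invgK mulVKg.
by rewrite (tnth_nth 1).
Qed.

Lemma eq_simplex_of n v w : (forall k, (k <= n)%N -> v k = w k) ->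
  simplex_of n v = simplex_of n w.
Proof.
move=> vw; congr (_, _); first exact: vw.
by apply: eq_from_tnth => j; rewrite !tnth_mktuple !vw// ltnW.
Qed.

Lemma faceE n (i : 'I_n.+2) (p : A * n.+1.-tuple A) :
  face i p = simplex_of n (fun k => vertex p (bump i k)).
Proof.
have nth_vertex k : (k < n.+1)%N -> nth 1 p.2 k = vertex p k * (vertex p k.+1)^-1.
  by move=> kn; rewrite vertexS// invgM invgK mulVKg.
congr (_, _).
  rewrite /bump leqn0; case: eqP => [_|_] /=; last by rewrite vertex0.
  rewrite addn0 vertexS// vertex0 (_ : thead p.2 = nth 1 p.2 0)//.
  by rewrite /thead (tnth_nth 1).
apply: eq_from_tnth => j; rewrite !tnth_mktuple /bump.
have jn := ltn_ord j.
(* The two consecutive remaining vertices lie both before the deleted one, both after it, or on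
   either side of it. *)
case: (ltngtP j.+1 i) => ij.
- have -> : (i <= j)%N = false by lia.
  by rewrite !add0n nth_vertex//; lia.
- have -> : (i <= j)%N by lia.
  by rewrite !add1n nth_vertex.
- rewrite -ij ltnn /= add0n add1n !nth_vertex//; last by lia.
  by rewrite mulgA mulgVK.
Qed.

End Simplices.

Section VertexMaps.
Variables A B : groupType.

(* Faces, [simplex_map] and the operators of the prism are all of this form, and
   [vertexwise_comp] reduces their identities to arithmetic on indices. *)
Definition vertexwise n m (kappa : nat -> A -> B) (a : nat -> nat)
    (p : A * n.-tuple A) : B * m.-tuple B :=
  simplex_of m (fun k => kappa k (vertex p (a k))).
Arguments vertexwise {n m} kappa a p.

Lemma simplex_mapE n (theta : A -> B) :
  @simplex_map A B theta n = @vertexwise n n (fun=> theta) id.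
Proof.
apply/funext => p; congr (_, _); by rewrite vertex0.
Qed.

Lemma eq_vertexwise n m (kappa kappa' : nat -> A -> B) a a' p :
  (forall k, (k <= m)%N -> kappa k (vertex p (a k)) = kappa' k (vertex p (a' k))) ->
  @vertexwise n m kappa a p = @vertexwise n m kappa' a' p.
Proof. by move=> kk; apply: eq_simplex_of. Qed.

End VertexMaps.

Arguments vertexwise {A B n m} kappa a p.

Lemma face_vertexwise (A : groupType) n (i : 'I_n.+2) :
  @face A n i = vertexwise (fun=> id) (bump i).
Proof. by apply/funext => p; rewrite faceE. Qed.

Lemma vertexwise_comp (A B C : groupType) n m l kappa a kappa' a' :
  (forall k, (k <= l)%N -> (a' k <= m)%N) ->
  @vertexwise B C m l kappa' a' \o @vertexwise A B n m kappa a =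
  vertexwise (fun k => kappa' k \o kappa (a' k)) (a \o a').
Proof.
move=> a'm; apply/funext => p; apply: eq_simplex_of => k kl /=.
by rewrite vertex_simplex_of// a'm.
Qed.

Lemma simplex_map_comp (A B C : groupType) n (theta : A -> B) (eta : B -> C) :
  @simplex_map B C eta n \o @simplex_map A B theta n = @simplex_map A C (eta \o theta) n.
Proof. by rewrite !simplex_mapE vertexwise_comp. Qed.

Lemma simplex_map_id (A : groupType) n : @simplex_map A A id n = id.
Proof.
by apply/funext => p; rewrite simplex_mapE /vertexwise simplex_of_vertex.
Qed.

Lemma bump_bound n h k : (k <= n)%N -> (bump h k <= n.+1)%N.
Proof. by rewrite /bump; lia. Qed.

Lemma face_simplex_map (A B : groupType) n (theta : A -> B) (i : 'I_n.+2) :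
  face i \o @simplex_map A B theta n.+1 = @simplex_map A B theta n \o face i.
Proof.
rewrite !simplex_mapE !face_vertexwise !vertexwise_comp//.
by move=> k; apply: bump_bound.
Qed.

Section Prism.
Variables (A B : groupType) (theta theta' : A -> B).

(* The vertices of [prism i] are the images under [theta] of the vertices
   [0, ..., i], followed by those under [theta'] of [i, ..., n]. *)
Definition prism n (i : nat) : A * n.-tuple A -> B * n.+1.-tuple B :=
  vertexwise (fun k => if (k <= i)%N then theta else theta') (unbump i).

Lemma face_prism n i (j : 'I_n.+2) :
  face j \o @prism n i = vertexwise
    (fun k => if (bump j k <= i)%N then theta else theta') (unbump i \o bump j).
Proof. by rewrite face_vertexwise vertexwise_comp// => k; apply: bump_bound. Qed.

Lemma prism_face n i (j : 'I_n.+2) : (i <= n)%N ->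
  @prism n i \o face j = vertexwise
    (fun k => if (k <= i)%N then theta else theta') (bump j \o unbump i).
Proof.
move=> ni; rewrite face_vertexwise vertexwise_comp// => k kn.
by rewrite /unbump; lia.
Qed.

(** The vertex deleted is theta x_j with j < i, which shortens the theta part of the prism; hence
    the index [i.-1] on the right. *)
Lemma face_prism_lt n i (j : 'I_n.+3) (j' : 'I_n.+2) :
  (j < i)%N -> (i <= n.+1)%N -> j' = j :> nat ->
  face j \o @prism n.+1 i = @prism n i.-1 \o face j'.
Proof.
move=> ji ni jj'; rewrite face_prism prism_face; last by lia.
apply/funext => p; apply: eq_vertexwise => k kn /=; rewrite jj'.
have -> : (bump j k <= i)%N = (k <= i.-1)%N by rewrite /bump; lia.
by have -> : unbump i (bump j k) = bump j (unbump i.-1 k) by rewrite /bump /unbump; lia.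
Qed.

(** The vertex deleted is theta' x_(j-1), because x_i occurs twice in the prism; hence [j.-1]. *)
Lemma face_prism_gt n i (j : 'I_n.+3) (j' : 'I_n.+2) :
  (i.+1 < j)%N -> j' = j.-1 :> nat ->
  face j \o @prism n.+1 i = @prism n i \o face j'.
Proof.
move=> ij jj'; have jn := ltn_ord j; rewrite face_prism prism_face; last by lia.
apply/funext => p; apply: eq_vertexwise => k kn /=; rewrite jj'.
have -> : (bump j k <= i)%N = (k <= i)%N by rewrite /bump; lia.
by have -> : unbump i (bump j k) = bump j.-1 (unbump i k) by rewrite /bump /unbump; lia.
Qed.

(** Both sides have the vertices theta x_0, ..., theta x_i, theta' x_(i+1), ..., theta' x_n: this is
    the common face of two consecutive prisms, which cancels in the alternating sum. *)
Lemma face_prism_diag n i (j : 'I_n.+2) : j = i.+1 :> nat ->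
  face j \o @prism n i.+1 = face j \o @prism n i.
Proof.
move=> ji; rewrite !face_prism.
apply/funext => p; apply: eq_vertexwise => k kn /=; rewrite ji.
have -> : (bump i.+1 k <= i.+1)%N = (bump i.+1 k <= i)%N by rewrite /bump; lia.
by have -> : unbump i.+1 (bump i.+1 k) = unbump i (bump i.+1 k) by rewrite /bump /unbump; lia.
Qed.

Lemma face_prism_first n : face ord0 \o @prism n 0 = simplex_map theta' (n := n).
Proof.
rewrite face_prism simplex_mapE.
apply/funext => p; apply: eq_vertexwise => k kn /=.
by have -> : unbump 0 (bump 0 k) = k by rewrite /bump /unbump; lia.
Qed.

Lemma face_prism_last n : face ord_max \o @prism n n = simplex_map theta (n := n).
Proof.
rewrite face_prism simplex_mapE.
apply/funext => p; apply: eq_vertexwise => k kn /=.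
have -> : (bump n.+1 k <= n)%N by rewrite /bump; lia.
by have -> : unbump n (bump n.+1 k) = k by rewrite /bump /unbump; lia.
Qed.

End Prism.

Section PrismSum.
Variables (R : pzRingType) (V : lmodType R).

(** [F] stands for the faces of the prisms and [P] for the prisms over the faces. Abstract families
    let the same computation serve push-forwards of chains and pull-backs of cochains. *)
Lemma prism_sum n (F P : nat -> nat -> V) :
  (forall i j, (j < i)%N -> (i <= n)%N -> F i j = P i.-1 j) ->
  (forall i j, (i.+1 < j)%N -> (j <= n.+1)%N -> F i j = P i j.-1) ->
  (forall i, (i < n)%N -> F i.+1 i.+1 = F i i.+1) ->
  \sum_(i < n.+1) \sum_(j < n.+2) (-1 : R) ^+ (i + j) *: F i j =
  F 0%N 0%N - F n n.+1 - \sum_(i < n) \sum_(j < n.+1) (-1) ^+ (i + j) *: P i j.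
Proof.
move=> Flt Fgt Fdiag.
(* [D] holds the two middle faces of the i-th prism, and its sum telescopes by [Fdiag]. [Lo] and
   [Hi] hold the faces before and after; [Flt] and [Fgt] turn them into the terms of [P] with j <= i
   and with j > i, each with the opposite sign. *)
pose D i := F i i - F i i.+1.
pose Lo i := \sum_(0 <= j < i) (-1 : R) ^+ (i + j) *: F i j.
pose Hi i := \sum_(i.+2 <= j < n.+2) (-1 : R) ^+ (i + j) *: F i j.
have -> : \sum_(i < n.+1) \sum_(j < n.+2) (-1 : R) ^+ (i + j) *: F i j =
    \sum_(i < n.+1) D i + \sum_(i < n.+1) Lo i + \sum_(i < n.+1) Hi i.
  rewrite -!big_split; apply: eq_bigr => i _ /=.
  have iN := ltn_ord i.
  rewrite -(big_mkord xpredT (fun j => (-1 : R) ^+ (i + j) *: F i j)).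
  have iN2 : (i < n.+2)%N by lia.
  rewrite (big_cat_nat (n := i)) /=; [|by []|exact: ltnW].
  rewrite (big_ltn iN2) (@big_ltn _ _ _ i.+1)// -/(Lo i) -/(Hi i).
  rewrite addnS -[in X in X *: F i i]signr_odd -[in X in X *: F i i.+1]signr_odd /=.
  rewrite oddD addbb expr0 expr1 scale1r scaleN1r.
  by rewrite /D [_ + Lo i]addrC -!addrA.
have -> : \sum_(i < n.+1) D i = F 0%N 0%N - F n n.+1.
  rewrite -(big_mkord xpredT D).
  have T m : (m <= n)%N -> \sum_(0 <= i < m.+1) D i = F 0%N 0%N - F m m.+1.
    elim: m => [|m IH] mn; first by rewrite big_nat1.
    by rewrite big_nat_recr//= IH ?(ltnW mn)// /D Fdiag// addrA subrK.
  exact: T.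
rewrite -addrA; congr (_ + _).
have -> : \sum_(i < n.+1) Lo i =
    - \sum_(i < n) \sum_(0 <= j < i.+1) (-1) ^+ (i + j) *: P i j.
  rewrite big_ord_recl /Lo big_geq// add0r -sumrN; apply: eq_bigr => i _.
  rewrite /bump /= -sumrN; apply: eq_big_nat => j /andP[_ ji].
  by rewrite Flt// addSn exprS mulN1r scaleNr.
have -> : \sum_(i < n.+1) Hi i =
    - \sum_(i < n) \sum_(i.+1 <= j < n.+1) (-1) ^+ (i + j) *: P i j.
  rewrite big_ord_recr /= {2}/Hi big_geq// addr0 -sumrN; apply: eq_bigr => i _.
  rewrite -sumrN /Hi [LHS]big_add1 /=; apply: eq_big_nat => j /andP[ij jn].
  by rewrite Fgt//= addnS exprS mulN1r scaleNr.
rewrite -opprD -big_split; congr (- _); apply: eq_bigr => i _ /=.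
rewrite -big_cat_nat//= ?ltnS ?(ltnW (ltn_ord i))// ?ltn_ord//.
by rewrite big_mkord.
Qed.

End PrismSum.

(** * Maps on chains *)

Section Bornology.
Variables (A : groupType) (bor : set (set A)).

Definition shift_stable : Prop :=
  forall S e, bor S -> bor ((fun x => e * x)%g @` S).

Definition controlled (B : groupType) (theta : A -> B) : Prop :=
  forall S e, bor S -> near_on S (fun x => theta (e * x)%g) theta.

Definition close_on (B : Type) (C : groupType) (b : set (set B)) (f g : B -> C) : Prop :=
  forall S, b S -> near_on S f g.

Lemma controlled_id : controlled id.
Proof. by move=> S e _; exact: (near_shift S id e). Qed.

Hypothesis stable : shift_stable.

Lemma controlled_close (B : groupType) (theta theta' : A -> B) :
  close_on bor theta theta' -> controlled theta -> controlled theta'.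
Proof.
move=> close ctl S e bS; apply: near_trans (close S bS).
apply: near_trans (ctl S e bS); apply: near_sym.
exact: (near_comp (close _ (stable e bS))).
Qed.

Lemma near_vertices (B : groupType) (theta f g : A -> B) S e e' :
  controlled theta -> close_on bor f theta -> close_on bor g theta -> bor S ->
  near_on S (fun x => f (e * x)%g) (fun x => g (e' * x)%g).
Proof.
move=> ctl ft gt bS; have half k c : close_on bor k theta ->
    near_on S (fun x => k (c * x)%g) theta.
  move=> kt; apply: near_trans (ctl S c bS).
  exact: (near_comp (kt _ (stable c bS))).
by apply: near_trans (half f e ft) _; apply/near_sym/half.
Qed.

End Bornology.

Lemma finite_tuples (T : Type) (A : choiceType) n (S : set T) (t : 'I_n -> T -> A) :
  (forall j, finite_set [set t j x | x in S]) ->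
  finite_set [set [tuple t j x | j < n] | x in S].
Proof.
move=> fin.
(* One finite set holds the entries at all positions, so the tuples come from a finite type. *)
have fD : finite_set (\bigcup_(j in [set: 'I_n]) [set t j x | x in S]).
  by apply: bigcup_finite => //; exact: finite_finset.
pose D := fset_set (\bigcup_(j in [set: 'I_n]) [set t j x | x in S]).
have fT : finite_set [set: n.-tuple D] by exact: finite_finset.
have := finite_image (fun s : n.-tuple D => [tuple val (tnth s j) | j < n]) fT.
apply: sub_finite_set => _ [x Sx <-].
have tD j : t j x \in D.
  by rewrite /D in_fset_set// inE; exists j => //; exists x.
exists [tuple [` tD j]%fset | j < n] => //.
by apply: eq_from_tnth => j; rewrite !tnth_mktuple.
Qed.

(** For fixed [g] the vertices of (x, g) are fixed left translates of x, so each group coordinate of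
    the image is a displacement between two maps near [theta]. The first vertex of the image may
    still take infinitely many values. *)
Lemma finite_simplices (A B : groupType) (bor : set (set A)) n m
    (theta : A -> B) (kappa : nat -> A -> B) a (g : n.-tuple A) S :
  shift_stable bor -> controlled bor theta ->
  (forall k, close_on bor (kappa k) theta) -> bor S ->
  finite_set [set (@vertexwise A B n m kappa a (x, g)).2 | x in S].
Proof.
move=> stable ctl close bS.
apply: (@finite_tuples _ _ _ _ (fun (j : 'I_m) x =>
  kappa j (vertex (x, g) (a j)) * (kappa j.+1 (vertex (x, g) (a j.+1)))^-1)%g) => j.
have := near_vertices stable (vertex (1%g, g) (a j)) (vertex (1%g, g) (a j.+1))
  ctl (close j) (close j.+1) bS.
apply: sub_finite_set => _ [x Sx <-]; exists x => //=.
by rewrite -!vertexM mul1g.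
Qed.

Section RestrPartition.
Variables (R : pzRingType) (W : lmodType R).

(** The factor 1 gives the decomposition the shape that [pushf_sum] expects. *)
Lemma restr_partition (A : Type) (I : choiceType) (h : A -> I) (C : set I) (f : A -> W) :
  finite_set C -> (forall x, supp f x -> C (h x)) ->
  f = \sum_(c <- fset_set C) (1 : R) *: restr [set x | h x = c] f.
Proof.
move=> fC Ch; apply/funext => x; rewrite fct_sumE.
have [fx|nfx] := pselect (supp f x); last first.
  rewrite (suppN nfx) big1// => c _.
  rewrite (_ : (_ *: _) x = 1 *: restr [set x | h x = c] f x)// scale1r.
  by rewrite /restr suppN//; case: ifP.
rewrite (bigD1_seq (h x)) ?fset_uniq//=; last first.
  by rewrite in_fset_set// inE; exact: Ch.
rewrite (_ : (_ *: _) x = 1 *: restr [set x' | h x' = h x] f x)//.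
rewrite restr_in// scale1r big1 ?addr0// => c /eqP ch.
rewrite (_ : (_ *: _) x = 1 *: restr [set x' | h x' = c] f x)//.
by rewrite restr_out ?scaler0// => /esym.
Qed.

Lemma supp_restr (A : Type) (S : set A) (f : A -> W) :
  supp (restr S f) `<=` S `&` supp f.
Proof. by move=> x; rewrite /supp /= /restr; case: ifP => [/set_mem//|_]; rewrite eqxx. Qed.

Lemma pushf_shift (A : choiceType) (B : groupType) (theta : A -> B) c (f : A -> W) :
  pushf (fun x => c * theta x)%g f = translate c (pushf theta f).
Proof.
apply/funext => y; rewrite /pushf /translate.
suff -> : (fun x => c * theta x)%g @^-1` [set y] = theta @^-1` [set c^-1 * y]%g by [].
by apply/seteqP; split=> x /= => [<-|->]; rewrite ?mulKg// mulVKg.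
Qed.

Lemma pushf_translate (A : groupType) (B : choiceType) (theta : A -> B) (e : A) (f : A -> W) :
  pushf (fun x => theta (e * x)%g) f = pushf theta (translate e f).
Proof.
apply/funext => y; rewrite /pushf /translate.
rewrite (reindex_fsbig (fun x => e * x)%g [set x | theta (e * x)%g = y]
  (theta @^-1` [set y])).
  by apply: eq_fsbigr => x _; rewrite mulKg.
split=> [x//|x x' _ _ /mulgI//|x' /= <-].
by exists (e^-1 * x')%g; rewrite /= mulVKg.
Qed.

End RestrPartition.

Section TamePush.
Variables (R : pzRingType) (W : lmodType R).

Definition bounded_by (A : groupType) (bor : set (set A)) (N : resmod W A) : Prop :=
  shift_stable bor /\ forall f, f \in N -> bor (supp f).

Variables (A : groupType) (bor : set (set A)) (N : resmod W A).
Hypothesis bN : bounded_by bor N.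

Definition tame_push (B : groupType) (theta : A -> B) (N' : resmod W B) : Prop :=
  [/\ controlled bor theta, forall S, bor S -> proper_on theta S &
      forall f, f \in N -> pushf theta f \in N'].

Variables (B : groupType) (N' : resmod W B).
Implicit Types theta : A -> B.

Lemma proper_close theta theta' S : near_on S theta theta' ->
  proper_on theta S -> proper_on theta' S.
Proof.
move=> close p b; apply: sub_finite_set (bigcup_finite close
  (fun c _ => p (c * b)%g)).
by move=> x [Sx /= xb]; exists (theta x * (theta' x)^-1)%g; [exists x|
  split=> //=; rewrite -xb mulgVK].
Qed.

(** The displacement c between [theta] and [theta'] takes finitely many values on the support of
    [f]. Where it equals c, [theta'] is c^-1 theta, so that piece of [f] is pushed to a translate of
    a push-forward along [theta]. *)
Lemma tame_push_close theta theta' : close_on bor theta theta' ->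
  tame_push theta N' -> tame_push theta' N'.
Proof.
have [stable bor_supp] := bN.
move=> close [ctl prop push]; split; first exact: controlled_close close ctl.
  by move=> S bS; apply: proper_close (close S bS) (prop S bS).
move=> f fN; have fC := close _ (bor_supp f fN).
pose h x := (theta x * (theta' x)^-1)%g.
have rN c : restr [set x | h x = c] f \in N by exact: resmod_restr.
have -> : pushf theta' f = \sum_(c <- fset_set [set h x | x in supp f])
    (1 : R) *: pushf theta' (restr [set x | h x = c] f).
  have hC x : supp f x -> [set h x | x in supp f] (h x) by move=> fx; exists x.
  rewrite [f in LHS](restr_partition fC hC).
  apply: (pushf_sum _ _ _ _).1 => c; have b := bor_supp _ (rN c).
  exact: proper_close (close _ b) (prop _ b).
apply: rpred_sum => c _; rewrite scale1r.
rewrite (@eq_pushf R W A B theta' (fun x => c^-1 * theta x)%g).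
  by rewrite pushf_shift; apply/resmod_translate/push.
by move=> x fx; have [/= xc _] := supp_restr fx; rewrite -xc /h invgM invgK mulgVK.
Qed.

End TamePush.

Section ChainPush.
Variables (R : comPzRingType) (W : lmodType R) (A B : groupType).
Variables (bor : set (set A)) (N : resmod W A) (N' : resmod W B).
Hypothesis bN : bounded_by bor N.
Variables (n m : nat) (K : A * n.-tuple A -> B * m.-tuple B).
Hypothesis K_fin : forall g S, bor S -> finite_set [set (K (x, g)).2 | x in S].
Hypothesis K_proper : forall g S, bor S -> proper_on (fun x => (K (x, g)).1) S.
Hypothesis K_push : forall g f, f \in N -> pushf (fun x => (K (x, g)).1) f \in N'.

Lemma chain_proper (u : chains N n) : proper_on K (supp (val u)).
Proof.
move=> b; have fin := chain_fin u.
have fb g : finite_set ((fun x => (x, g)) @`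
    (supp (slice (val u) g) `&` (fun x => (K (x, g)).1) @^-1` [set b.1])).
  by apply/finite_image/K_proper/bN.2/chain_slice.
apply: sub_finite_set (bigcup_finite fin (fun g _ => fb g)) => -[x g] [uxg /= Kb].
exists g => /=.
  by apply: contraNneq uxg => /(congr1 (fun f => f x)) ux; apply/eqP.
by exists x => //; split=> //=; rewrite Kb.
Qed.

(** The slice of the image at h comes from those x whose image has group coordinates h, pushed along
    the first coordinate of [K]; [K_fin] leaves finitely many h. *)
Lemma pushf_slice_chain (u : chains N n) g :
  pushf K (restr [set p | p.2 = g] (val u)) \in @chain_pred _ _ _ N' m.
Proof.
set f := slice (val u) g; have fN : f \in N by exact: chain_slice.
have bf := bN.2 _ fN.
have sliceE h : slice (pushf K (restr [set p | p.2 = g] (val u))) h =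
    pushf (fun x => (K (x, g)).1) (restr [set x | (K (x, g)).2 = h] f).
  (* Both sides are sums over the same finitely many x; on the left each x carries the constant
     second coordinate [g]. *)
  apply/funext => y; rewrite /slice (@pushfE _ _ _ _ K _ _
    [fset (x, g) | x in fset_set (supp f `&` (fun x => (K (x, g)).1) @^-1` [set y])
                   & (K (x, g)).2 == h]%fset).
  - rewrite (@pushfE _ _ _ _ _ _ _
      [fset x in fset_set (supp f `&` (fun x => (K (x, g)).1) @^-1` [set y])
            | (K (x, g)).2 == h]%fset).
    + rewrite big_imfset/=; last by move=> x x' _ _ [].
      rewrite big_filter big_fset /=; apply: eq_bigr => x /eqP Kx.
      by rewrite !restr_in.
    + move=> x; rewrite !inE => /andP[+ _].
      by rewrite in_fset_set ?inE; [move=> []|exact: K_proper].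
    + move=> x Kx fx; have [/= Kh {}fx] := supp_restr fx; rewrite !inE Kh eqxx andbT.
      by rewrite in_fset_set ?inE//; exact: K_proper.
  - move=> p /imfsetP[x /=]; rewrite !inE => /andP[+ /eqP Kx] ->.
    rewrite in_fset_set ?inE; last exact: K_proper.
    by move=> -[_ /= K1]; rewrite [LHS]surjective_pairing K1 Kx.
  - move=> [x g'] Kx ux; have [/= gg' {}ux] := supp_restr ux; apply/imfsetP; exists x; last by rewrite gg'.
    rewrite /= !inE -gg' Kx eqxx andbT in_fset_set; last by rewrite gg'; exact: K_proper.
    by rewrite inE /f -gg'; split=> //=; rewrite Kx.
apply/chain_predP; split=> [h|]; first by rewrite sliceE; apply/K_push/resmod_restr.
apply: sub_finite_set (K_fin g bf) => h /=; rewrite sliceE => nz.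
apply: contrapT => nh; move/negP: nz; apply; apply/eqP.
rewrite (_ : restr _ f = 0) ?pushf0//; apply/funext => x.
have [Kx|nKx] := pselect ((K (x, g)).2 = h); last by rewrite restr_out.
rewrite restr_in//; apply: suppN => fx; apply: nh; by exists x.
Qed.

Lemma chain_push (u : chains N n) : pushf K (val u) \in @chain_pred _ _ _ N' m.
Proof.
have fin := chain_fin u.
have uC p : supp (val u) p -> [set g | slice (val u) g != 0] p.2.
  by case: p => x g; apply: contraNneq => /(congr1 (fun f => f x)) ux; apply/eqP.
rewrite {1}(restr_partition fin uC).
have [|-> _] := @pushf_sum _ _ _ _ K _
  (fset_set [set g | slice (val u) g != 0]) xpredT (fun=> 1)
  (fun g => restr [set p | p.2 = g] (val u)).
  by move=> g; apply: (proper_on_sub _ (chain_proper u)) => p up; have [] := supp_restr up.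
by apply: rpred_sum => g _; rewrite scale1r pushf_slice_chain.
Qed.

End ChainPush.

Section TameChains.
Variables (R : comPzRingType) (W : lmodType R) (A B : groupType).
Variables (bor : set (set A)) (N : resmod W A) (N' : resmod W B).
Hypothesis bN : bounded_by bor N.
Variables (theta : A -> B).
Hypothesis tame : tame_push bor N theta N'.

Section Vertexwise.
Variables (n m : nat) (kappa : nat -> A -> B) (a : nat -> nat).
Hypothesis close : forall k, close_on bor (kappa k) theta.
Local Notation K := (@vertexwise A B n m kappa a).

Let kappa_tame k : tame_push bor N (kappa k) N'.
Proof.
by apply: tame_push_close tame => // S bS; apply/near_sym/close.
Qed.

Let firstE g : (fun x => (K (x, g)).1) =
  (fun x => kappa 0%N (vertex (1%g, g) (a 0%N) * x)%g).
Proof. by apply/funext => x; rewrite /= -vertexM mul1g. Qed.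

Let vw_fin g S : bor S -> finite_set [set (K (x, g)).2 | x in S].
Proof. exact: finite_simplices bN.1 (let: And3 c _ _ := tame in c) close. Qed.

Let vw_proper g S : bor S -> proper_on (fun x => (K (x, g)).1) S.
Proof.
move=> bS; have [_ prop _] := kappa_tame 0%N; rewrite firstE => b.
set e := vertex _ _.
apply: sub_finite_set (finite_image (fun x => e^-1 * x)%g (prop _ (bN.1 _ e bS) b)).
move=> x [Sx /= xb]; exists (e * x)%g; last by rewrite mulKg.
by split=> //; exists x.
Qed.

Let vw_push g f : f \in N -> pushf (fun x => (K (x, g)).1) f \in N'.
Proof.
move=> fN; have [_ _ push] := kappa_tame 0%N; rewrite firstE pushf_translate.
exact/push/resmod_translate.
Qed.

Lemma vertexwise_proper (u : chains N n) : proper_on K (supp (val u)).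
Proof. exact: (chain_proper bN vw_proper). Qed.

(** Each vertex may be moved by its own map as long as all these maps are close to [theta]. This
    covers the prism, where two maps occur, as well as faces and cones. *)
Lemma vertexwise_chain (u : chains N n) : pushf K (val u) \in @chain_pred _ _ _ N' m.
Proof. exact: (chain_push bN vw_fin vw_proper vw_push). Qed.

End Vertexwise.

Let close_refl : close_on bor theta theta.
Proof. by move=> S _; exact: near_refl. Qed.

Lemma simplex_chain n (u : chains N n) :
  pushf (@simplex_map A B theta n) (val u) \in @chain_pred _ _ _ N' n.
Proof. by rewrite simplex_mapE; apply: vertexwise_chain. Qed.

Lemma simplex_proper n (u : chains N n) :
  proper_on (@simplex_map A B theta n) (supp (val u)).
Proof. by rewrite simplex_mapE; apply: vertexwise_proper. Qed.

End TameChains.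

Section ChainDifferential.
Variables (R : comPzRingType) (W : lmodType R) (A : groupType) (N : resmod W A).

(** The smallest family of sets that [bounded_by] allows, hence the one that asks least of a tame
    map. A larger family could contain sets on which [omega] is not controlled. *)
Definition supports : set (set A) := [set S | exists2 f, f \in N & supp f = S].

Lemma bounded_supports : bounded_by supports N.
Proof.
split=> [S e [f fN <-]|f fN]; last by exists f.
exists (translate e f); first exact: resmod_translate.
apply/seteqP; split=> x /= => [fx|[x' fx <-]].
  by exists (e^-1 * x)%g => //; rewrite mulVKg.
by rewrite /supp /translate /= mulKg.
Qed.

Lemma tame_id : tame_push supports N id N.
Proof.
split=> [|S _ b|f fN]; first exact: controlled_id.
  by apply: (sub_finite_set _ (finite_set1 b)) => x [].
by rewrite pushf_id.
Qed.

Lemma face_chain n (i : 'I_n.+2) (u : chains N n.+1) :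
  pushf (face i) (val u) \in @chain_pred _ _ _ N n.
Proof.
rewrite face_vertexwise; apply: (vertexwise_chain bounded_supports tame_id).
by move=> k S _; exact: near_refl.
Qed.

Lemma chain_dE n (f : A * n.+1.-tuple A -> W) :
  chain_d f = \sum_(i < n.+2) (-1) ^+ i *: pushf (face i) f.
Proof. by apply/funext => q; rewrite fct_sumE. Qed.

Lemma chain_d_chain n (u : chains N n.+1) : chain_d (val u) \in @chain_pred _ _ _ N n.
Proof.
rewrite chain_dE; apply: rpred_sum => i _; rewrite rpredZ//; exact: face_chain.
Qed.

Lemma chain_d_sum n I (r : seq I) (P : pred I) (c : I -> R) (F : I -> chains N n.+1) :
  chain_d (val (\sum_(i <- r | P i) c i *: F i)) =
  \sum_(i <- r | P i) c i *: chain_d (val (F i)).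
Proof.
elim: r => [|i r IH]; first by rewrite !big_nil chain_d0.
by rewrite !big_cons; case: ifP => // _; rewrite chain_d_linear IH.
Qed.

End ChainDifferential.

Notation tame N theta N' := (tame_push (supports N) N theta N').

Section ChainMaps.
Variables (R : comPzRingType) (W : lmodType R) (A B : groupType).
Variables (N : resmod W A) (N' : resmod W B) (theta : A -> B).
Hypothesis tm : tame N theta N'.
Local Notation bN := (bounded_supports N).

Definition push_chain n (u : chains N n) : chains N' n :=
  Submod (simplex_chain bN tm u).

Let close_refl : close_on (supports N) theta theta.
Proof. by move=> S _; exact: near_refl. Qed.

Lemma chain_d_push n (u : chains N n.+1) :
  chain_d (pushf (@simplex_map A B theta n.+1) (val u)) =
  pushf (@simplex_map A B theta n) (chain_d (val u)).
Proof.
rewrite !chain_dE.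
have [i|-> _] := @pushf_sum _ _ _ _ (@simplex_map A B theta n) _
  (index_enum 'I_n.+2) xpredT (fun i => (-1) ^+ i) (fun i => pushf (face i) (val u)).
  exact: (simplex_proper bN tm (Submod (face_chain i u))).
apply: eq_bigr => i _; congr (_ *: _).
have fs := face_simplex_map theta i.
have p : proper_on (face i \o @simplex_map A B theta n.+1) (supp (val u)).
  rewrite simplex_mapE face_vertexwise vertexwise_comp; last exact: bump_bound.
  exact: (vertexwise_proper bN tm).
by rewrite -!pushf_comp ?fs// -?fs.
Qed.

Lemma push_chain_linear n a (u v : chains N n) :
  pushf (@simplex_map A B theta n) (a *: val u + val v) =
  a *: pushf (@simplex_map A B theta n) (val u) + pushf (@simplex_map A B theta n) (val v).
Proof. by apply: pushf_linear; exact: (simplex_proper bN tm). Qed.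

Lemma pushf_cycle n (u : chains N n) :
  u \in cycle_pred N n -> push_chain u \in cycle_pred N' n.
Proof.
move=> /cycle_predP Zu; apply/cycle_predP; case: n u Zu => // n u /= du.
by rewrite chain_d_push du pushf0.
Qed.

Lemma pushf_boundary n (u : chains N n) :
  u \in boundary_pred N n -> push_chain u \in boundary_pred N' n.
Proof.
move=> /boundary_predP[b ub]; apply/boundary_predP; exists (push_chain b).
by rewrite chain_d_push -ub.
Qed.

(** For a cycle the usual second term of a chain homotopy, the prism over the boundary of [u], is
    absent, so one chain [b] suffices. *)
Lemma prism_homotopy theta' n (u : chains N n) :
  close_on (supports N) theta' theta -> is_cycle (val u) ->
  exists b : chains N' n.+1,
    pushf (@simplex_map A B theta' n) (val u) - pushf (@simplex_map A B theta n) (val u)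
    = chain_d (val b).
Proof.
move=> close Zu.
have kclose i k : close_on (supports N) (if (k <= i)%N then theta else theta') theta.
  by case: ifP.
have Pc i : pushf (prism theta theta' i) (val u) \in @chain_pred _ _ _ N' n.+1.
  apply: (vertexwise_chain bN tm); exact: kclose.
pose b : chains N' n.+1 := \sum_(i < n.+1) (-1) ^+ i *: Submod (Pc i).
exists b; rewrite chain_d_sum.
(* [inord] extends the faces to all natural indices, as [prism_sum] requires; the sums use indices
   below [n.+2] only. *)
pose F i j := pushf (face (inord j : 'I_n.+2) \o @prism A B theta theta' n i) (val u).
have Fp i (j : 'I_n.+2) : proper_on (face j \o @prism A B theta theta' n i) (supp (val u)).
  rewrite face_prism; apply: (vertexwise_proper bN tm) => k.
  by case: ifP.
have -> : \sum_(i < n.+1) (-1) ^+ i *: chain_d (val (Submod (Pc i) : chains N' n.+1)) =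
    \sum_(i < n.+1) \sum_(j < n.+2) (-1) ^+ (i + j) *: F i j.
  apply: eq_bigr => i _; rewrite chain_dE scaler_sumr; apply: eq_bigr => j _.
  by rewrite scalerA -exprD /F inord_val -pushf_comp.
have F0 : F 0%N 0%N = pushf (@simplex_map A B theta' n) (val u).
  by rewrite /F -(face_prism_first theta) (_ : inord 0 = ord0)//; apply/val_inj; rewrite /= inordK.
have Fn : F n n.+1 = pushf (@simplex_map A B theta n) (val u).
  rewrite /F -(face_prism_last theta theta') (_ : inord n.+1 = ord_max)//.
  by apply/val_inj; rewrite /= inordK.
have Fdiag i : (i < n)%N -> F i.+1 i.+1 = F i i.+1.
  by move=> ni; rewrite /F face_prism_diag// inordK//; lia.
have FE i j : F i j = pushf (face (inord j : 'I_n.+2) \o prism theta theta' i) (val u) by [].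
case: n u Zu Pc b F FE Fp F0 Fn Fdiag => [|n] u Zu Pc b F FE Fp F0 Fn Fdiag.
  (* In degree 0 the correction sum is empty, so a dummy family takes the place of [P]. *)
  rewrite (@prism_sum _ _ _ _ (fun _ _ => 0))//; last by move=> i j; lia.
    by rewrite big_ord0 subr0 F0 Fn.
  by move=> i j; lia.
pose P i j := pushf (@prism A B theta theta' n i \o face (inord j : 'I_n.+2)) (val u).
rewrite (@prism_sum _ _ _ _ P)//; last 2 first.
- move=> i j ji ni; rewrite FE /P (@face_prism_lt _ _ _ _ _ i _ (inord j)) ?inordK//; lia.
- move=> i j ij jn; rewrite FE /P (@face_prism_gt _ _ _ _ _ i _ (inord j.-1)) ?inordK//; lia.
rewrite F0 Fn (_ : \sum_(i < _) _ = 0) ?subr0//.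
rewrite big1// => i _.
have /= du := Zu.
(* Each inner sum is a prism operator applied to the boundary of [u], which is zero. *)
rewrite (_ : \sum_(j < n.+2) _ = (-1) ^+ i *: pushf (@prism A B theta theta' n i) (chain_d (val u))).
  by rewrite du pushf0 scaler0.
rewrite chain_dE.
have [j|-> _] := @pushf_sum _ _ _ _ (@prism A B theta theta' n i) _
  (index_enum 'I_n.+2) xpredT (fun i => (-1) ^+ i) (fun i => pushf (face i) (val u)).
  exact: (vertexwise_proper bN tm _ (kclose i) (Submod (face_chain j u))).
rewrite scaler_sumr; apply: eq_bigr => j _.
rewrite scalerA -exprD /P inord_val pushf_comp// prism_face; last by rewrite -ltnS.
exact: (vertexwise_proper bN tm _ (kclose i)).
Qed.

End ChainMaps.

(** * Maps on cochains *)

Section TamePull.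
Variables (R : pzRingType) (W : lmodType R) (A B : groupType).
Variables (bor : set (set A)) (N : resmod W A) (N' : resmod W B).

(** The counterpart of [bounded_by] for cochains: they satisfy no support condition, so membership
    in [N] has to be decided on the sets where the maps are controlled. *)
Definition local_for : Prop := shift_stable bor /\
  forall F, (forall S, bor S -> restr S F \in N) -> F \in N.

Definition tame_pull (theta : A -> B) : Prop :=
  controlled bor theta /\ forall f, f \in N' -> pullf theta f \in N.

Hypothesis lN : local_for.

(** On a set of [bor] the displacement c between the two maps takes finitely many values; where it
    equals c, pulling [f] back along [theta'] amounts to pulling [translate c f] back along
    [theta]. *)
Lemma tame_pull_close theta theta' : close_on bor theta theta' ->
  tame_pull theta -> tame_pull theta'.
Proof.
move=> close [ctl pull]; split; first exact: controlled_close lN.1 _ _ _ close ctl.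
move=> f fN; apply: lN.2 => S bS.
apply: (@resmod_piecewise _ _ _ _
  [set pullf theta (translate c f) |
     c in [set theta x * (theta' x)^-1 | x in S]%g]).
- exact/finite_image/close.
- by move=> _ [c _ <-]; apply/pull/resmod_translate.
- move=> x; have [Sx|nSx] := pselect (S x); last by left; rewrite restr_out.
  right; rewrite restr_in//; exists (pullf theta (translate (theta x * (theta' x)^-1)%g f)).
    by exists (theta x * (theta' x)^-1)%g => //; exists x.
  by rewrite /pullf /translate /= invgM invgK mulgVK.
Qed.

End TamePull.

Section CochainMaps.
Variables (R : comPzRingType) (W : lmodType R) (A B : groupType).
Variables (bor : set (set A)) (N : resmod W A) (N' : resmod W B).
Hypothesis lN : local_for bor N.
Variable theta : A -> B.
Hypothesis tm : tame_pull bor N N' theta.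

(** The slice at [g] may involve infinitely many slices of [u], but on one set of [bor] only
    finitely many, one for each value of the group coordinates. Each of them contributes a translate
    of its pull-back along [kappa 0]. *)
Lemma vertexwise_cochain n m (kappa : nat -> A -> B) a (u : cochains N' m) :
  (forall k, close_on bor (kappa k) theta) ->
  pullf (@vertexwise A B n m kappa a) (val u) \in @cochain_pred _ _ _ N n.
Proof.
move=> close; apply/cochain_predP => g; apply: lN.2 => S bS.
have [_ pull0] : tame_pull bor N N' (kappa 0%N).
  by apply: tame_pull_close lN _ _ _ tm => S' bS'; apply/near_sym/close.
set K := vertexwise kappa a; set e := vertex (1%g, g) (a 0%N).
apply: (@resmod_piecewise _ _ _ _
  [set translate e^-1%g (pullf (kappa 0%N) (slice (val u) h)) |
     h in [set (K (x, g)).2 | x in S]]).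
- apply: finite_image.
  exact: (@finite_simplices _ _ bor _ _ theta kappa a g S lN.1 tm.1 close bS).
- by move=> _ [h _ <-]; apply/resmod_translate/pull0/cochain_slice.
- move=> x; have [Sx|nSx] := pselect (S x); last by left; rewrite restr_out.
  right; rewrite restr_in//.
  exists (translate e^-1%g (pullf (kappa 0%N) (slice (val u) (K (x, g)).2))).
    by exists (K (x, g)).2 => //; exists x.
  rewrite /translate /pullf /slice /= invgK /e -vertexM mul1g.
  by congr (submod_val u _); rewrite [LHS]surjective_pairing.
Qed.

Let close_refl : close_on bor theta theta.
Proof. by move=> S _; exact: near_refl. Qed.

Lemma simplex_cochain n (u : cochains N' n) :
  pullf (@simplex_map A B theta n) (val u) \in @cochain_pred _ _ _ N n.
Proof. by rewrite simplex_mapE; apply: vertexwise_cochain. Qed.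

Definition pull_cochain n (u : cochains N' n) : cochains N n :=
  Submod (simplex_cochain u).

Lemma cochain_dE (C : groupType) n (f : C * n.-tuple C -> W) :
  cochain_d f = \sum_(i < n.+2) (-1) ^+ i *: pullf (face i) f.
Proof. by apply/funext => q; rewrite fct_sumE. Qed.

Lemma pullf_sum (C D : Type) (K : C -> D) n (c : 'I_n -> R) (F : 'I_n -> D -> W) :
  pullf K (\sum_i c i *: F i) = \sum_i c i *: pullf K (F i).
Proof. by apply/funext => x; rewrite /pullf /= !fct_sumE. Qed.

Lemma cochain_d_pull n (f : B * n.-tuple B -> W) :
  cochain_d (pullf (@simplex_map A B theta n) f) =
  pullf (@simplex_map A B theta n.+1) (cochain_d f).
Proof.
rewrite !cochain_dE pullf_sum; apply: eq_bigr => i _; congr (_ *: _).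
apply/funext => p; rewrite /pullf /=; congr f.
by have := congr1 (fun k => k p) (face_simplex_map theta i).
Qed.

Lemma pullf_cocycle n (u : cochains N' n) :
  u \in cocycle_pred N' n -> pull_cochain u \in cocycle_pred N n.
Proof.
move=> /cocycle_predP du; apply/cocycle_predP.
by rewrite cochain_d_pull du.
Qed.

Lemma pullf_coboundary n (u : cochains N' n) :
  u \in coboundary_pred N' n -> pull_cochain u \in coboundary_pred N n.
Proof.
move=> /coboundary_predP Bu; apply/coboundary_predP.
case: n u Bu => [|n] u /=; first by move=> ->.
by move=> [b ->]; exists (pull_cochain b); rewrite cochain_d_pull.
Qed.

(** The cancellation of [prism_sum] is read in the other direction: the sum over all faces of all
    prisms is zero, being made of prisms applied to the coboundary of [u], and the correction sum
    becomes the coboundary sought. *)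
Lemma prism_cohomotopy theta' n (u : cochains N' n) :
  close_on bor theta' theta -> cochain_d (val u) = 0 ->
  is_coboundary N
    (pullf (@simplex_map A B theta' n) (val u) - pullf (@simplex_map A B theta n) (val u)).
Proof.
move=> close du.
pose F i j := pullf (face (inord j : 'I_n.+2) \o @prism A B theta theta' n i) (val u).
have F0 : F 0%N 0%N = pullf (@simplex_map A B theta' n) (val u).
  by rewrite /F -(face_prism_first theta) (_ : inord 0 = ord0)//; apply/val_inj; rewrite /= inordK.
have Fn : F n n.+1 = pullf (@simplex_map A B theta n) (val u).
  rewrite /F -(face_prism_last theta theta') (_ : inord n.+1 = ord_max)//.
  by apply/val_inj; rewrite /= inordK.
have Fdiag i : (i < n)%N -> F i.+1 i.+1 = F i i.+1.
  by move=> ni; rewrite /F face_prism_diag// inordK//; lia.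
have S0 : \sum_(i < n.+1) \sum_(j < n.+2) (-1 : R) ^+ (i + j) *: F i j = 0.
  rewrite big1// => i _.
  rewrite (_ : \sum_(j < n.+2) _ = (-1) ^+ i *: pullf (@prism A B theta theta' n i) (cochain_d (val u))).
    by rewrite du; exact: scaler0.
  rewrite cochain_dE pullf_sum scaler_sumr; apply: eq_bigr => j _.
  by rewrite scalerA -exprD /F inord_val.
have FE i j : F i j = pullf (face (inord j : 'I_n.+2) \o prism theta theta' i) (val u) by [].
rewrite -F0 -Fn.
case: n u du F FE F0 Fn Fdiag S0 => [|n] u du F FE F0 Fn Fdiag S0.
  (* In degree 0 the correction sum is empty and the difference itself vanishes, as [is_coboundary]
     demands there. *)
  move: S0; rewrite (@prism_sum _ _ _ _ (fun _ _ => 0))//; last by move=> i j; lia.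
    by rewrite big_ord0 subr0.
  by move=> i j; lia.
pose P i j := pullf (@prism A B theta theta' n i \o face (inord j : 'I_n.+2)) (val u).
move: S0; rewrite (@prism_sum _ _ _ _ P)//; last 2 first.
- move=> i j ji ni; rewrite FE /P (@face_prism_lt _ _ _ _ _ i _ (inord j)) ?inordK//; lia.
- move=> i j ij jn; rewrite FE /P (@face_prism_gt _ _ _ _ _ i _ (inord j.-1)) ?inordK//; lia.
move/eqP; rewrite subr_eq0 => /eqP -> /=.
have Pc (i : 'I_n.+1) : pullf (@prism A B theta theta' n i) (val u) \in @cochain_pred _ _ _ N n.
  by apply: vertexwise_cochain => k; case: ifP.
exists (\sum_(i < n.+1) (-1) ^+ i *: Submod (Pc i)).
rewrite submod_val_sum cochain_dE exchange_big /=; apply: eq_bigr => j _.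
rewrite pullf_sum scaler_sumr; apply: eq_bigr => i _.
by rewrite scalerA -exprD addnC /P inord_val.
Qed.

End CochainMaps.

(** * Maps of subquotients *)

Lemma pi_subquot_linear (R : pzRingType) (V : lmodType R) (Z N : submodClosed V)
    a (x y : submod Z) :
  \pi_(subquot Z N) (a *: x + y : submod Z) = a *: \pi_(subquot Z N) x + \pi_(subquot Z N) y.
Proof. by rewrite raddfD; congr (_ + _); exact/esym/subquot_scaleE. Qed.

Section Induced.
Variables (R : pzRingType) (W : lmodType R) (A B : Type).
Variables (C : submodClosed (A -> W)) (C' : submodClosed (B -> W)).
Variables (Z N : submodClosed (submod C)) (Z' N' : submodClosed (submod C')).
Implicit Types (T : (A -> W) -> (B -> W)).

Lemma inducesE T (F : subquot Z N -> subquot Z' N') (z : submod Z) (z' : submod Z') :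
  induces T F -> val (val z') = T (val (val z)) -> F (\pi z) = \pi z'.
Proof.
move=> indF z'E; have [w wE ->] := indF z; congr (\pi _).
by do 2!apply: val_inj; rewrite wE.
Qed.

(** Linearity is asked on [Z] only, because [pushf] is not linear on arbitrary functions. A lift to
    [Z'] is determined by its underlying function, so chosen lifts are automatically linear. *)
Lemma subquot_induces T :
  (forall z : submod Z, exists2 z' : submod Z', val (val z') = T (val (val z)) &
     val z \in N -> val z' \in N') ->
  (forall a (z z' : submod Z), T (a *: val (val z) + val (val z')) =
     a *: T (val (val z)) + T (val (val z'))) ->
  exists F : {linear subquot Z N -> subquot Z' N'}, induces T F.
Proof.
move=> TZ TL; pose t z := s2val (cid2 (TZ z)).
have tE z : val (val (t z)) = T (val (val z)) by exact: s2valP (cid2 (TZ z)).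
have tN z : val z \in N -> val (t z) \in N' by exact: s2valP' (cid2 (TZ z)).
have tL a z z' : t (a *: z + z') = a *: t z + t z'.
  do 2!apply: val_inj; rewrite !submod_valD !submod_valZ !tE.
  by rewrite !submod_valD !submod_valZ TL.
pose F (c : subquot Z N) := \pi_(subquot Z' N') (t (repr c)).
have FE (z : submod Z) : F (\pi_(subquot Z N) z) = \pi_(subquot Z' N') (t z).
  apply/subquotP; rewrite -submod_valB.
  have -> : t (repr (\pi_(subquot Z N) z)) - t z = t (repr (\pi_(subquot Z N) z) - z).
    by rewrite -scaleN1r addrC -tL scaleN1r addrC.
  by apply: tN; rewrite submod_valB; apply/subquotP; rewrite reprK.
have FL : GRing.linear_for *:%R F.
  move=> a c d; elim/quotW: c => x; elim/quotW: d => y.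
  by rewrite -pi_subquot_linear !FE tL pi_subquot_linear.
pose lF := GRing.isLinear.Build _ _ _ _ F FL.
pose LF : {linear subquot Z N -> subquot Z' N'} := HB.pack F lF.
exists LF => z; exists (t z) => //; exact: FE.
Qed.

End Induced.

Section InducedCancel.
Variables (R : pzRingType) (W : lmodType R) (A B : Type).
Variables (C : submodClosed (A -> W)) (C' : submodClosed (B -> W)).
Variables (Z N : submodClosed (submod C)) (Z' N' : submodClosed (submod C')).

Lemma induces_cancel (T : (A -> W) -> (B -> W)) (T' : (B -> W) -> (A -> W))
    (F : subquot Z N -> subquot Z' N') (F' : subquot Z' N' -> subquot Z N) :
  induces T F -> induces T' F' ->
  (forall z : submod Z, exists2 w : submod Z,
     val (val w) = T' (T (val (val z))) - val (val z) & val w \in N) ->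
  cancel F F'.
Proof.
move=> indF indF' TT' c; elim/quotW: c => z.
have [z' z'E ->] := indF z; have [z'' z''E ->] := indF' z'.
have [w wE wN] := TT' z; apply/subquotP.
rewrite (_ : val z'' - val z = val w)//; apply: val_inj.
by rewrite submod_valB z''E z'E wE.
Qed.

End InducedCancel.

Section Cosets.
Variables (R : pzRingType) (W : lmodType R) (A : Type).

(** The comparison takes place among functions because the two modules, even if they have the same
    members, give different types of classes. *)
Lemma coset_sub (C C' : submodClosed (A -> W)) (Z N : submodClosed (submod C))
    (Z' N' : submodClosed (submod C')) (z : submod Z) (z' : submod Z') :
  (forall v : submod Z, exists2 v' : submod Z', val (val v') = val (val v) &
     val v \in N -> val v' \in N') ->
  (exists2 w : submod Z', val (val w) = val (val z) - val (val z') & val w \in N') ->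
  coset (\pi_(subquot Z N) z) `<=` coset (\pi_(subquot Z' N') z').
Proof.
move=> vZ [w wE wN] _ [v /= /subquotP vz <-].
have [d dE dN] := vZ (v - z).
exists (d + w + z'); last first.
  by rewrite !submod_valD dE wE !submod_valB addrA !subrK.
apply/subquotP; rewrite !submod_valD addrK rpredD//.
by apply: dN; rewrite submod_valB.
Qed.

End Cosets.

Section InducedContinuity.
Variables (R : pzRingType) (W : lmodType R) (A B : Type).
Variables (C : submodClosed (A -> W)) (C' : submodClosed (B -> W)).
Variables (Z N : submodClosed (submod C)) (Z' N' : submodClosed (submod C')).
Variables (t : topology (submod C)) (t' : topology (submod C')).

Lemma induces_continuous (T : (A -> W) -> (B -> W)) (F : subquot Z N -> subquot Z' N')
    (k : submod C -> submod C') :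
  induces T F -> (forall u, val (k u) = T (val u)) ->
  (forall u, u \in Z -> k u \in Z') ->
  continuous (k : top_space t -> top_space t') ->
  continuous (F : subquot_space t Z N -> subquot_space t' Z' N').
Proof.
move=> indF kE kZ ck.
pose K (z : sub_space t Z) : sub_space t' Z' := Submod (kZ _ (submodP z)).
have cK : continuous K.
  apply: continuous_comp_initial.
  apply: (@continuous_compose (sub_space t Z) (top_space t) (top_space t')
    (@submod_val _ _ Z) k) => //.
  exact: (@initial_continuous _ _ (@submod_val _ _ Z : _ -> top_space t)).
apply/quotient_continuous.
have -> : (F : subquot_space t Z N -> subquot_space t' Z' N') \o \pi_(subquot_space t Z N) =
    \pi_(subquot_space t' Z' N') \o K.
  by apply/funext => z; apply: (inducesE indF); rewrite kE.
exact: continuous_compose cK (@pi_continuous _ _).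
Qed.

Lemma closure_pred_map (tc : separately_continuous t) (tc' : separately_continuous t')
    (M : submodClosed (submod C)) (M' : submodClosed (submod C'))
    (k : submod C -> submod C') :
  continuous (k : top_space t -> top_space t') ->
  (forall u, u \in M -> k u \in M') ->
  forall u, u \in closure_submod tc M -> k u \in closure_submod tc' M'.
Proof.
move=> ck kM u /closure_predP clu; apply/closure_predP => U Uku.
have [v [/= Mv Ukv]] := clu _ (ck _ _ Uku).
by exists (k v); split=> //; exact: kM.
Qed.

End InducedContinuity.

(** * Vanishing of reduced homology in positive degrees *)

(** The sets containing every [g] that equals [f] on some finite set of indices form a filter. It
    converges to [f], since a subbasic neighbourhood constrains a single coordinate. *)
Lemma nbhs_prod_finite (I : choiceType) (K : I -> topologicalType)
    (f : prod_topology K) (U : set (prod_topology K)) : nbhs f U ->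
  exists2 D : set I, finite_set D & forall g, (forall i, D i -> g i = f i) -> U g.
Proof.
pose F : set_system (prod_topology K) := [set U | exists2 D : set I, finite_set D &
  forall g, (forall i, D i -> g i = f i) -> U g].
suff : F --> f by apply.
have FF : Filter F.
  split; first by exists set0.
    move=> P Q [D fD DP] [D' fD' DQ]; exists (D `|` D'); first by rewrite finite_setU.
    by move=> g gf; split; [apply: DP|apply: DQ] => i Di; apply: gf; [left|right].
  by move=> P Q PQ [D fD DP]; exists D => // g /DP /PQ.
apply/cvg_sup => i V [_ [[O oO <-] Of OV]].
by exists [set i] => // g gf; apply: OV; rewrite /preimage /= gf.
Qed.

Section Density.
Variables (R : comPzRingType) (W : lmodType R) (A : groupType) (N : topmod W A).

(** Exact agreement on finitely many slices implies closeness for pointwise convergence, whatever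
    the topology of the coefficients. *)
Lemma closure_chains n (M : submodClosed (chains N n)) (z : chains N n) :
  (forall D : set (n.-tuple A), finite_set D -> exists2 w, w \in M &
     forall g, D g -> slice (val w) g = slice (val z) g) ->
  z \in closure_submod (chain_separately_continuous N n) M.
Proof.
move=> approx; apply/closure_predP => U [_ [[O oO <-] Oz OU]].
have [D fD DO] := nbhs_prod_finite (open_nbhs_nbhs (conj oO Oz)).
have [w wM wz] := approx D fD.
exists w; split=> //; apply: OU; apply: DO => g Dg.
by apply: val_inj; rewrite /= wz.
Qed.

(* Adds the vertex [tau x_m] to the simplex [(x_0, ..., x_m)]. *)
Definition cone (tau : A -> A) m : A * m.-tuple A -> A * m.+1.-tuple A :=
  vertexwise (fun j => if j == m.+1 then tau else id) (minn^~ m).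

Lemma face_cone_last tau m : face ord_max \o @cone tau m = id.
Proof.
rewrite face_vertexwise vertexwise_comp; last exact: bump_bound.
apply/funext => p; rewrite -[RHS]simplex_of_vertex; apply: eq_simplex_of => j jm /=.
have -> : (bump m.+1 j == m.+1) = false by rewrite /bump; lia.
by have -> : minn (bump m.+1 j) m = j by rewrite /bump; lia.
Qed.

(** The face [m.+1] deletes x_(m+1), the vertex to which [tau] would be applied. With a constant
    apex this face commutes with the cone like the earlier ones. *)
Lemma face_cone c m (i : 'I_m.+3) (i' : 'I_m.+2) : i' = i :> nat ->
  face i \o @cone (fun=> c) m.+1 = @cone (fun=> c) m \o face i'.
Proof.
move=> ii'; have im := ltn_ord i'; rewrite !face_vertexwise !vertexwise_comp.
- apply/funext => p; apply: eq_vertexwise => j jm /=; rewrite ii'.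
  have [->|jm1] := eqVneq j m.+1.
    by have -> : (bump i m.+1 == m.+2) by rewrite /bump; lia.
  have -> : (bump i j == m.+2) = false by rewrite /bump; lia.
  have -> : minn j m = j by lia.
  by have -> : minn (bump i j) m.+1 = bump i j by rewrite /bump; lia.
- by move=> j jm; lia.
- exact: bump_bound.
Qed.

(** Nearness to the identity on the whole group holds for left translations, and for a constant map
    if the group is finite: these are the two kinds of cone in use. *)
Lemma cone_close tau m : near_on setT tau id ->
  forall j, close_on (supports N) (if j == m.+1 then tau else id) id.
Proof.
by move=> c j S _; case: ifP => _; [exact: near_sub c|exact: near_refl].
Qed.

Lemma cone_chain tau m (z : chains N m) : near_on setT tau id ->
  pushf (@cone tau m) (val z) \in @chain_pred _ _ _ N m.+1.
Proof.
move=> c; apply: (vertexwise_chain (bounded_supports N) (tame_id N)) => j.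
exact: cone_close.
Qed.

Lemma pushf_face_cone tau m (z : chains N m) (i : 'I_m.+2) : near_on setT tau id ->
  pushf (face i) (pushf (@cone tau m) (val z)) =
  pushf (face i \o @cone tau m) (val z).
Proof.
move=> c; rewrite -pushf_comp// face_vertexwise vertexwise_comp; last exact: bump_bound.
apply: (vertexwise_proper (bounded_supports N) (tame_id N)) => j.
exact: cone_close.
Qed.

Lemma chain_d_cone tau m (z : chains N m) : near_on setT tau id ->
  chain_d (pushf (@cone tau m) (val z)) =
  \sum_(i < m.+1) (-1) ^+ i *: pushf (face (widen_ord (leqnSn _) i) \o @cone tau m) (val z)
  + (-1) ^+ m.+1 *: val z.
Proof.
move=> c; rewrite chain_dE big_ord_recr /= pushf_face_cone// face_cone_last pushf_id.
by congr (_ + _); apply: eq_bigr => i _; rewrite pushf_face_cone.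
Qed.

Lemma finite_cycle_boundary n (z : chains N n.+1) : finite_set [set: A] ->
  chain_d (val z) = 0 -> z \in boundary_pred N n.+1.
Proof.
move=> finA dz.
have c : near_on [set: A] (fun=> 1%g) id by exact: finite_image.
pose b : chains N n.+2 := Submod (cone_chain z c).
suff bz : chain_d (val b) = (-1) ^+ n.+2 *: val z.
  apply/boundary_predP; exists ((-1) ^+ n.+2 *: b).
  have := chain_d_linear ((-1) ^+ n.+2) b 0; rewrite addr0 chain_d0 addr0 => ->.
  by rewrite bz scalerA -exprD -signr_odd oddD addbb scale1r.
(* The faces other than the last add up to the cone over the boundary of [z], which is zero. *)
rewrite chain_d_cone// -[RHS]add0r; congr (_ + _).
have pc m (u : chains N m) : proper_on (@cone (fun=> 1%g) m) (supp (val u)).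
  apply: (vertexwise_proper (bounded_supports N) (tame_id N)) => j.
  exact: cone_close.
have [i|+ _] := @pushf_sum _ _ _ _ (@cone (fun=> 1%g) n) _
  (index_enum 'I_n.+2) xpredT (fun i => (-1) ^+ i) (fun i => pushf (face i) (val z)).
  exact: (pc _ (Submod (face_chain i z))).
rewrite -chain_dE dz pushf0 => E; rewrite [RHS]E; apply: eq_bigr => i _; congr (_ *: _).
rewrite (@face_cone _ _ _ i)// pushf_comp//.
rewrite /cone face_vertexwise vertexwise_comp; last first.
  by move=> j jm; rewrite geq_minr.
apply: (vertexwise_proper (bounded_supports N) (tame_id N)) => j.
exact: cone_close.
Qed.

Lemma chain_closed_boundary n (z : chains N n.+1) : ~ finite_set [set: A] ->
  z \in closed_boundaries N n.+1.
Proof.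
move=> infA; apply: closure_chains => D fD.
pose last_of (g : n.+1.-tuple A) := tnth g ord_max.
pose S := [set g | slice (val z) g != 0].
(* The last coordinate of a face of the cone other than the last face is [k], or [last_of h * k] if
   x_(n+1) is deleted, where h are the coordinates of a simplex in the support. The two finite sets
   to be avoided keep both values away from the last coordinates of [D]. *)
have [k kD kSD] : exists2 k, ~ (last_of @` D) k &
    ~ [set ((last_of h)^-1 * last_of g)%g | h in S & g in D] k.
  apply: contrapT => nk; apply: infA.
  apply: (@sub_finite_set _ _ (last_of @` D `|`
    [set ((last_of h)^-1 * last_of g)%g | h in S & g in D])).
    by move=> k _; apply: contrapT => /not_orP[kD kSD]; apply: nk; exists k.
  rewrite finite_setU; split; first exact: finite_image.
  by apply: finite_image2 => //; exact: chain_fin.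
have c : near_on [set: A] (fun x => k^-1 * x)%g id by exact: (near_shift _ id).
pose b : chains N n.+2 := Submod (cone_chain z c).
have wN := chain_d_chain b.
exists ((-1) ^+ n.+2 *: Submod wN).
  apply/boundary_predP; exists ((-1) ^+ n.+2 *: b).
  have := chain_d_linear ((-1) ^+ n.+2) b 0; rewrite addr0 chain_d0 addr0 => ->.
  by rewrite submod_valZ.
move=> g Dg; apply/funext => x; rewrite submod_valZ /slice.
rewrite (_ : (_ *: _) (x, g) = (-1) ^+ n.+2 *: chain_d (val b) (x, g))//.
rewrite chain_d_cone//.
set s := \sum_(i < _) _.
rewrite (_ : (s + _) (x, g) = s (x, g) + (-1) ^+ n.+2 *: val z (x, g))//.
have sq : (-1) ^+ (n.+2 + n.+2) = 1 :> R by rewrite -signr_odd oddD addbb.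
rewrite scalerDr scalerA -exprD sq scale1r.
rewrite (_ : s (x, g) = 0) ?scaler0 ?add0r// /s fct_sumE big1// => i _.
rewrite (_ : (_ *: _) (x, g) = (-1) ^+ i *:
  pushf (face (widen_ord (leqnSn _) i) \o @cone (fun x => k^-1 * x)%g n.+1) (val z) (x, g))//.
rewrite pushf_out ?scaler0// => p Kp; apply: contrapT => /eqP zp.
have pS : S p.2.
  by apply: contraNneq zp => /(congr1 (fun f => f p.1)) ux; apply/eqP;
    rewrite [p]surjective_pairing.
have : last_of (face (widen_ord (leqnSn _) i) (cone (fun x => k^-1 * x)%g p)).2 = last_of g.
  by rewrite [X in X.2]Kp.
have lastE v : last_of (simplex_of n.+1 v).2 = (v n * (v n.+1)^-1)%g.
  by rewrite /last_of tnth_mktuple.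
rewrite faceE lastE /cone /vertexwise.
have iN := ltn_ord i.
rewrite !vertex_simplex_of; [|by rewrite /bump/=; lia..].
have -> : bump (widen_ord (leqnSn _) i) n.+1 = n.+2 by rewrite /bump /=; lia.
rewrite eqxx (_ : (bump _ n == n.+2) = false); last by rewrite /bump /=; lia.
have -> : minn n.+2 n.+1 = n.+1 by lia.
have pl : last_of p.2 = (vertex p n * (vertex p n.+1)^-1)%g.
  by rewrite -[in LHS](simplex_of_vertex p) lastE.
case: (ltngtP i n.+1) => ni; last 2 first.
- by lia.
- have -> : minn (bump (widen_ord (leqnSn _) i) n) n.+1 = n by rewrite /bump /=; lia.
  rewrite /= invgM invgK mulgA -pl => pk; apply: kSD.
  by exists p.2 => //; exists g => //; rewrite -pk mulKg.
have -> : minn (bump (widen_ord (leqnSn _) i) n) n.+1 = n.+1 by rewrite /bump /=; lia.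
by rewrite /= invgM invgK mulVKg => kg; apply: kD; exists g.
Qed.

Lemma rhomology_vanish n (z : chains N n.+1) :
  z \in cycle_pred N n.+1 -> z \in closed_boundaries N n.+1.
Proof.
move=> /cycle_predP Zz; have [finA|infA] := pselect (finite_set [set: A]); last first.
  exact: chain_closed_boundary.
apply/closure_predP/subset_closure; exact: finite_cycle_boundary.
Qed.

End Density.

(** * Coarse maps *)

Section CoarseMaps.
Variables (G H : groupType).

Lemma coarse_near (T : Type) (S : set T) (f g : T -> G) (phi : G -> H) :
  coarse_map phi -> near_on S f g -> near_on S (phi \o f) (phi \o g).
Proof.
move=> [_ cphi] fg; have := cphi [set (f x, g x) | x in S].
have fin : finite_set [set (s.1 * s.2^-1)%g | s in [set (f x, g x) | x in S]].
  by apply: sub_finite_set fg => _ [_ [x Sx <-] <-]; exists x.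
move=> /(_ fin); apply: sub_finite_set => _ [x Sx <-].
by exists (f x, g x) => //; exists x.
Qed.

Lemma embedding_near (T : Type) (S : set T) (f g : T -> G) (phi : G -> H) :
  coarse_embedding phi -> near_on S (phi \o f) (phi \o g) -> near_on S f g.
Proof.
move=> emb fg; have [_ ephi] := emb [set (f x, g x) | x in S].
have fin : finite_set [set (phi s.1 * (phi s.2)^-1)%g | s in [set (f x, g x) | x in S]].
  by apply: sub_finite_set fg => _ [_ [x Sx <-] <-]; exists x.
move: (ephi fin); apply: sub_finite_set => _ [x Sx <-].
by exists (f x, g x) => //; exists x.
Qed.

Lemma coarse_controlled (phi : G -> H) bor : coarse_map phi -> controlled bor phi.
Proof.
move=> cphi S e _; apply: (@coarse_near _ S (fun x => e * x)%g id) => //.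
exact: (near_shift S id).
Qed.

End CoarseMaps.

Section PushCoarse.
Variables (R : comPzRingType) (W : lmodType R) (G H : groupType).
Variables (phi : G -> H) (coarse_phi : coarse_map phi).

Lemma tame_coarse (L : resmod W G) : tame L phi (push phi L).
Proof.
split; first exact: coarse_controlled.
  by move=> S _ y; apply: sub_finite_set (coarse_phi.1 y) => x [].
exact: pushf_push.
Qed.

Lemma proper_coarse S : proper_on phi S.
Proof. by move=> y; apply: sub_finite_set (coarse_phi.1 y) => x []. Qed.

Lemma push_close (phi' : G -> H) (L : resmod W G) : near_on setT phi phi' ->
  forall f, f \in push phi' L -> f \in push phi L.
Proof.
move=> close f /push_predP; apply => f' f'L.
have cl : close_on (supports L) phi phi' by move=> S _; exact: near_sub close.
by have [_ _] := tame_push_close (bounded_supports L) cl (tame_coarse L); apply.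
Qed.

End PushCoarse.

(** * Iterated push-forwards *)

Section PushComp.
Variables (R : comPzRingType) (W : lmodType R) (G H K : groupType).
Variables (phi : G -> H) (coarse_phi : coarse_map phi).
Variables (psi : H -> K) (coarse_psi : coarse_map psi).
Variable L : resmod W G.

Lemma coarse_comp : coarse_map (psi \o phi).
Proof.
split=> [z|S fS]; last first.
  have := coarse_psi.2 [set (phi s.1, phi s.2) | s in S].
  have fin : finite_set [set (s.1 * s.2^-1)%g | s in [set (phi s.1, phi s.2) | s in S]].
    by apply: sub_finite_set (coarse_phi.2 S fS) => _ [_ [s Ss <-] <-]; exists s.
  move=> /(_ fin); apply: sub_finite_set => _ [s Ss <-].
  by exists (phi s.1, phi s.2) => //; exists s.
apply: sub_finite_set (bigcup_finite (coarse_psi.1 z) (fun y _ => coarse_phi.1 y)).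
by move=> x /= xz; exists (phi x).
Qed.

Lemma push_comp_sub f : f \in push (psi \o phi) L -> f \in push psi (push phi L).
Proof.
move=> /push_predP; apply => f' f'L.
rewrite pushf_comp; last exact: (proper_coarse coarse_comp).
exact/pushf_push/pushf_push.
Qed.

(** Quantifying over all translations and restrictions makes this a [res]-invariant module by
    construction, although [pushf psi] does not commute with these operations. The minimality of
    [push phi L] then reduces an inclusion to generators. *)
Definition push_into_pred : {pred H -> W} :=
  [pred f | `[< forall B h, pushf psi (restr B (translate h f)) \in push (psi \o phi) L >]].

Lemma push_into_predP f : f \in push_into_pred <->
  forall B h, pushf psi (restr B (translate h f)) \in push (psi \o phi) L.
Proof. by split=> [/asboolP|?]; last exact/asboolP. Qed.

Lemma push_into_closed : GRing.subsemimod_closed push_into_pred.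
Proof.
apply: closed_of_linear => [|a f g /push_into_predP fP /push_into_predP gP].
  apply/push_into_predP => B h; rewrite (_ : restr B _ = 0) ?pushf0 ?rpred0//.
  by apply/funext => x; rewrite /restr /translate; case: ifP.
apply/push_into_predP => B h.
rewrite (_ : translate h _ = a *: translate h f + translate h g)//.
by rewrite restrD restrZ pushf_linear ?rpredD ?rpredZ//; exact: proper_coarse.
Qed.

HB.instance Definition _ :=
  GRing.isSubmodClosed.Build R (H -> W) push_into_pred push_into_closed.

Lemma translateM (D : groupType) (g h : D) (f : D -> W) :
  translate g (translate h f) = translate (g * h)%g f.
Proof. by apply/funext => x; rewrite /translate invgM mulgA. Qed.

Lemma translate_restr (D : groupType) (g : D) B (f : D -> W) :
  translate g (restr B f) = restr [set x | B (g^-1 * x)%g] (translate g f).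
Proof.
apply/funext => x; rewrite /translate.
have [Bx|nBx] := pselect (B (g^-1 * x)%g); first by rewrite !restr_in.
by rewrite !restr_out.
Qed.

Lemma restr_restr T B B' (f : T -> W) : restr B (restr B' f) = restr (B `&` B') f.
Proof.
apply/funext => x; rewrite /restr in_setI.
by case: (x \in B); case: (x \in B').
Qed.

Lemma push_into_translate h f : f \in push_into_pred -> translate h f \in push_into_pred.
Proof.
move=> /push_into_predP fP; apply/push_into_predP => B k.
by rewrite translateM.
Qed.

Lemma push_into_restr B f : f \in push_into_pred -> restr B f \in push_into_pred.
Proof.
move=> /push_into_predP fP; apply/push_into_predP => B' k.
by rewrite translate_restr restr_restr.
Qed.

Definition push_into : resmod W H := ResMod push_into_translate push_into_restr.

Lemma restr_pushf (C D : choiceType) (theta : C -> D) B (f : C -> W) :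
  restr B (pushf theta f) = pushf theta (restr (theta @^-1` B) f).
Proof.
apply/funext => y; have [By|nBy] := pselect (B y); last first.
  by rewrite restr_out// pushf_out// => x xy; rewrite restr_out//= /preimage /= xy.
rewrite restr_in// /pushf; apply: eq_fsbigr => x; rewrite inE /= => xy.
by rewrite restr_in// /preimage /= xy.
Qed.

Lemma push_comp_sup f : f \in push psi (push phi L) -> f \in push (psi \o phi) L.
Proof.
suff sub g : g \in push phi L -> g \in push_into.
  move=> /push_predP; apply => g /sub /push_into_predP /(_ setT 1%g).
  rewrite (_ : restr _ _ = g)//; apply/funext => x.
  by rewrite restr_in// /translate invg1 mul1g.
move=> /push_predP; apply => {}f fL; apply/push_into_predP => B h.
(* A translated and restricted generator is the push-forward of a restriction of [f] along x |-> h
   phi(x), and psi(h phi(x)) stays near psi(phi(x)). *)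
rewrite -pushf_shift restr_pushf.
set f' := restr _ f; have f'L : f' \in L by exact: resmod_restr.
have near : near_on setT (psi \o phi) (psi \o (fun x => h * phi x)%g).
  by apply: coarse_near => //; apply/near_sym/near_shift.
have cl : close_on (supports L) (psi \o phi) (psi \o (fun x => h * phi x)%g).
  by move=> S _; exact: near_sub near.
have [_ prop push] := tame_push_close (bounded_supports L) cl (tame_coarse coarse_comp L).
by rewrite -pushf_comp; [exact: push|apply: prop; exists f'].
Qed.

End PushComp.

Section PullCoarse.
Variables (R : comPzRingType) (W : lmodType R) (G H : groupType).
Variables (phi : G -> H) (coarse_phi : coarse_map phi).

Lemma local_all (N : resmod W G) : local_for [set: set G] N.
Proof.
split=> // F /(_ setT I); rewrite (_ : restr setT F = F)//.
by apply/funext => x; rewrite restr_in.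
Qed.

Lemma tame_pull_coarse (M : resmod W H) : tame_pull [set: set G] (pull phi M) M phi.
Proof. by split; [exact: coarse_controlled|exact: pullf_pull]. Qed.

Lemma pull_close (phi' : G -> H) (M : resmod W H) : near_on setT phi phi' ->
  forall f, f \in pull phi' M -> f \in pull phi M.
Proof.
move=> close f /pull_predP; apply => f' f'M.
have cl : close_on [set: set G] phi phi' by move=> S _; exact: near_sub close.
by have [_] := tame_pull_close (local_all _) cl (tame_pull_coarse M); apply.
Qed.

End PullCoarse.

(** * Iterated pull-backs *)

Section PullComp.
Variables (R : comPzRingType) (W : lmodType R) (G H K : groupType).
Variables (phi : G -> H) (coarse_phi : coarse_map phi).
Variables (psi : H -> K) (coarse_psi : coarse_map psi).
Variable N : resmod W K.

Lemma pull_comp_sub f : f \in pull (psi \o phi) N -> f \in pull phi (pull psi N).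
Proof.
move=> /pull_predP; apply => f' f'N.
exact: (@pullf_pull _ _ _ _ phi (pull psi N) _ (pullf_pull psi f'N)).
Qed.

(** [pullinv phi] of the target is a [res]-invariant module whose members pull back into the target,
    so by minimality of [pull psi N] only generators matter; there the translation by h^-1 before
    [psi] changes the map by finitely many displacements. *)
Lemma pull_comp_sup f : f \in pull phi (pull psi N) -> f \in pull (psi \o phi) N.
Proof.
suff sub g : g \in pull psi N -> g \in pullinv phi (pull (psi \o phi) N).
  move=> /pull_predP; apply => g /sub /pullinv_predP /(_ 1%g).
  rewrite (_ : translate _ _ = g)//; apply/funext => x.
  by rewrite /translate invg1 mul1g.
move=> /pull_predP; apply => {}f fN; apply/pullinv_predP => h.
have near : near_on setT (psi \o phi) (psi \o (fun x => h^-1 * phi x)%g).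
  by apply: coarse_near => //; apply/near_sym/near_shift.
have cl : close_on [set: set G] (psi \o phi) (psi \o (fun x => h^-1 * phi x)%g).
  by move=> S _; exact: near_sub near.
have [_] := tame_pull_close (local_all _) cl
  (tame_pull_coarse (coarse_comp coarse_phi coarse_psi) N).
exact.
Qed.

End PullComp.

(** * The map omega *)

Section Omega.
Variables (G H : groupType) (phi : G -> H) (emb : coarse_embedding phi) (E : choices phi).
Local Notation h := (enumeration E).
Local Notation omega := (omega E).

Lemma omegaP y : Xpiece E (piece_index E y) (omega y) /\
  y = (h (piece_index E y) * phi (omega y))%g.
Proof.
have [x [Xx Yx] xy] := Ypiece_Xpiece (piece_indexP E y).
have [Xo oE] : section_set E (omega y) /\ phi (omega y) = ((h (piece_index E y))^-1 * y)%g.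
  apply: (xgetPex 1%g (P := [set x | section_set E x /\
    phi x = ((h (piece_index E y))^-1 * y)%g])).
  by exists x.
by rewrite oE mulVKg; split=> //; split=> //=; rewrite /preimage /= oE; exact: piece_indexP.
Qed.

Lemma omega_piece j x : Xpiece E j x -> omega (h j * phi x)%g = x.
Proof.
move=> Xx; have [Xo] := omegaP (h j * phi x)%g.
rewrite (piece_indexE (Xpiece_Ypiece Xx)) in Xo * => /mulgI phio.
exact: section_inj Xo.1 Xx.1 (esym phio).
Qed.

(** On h_j Y_j the composite is left multiplication by h_j^-1, and only the pieces with j < J meet
    [covered E J]. *)
Lemma phi_omega_near S J : S `<=` covered E J -> near_on S (phi \o omega) id.
Proof.
move=> SJ; apply: (@near_bigcup _ _ _ _ _ (fun j => [set y | piece_index E y = j]) J).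
  move=> y /SJ /coveredP[j jJ Yj]; exists j => //=; exact: piece_indexE.
move=> j; apply: (@near_eq _ _ _ (fun y => (h j)^-1 * y)%g); last exact: (near_shift _ id).
by move=> y /= <-; rewrite {2}(omegaP y).2 mulKg.
Qed.

Lemma covered_range y : range phi y -> covered E 1 y.
Proof. by move=> ry; apply: range_covered; rewrite enumeration0 invg1 mul1g. Qed.

(** The range of [phi] is the single piece h_0 Y_0, so phi omega phi is near phi, and a coarse
    embedding reflects nearness. *)
Lemma omega_phi_near : near_on setT (omega \o phi) id.
Proof.
apply: (embedding_near emb).
have := @phi_omega_near (range phi) 1 (@covered_range); exact: near_comp.
Qed.

Definition bounded_sets : set (set H) := [set S | exists J, S `<=` covered E J].

Lemma bounded_shift : shift_stable bounded_sets.
Proof.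
move=> S e [J SJ]; have [J' cJ'] := covered_translate E e J.
by exists J' => _ [y Sy <-]; apply: cJ'; rewrite mulKg; exact: SJ.
Qed.

Lemma phi_omega_close : close_on bounded_sets (phi \o omega) id.
Proof. by move=> S [J]; exact: phi_omega_near. Qed.

(** It is enough to compare after applying [phi], which reflects nearness: [phi \o omega] is near
    the identity on [S] and on its translate by [e]. *)
Lemma omega_controlled : controlled bounded_sets omega.
Proof.
move=> S e bS; apply: (embedding_near emb).
apply: (@near_trans _ _ _ _ (fun y => e * y)%g).
  exact: (near_comp (phi_omega_close (bounded_shift e bS))).
apply: (@near_trans _ _ _ _ id); first exact: (near_shift S id).
exact/near_sym/phi_omega_close.
Qed.

Lemma omega_proper S : bounded_sets S -> proper_on omega S.
Proof.
move=> [J SJ] x; apply: sub_finite_set (finite_image (fun j => h j * phi x)%g (finite_II J)).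
move=> y [/SJ /coveredP[j jJ Yj] /= yx]; exists j => //.
by rewrite -yx {2}(omegaP y).2 (piece_indexE Yj).
Qed.

Section Modules.
Variables (R : comPzRingType) (W : lmodType R) (L : resmod W G).

Lemma push_supp_covered f : f \in push phi L -> exists J, supp f `<=` covered E J.
Proof.
move=> /(push_assembled emb E) /assembled_predP[[J fJ] _].
by exists J => y; exact: fJ.
Qed.

Lemma supports_bounded S : supports (push phi L) S -> bounded_sets S.
Proof. by move=> [f fL <-]; exact: push_supp_covered. Qed.

(** On h_j Y_j the map [omega] inverts x |-> h_j phi(x) from X_j, so pushing forward this part of
    [f] reads off a component. *)
Lemma pushf_omega_component (f : H -> W) j x :
  pushf omega (restr [set y | piece_index E y = j] f) x = component E j f x.
Proof.
have [Xx|nXx] := pselect (Xpiece E j x).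
  rewrite component_in// -[X in pushf _ _ X](omega_piece Xx) pushf_inj_in//.
    move=> y y'; rewrite !inE => yj yj' yy'.
    by rewrite (omegaP y).2 (omegaP y').2 yj yj' yy'.
  exact: piece_indexE (Xpiece_Ypiece Xx).
rewrite component_out// pushf_out// => y yx; rewrite restr_out// => /= yj; apply: nXx.
by have [+ _] := omegaP y; rewrite yj yx.
Qed.

Lemma pushf_omega_sum (f : H -> W) J : supp f `<=` covered E J ->
  pushf omega f = \sum_(j <- fset_set `I_J) component E j f.
Proof.
move=> fJ.
have piece_lt y : supp f y -> `I_J (piece_index E y).
  by move=> /fJ /coveredP[j jJ Yj]; rewrite (piece_indexE Yj).
have propf : proper_on omega (supp f) by apply: omega_proper; exists J.
rewrite [f in LHS](restr_partition (finite_II J) piece_lt).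
have [j|-> _] := @pushf_sum _ _ _ _ omega _ (fset_set `I_J) xpredT (fun=> 1)
  (fun j => restr [set y | piece_index E y = j] f).
  by apply: (proper_on_sub _ propf) => y fy; have [] := supp_restr fy.
apply: eq_bigr => j _; rewrite scale1r; apply/funext => x.
exact: pushf_omega_component.
Qed.

Lemma tame_omega : tame (push phi L) omega L.
Proof.
split=> [S e /supports_bounded|S /supports_bounded|f fL].
- exact: omega_controlled.
- exact: omega_proper.
- have [J fJ] := push_supp_covered fL; rewrite (pushf_omega_sum fJ).
  apply: rpred_sum => j _.
  by have /assembled_predP[_] := push_assembled emb E fL; exact.
Qed.

Lemma pullinvI (F : H -> W) : (forall j, component E j F \in L) -> F \in pullinv phi L.
Proof.
move=> FL; have cX j : restr (Xpiece E j) (component E j F) = component E j F.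
  exact: restr_id.
suff <- : Defs.glue E (component E ^~ F) = F by exact: glue_pullinv.
apply/funext => y; have [j [x [Xx ->]]] := Xpiece_ex E y.
by rewrite glueE// component_in.
Qed.

(** Components decide membership by [pullinvI], and the j-th one sees only the values on h_j Y_j, a
    bounded set. *)
Lemma local_pullinv : local_for bounded_sets (pullinv phi L).
Proof.
split; first exact: bounded_shift.
move=> F FL; apply: pullinvI => j.
have bj : bounded_sets [set y | Ypiece E j ((h j)^-1 * y)%g].
  by exists j.+1 => y Yj; apply/coveredP; exists j.
have [+ _] := pullinv_component E (FL _ bj) => /(_ j).
rewrite (_ : component E j (restr _ F) = component E j F)//.
apply/funext => x; have [Xx|nXx] := pselect (Xpiece E j x); last by rewrite !component_out.
by rewrite !component_in// restr_in//=; exact: Xpiece_Ypiece.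
Qed.

Lemma component_pull_omega j (f : G -> W) :
  component E j (pullf omega f) = restr (Xpiece E j) f.
Proof.
apply/funext => x; have [Xx|nXx] := pselect (Xpiece E j x).
  by rewrite component_in// restr_in// /pullf /= omega_piece.
by rewrite component_out// restr_out.
Qed.

Lemma tame_pull_omega : tame_pull bounded_sets (pullinv phi L) L omega.
Proof.
split; first exact: omega_controlled.
move=> f fL; apply: pullinvI => j; rewrite component_pull_omega; exact: resmod_restr.
Qed.

Lemma pullf_pullinv f : f \in pullinv phi L -> pullf phi f \in L.
Proof.
move=> /pullinv_predP /(_ 1%g); rewrite (_ : translate _ f = f)//.
by apply/funext => y; rewrite /translate invg1 mul1g.
Qed.

Lemma tame_pull_pullinv : coarse_map phi -> tame_pull [set: set G] L (pullinv phi L) phi.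
Proof.
by move=> c; split; [exact: coarse_controlled|exact: pullf_pullinv].
Qed.

End Modules.
End Omega.

(** * Maps in homology and cohomology *)

Section HomologyMaps.
Variables (R : comPzRingType) (W : lmodType R) (A B : groupType).
Variables (N : resmod W A) (n : nat) (Bd : submodClosed (chains N n)).

(** [Bd] stands for the boundaries or for their closure. The condition is restricted to cycles
    because this is all that [respects_closures] provides. *)
Lemma homology_map (N' : resmod W B) (Bd' : submodClosed (chains N' n))
    (theta : A -> B) (tm : tame N theta N') :
  (forall u, u \in cycle_pred N n -> u \in Bd -> push_chain tm u \in Bd') ->
  exists F : {linear subquot (cycle_pred N n) Bd -> subquot (cycle_pred N' n) Bd'},
    induces (pushf (@simplex_map A B theta n)) F.
Proof.
move=> BB'; apply: subquot_induces => [z|a z z'].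
  exists (Submod (pushf_cycle tm (submodP z))) => // zB.
  by apply: BB' => //; exact: submodP.
exact: (push_chain_linear tm a (val z) (val z')).
Qed.

End HomologyMaps.

Lemma push_push (R : comPzRingType) (W : lmodType R) (A B : groupType) n (C : groupType) (theta : C -> A) (eta : A -> B)
    (M : resmod W C) (M' : resmod W B) (u : chains M n) : tame M (eta \o theta) M' ->
  pushf (@simplex_map A B eta n) (pushf (@simplex_map C A theta n) (val u)) =
  pushf (@simplex_map C B (eta \o theta) n) (val u).
Proof.
move=> tm; rewrite -simplex_map_comp pushf_comp// simplex_map_comp.
exact: (simplex_proper (bounded_supports M) tm).
Qed.

Section HomologyCompare.
Variables (R : comPzRingType) (W : lmodType R) (A B : groupType).
Variables (N : resmod W A) (n : nat).

Lemma close_id_tame (eta : A -> A) : close_on (supports N) eta id -> tame N eta N.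
Proof.
move=> close; apply: (tame_push_close (bounded_supports N) _ (tame_id N)).
by move=> S bS; apply/near_sym/close.
Qed.

Lemma pushf_simplex_id (u : chains N n) : pushf (@simplex_map A A id n) (val u) = val u.
Proof. by rewrite simplex_map_id pushf_id. Qed.

Lemma push_retract (theta : A -> B) (eta : B -> A) (u : chains N n) :
  close_on (supports N) (eta \o theta) id -> u \in cycle_pred N n ->
  exists b : chains N n.+1,
    pushf (@simplex_map B A eta n) (pushf (@simplex_map A B theta n) (val u)) - val u
    = chain_d (val b).
Proof.
move=> close /cycle_predP Zu.
rewrite (push_push u (close_id_tame close)) -[X in _ - X]pushf_simplex_id.
exact: (prism_homotopy (tame_id N) close Zu).
Qed.

Lemma push_cancel (Bd : submodClosed (chains N n)) (N' : resmod W B)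
    (Bd' : submodClosed (chains N' n)) (theta : A -> B) (eta : B -> A)
    (F : subquot (cycle_pred N n) Bd -> subquot (cycle_pred N' n) Bd')
    (F' : subquot (cycle_pred N' n) Bd' -> subquot (cycle_pred N n) Bd) :
  (forall u, u \in boundary_pred N n -> u \in Bd) ->
  induces (pushf (@simplex_map A B theta n)) F ->
  induces (pushf (@simplex_map B A eta n)) F' ->
  close_on (supports N) (eta \o theta) id -> cancel F F'.
Proof.
move=> BBd indF indF' close; apply: (induces_cancel indF indF') => z.
have [b bE] := push_retract close (submodP z).
have te := close_id_tame close.
have wc : push_chain te (val z) - val z \in cycle_pred N n.
  by rewrite -scaleN1r rpredD ?rpredZ ?(pushf_cycle te)//; exact: submodP.
exists (Submod wc); first by rewrite submod_valB (push_push _ te).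
apply/BBd/boundary_predP; exists b.
by rewrite -bE submod_valB (push_push _ te).
Qed.

Lemma chain_sub (N1 N2 : resmod W A) : (forall f, f \in N1 -> f \in N2) ->
  forall u : chains N1 n, val u \in @chain_pred _ _ _ N2 n.
Proof.
by move=> N12 u; apply/chain_predP; split=> [g|]; [exact/N12/chain_slice|exact: chain_fin].
Qed.

End HomologyCompare.

Section HomologyCosets.
Variables (R : comPzRingType) (W : lmodType R) (A B : groupType).
Variables (N : resmod W A) (n : nat).

Lemma push_coset_sub (N1 N2 : resmod W B) (Bd1 : submodClosed (chains N1 n))
    (Bd2 : submodClosed (chains N2 n)) (theta1 theta2 : A -> B)
    (z : submod (cycle_pred N n)) (z1 : submod (cycle_pred N1 n))
    (z2 : submod (cycle_pred N2 n)) :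
  (forall f, f \in N1 -> f \in N2) ->
  (forall (u1 : chains N1 n) (u2 : chains N2 n), val u2 = val u1 ->
     u1 \in cycle_pred N1 n -> u1 \in Bd1 -> u2 \in Bd2) ->
  (forall u, u \in boundary_pred N2 n -> u \in Bd2) ->
  tame N theta2 N2 -> close_on (supports N) theta1 theta2 ->
  val (val z1) = pushf (@simplex_map A B theta1 n) (val (val z)) ->
  val (val z2) = pushf (@simplex_map A B theta2 n) (val (val z)) ->
  coset (\pi_(subquot (cycle_pred N1 n) Bd1) z1) `<=`
  coset (\pi_(subquot (cycle_pred N2 n) Bd2) z2).
Proof.
move=> N12 B12 BBd tm2 close z1E z2E.
have cyc (u : chains N1 n) : u \in cycle_pred N1 n ->
    (Submod (chain_sub N12 u) : chains N2 n) \in cycle_pred N2 n.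
  by move=> /cycle_predP uZ; apply/cycle_predP; case: (n) u uZ.
apply: coset_sub => [v|].
  exists (Submod (cyc _ (submodP v))) => // vB.
  by apply: (B12 (val v)) => //; exact: submodP.
have [b bE] := prism_homotopy tm2 close ((cycle_predP _).1 (submodP z)).
have wc : (Submod (chain_sub N12 (val z1)) - val z2 : chains N2 n) \in cycle_pred N2 n.
  by rewrite -scaleN1r rpredD ?rpredZ ?cyc//; exact: submodP.
exists (Submod wc); first by rewrite submod_valB.
by apply/BBd/boundary_predP; exists b; rewrite submod_valB -bE -z1E -z2E.
Qed.

End HomologyCosets.

Section CohomologyMaps.
Variables (R : comPzRingType) (W : lmodType R) (A B : groupType).
Variables (bor : set (set A)) (N : resmod W A) (N' : resmod W B) (n : nat).
Hypothesis lN : local_for bor N.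
Variables (Bd : submodClosed (cochains N n)) (Bd' : submodClosed (cochains N' n)).

Lemma cohomology_map (theta : A -> B) (tm : tame_pull bor N N' theta) :
  (forall u, u \in Bd' -> pull_cochain lN tm u \in Bd) ->
  exists F : {linear subquot (cocycle_pred N' n) Bd' -> subquot (cocycle_pred N n) Bd},
    induces (pullf (@simplex_map A B theta n)) F.
Proof.
move=> BB'; apply: subquot_induces => [z|a z z']; last by [].
exists (Submod (pullf_cocycle lN tm (submodP z))) => // zB.
exact: BB'.
Qed.

Lemma pull_id_tame : tame_pull bor N N id.
Proof. by split; first exact: controlled_id. Qed.

Lemma pull_retract (eta : A -> A) (u : cochains N n) :
  close_on bor eta id -> u \in cocycle_pred N n ->
  is_coboundary N (pullf (@simplex_map A A eta n) (val u) - val u).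
Proof.
move=> close /cocycle_predP du.
by have := prism_cohomotopy lN pull_id_tame close du; rewrite simplex_map_id.
Qed.

(* [theta : B -> A] and [eta : A -> B], so that the composite [theta \o eta]
   acts on the cochains of [A]. *)
Lemma pull_cancel (theta : B -> A) (eta : A -> B)
    (F : subquot (cocycle_pred N n) Bd -> subquot (cocycle_pred N' n) Bd')
    (F' : subquot (cocycle_pred N' n) Bd' -> subquot (cocycle_pred N n) Bd) :
  (forall u, u \in coboundary_pred N n -> u \in Bd) ->
  induces (pullf (@simplex_map B A theta n)) F ->
  induces (pullf (@simplex_map A B eta n)) F' ->
  close_on bor (theta \o eta) id -> cancel F F'.
Proof.
move=> BBd indF indF' close; apply: (induces_cancel indF indF') => z.
have cb := pull_retract close (submodP z).
have tm : tame_pull bor N N (theta \o eta).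
  by apply: tame_pull_close lN _ _ _ pull_id_tame => S bS; apply/near_sym/close.
have wc : pull_cochain lN tm (val z) - val z \in cocycle_pred N n.
  by rewrite -scaleN1r rpredD ?rpredZ ?pullf_cocycle//; exact: submodP.
exists (Submod wc).
  by rewrite submod_valB /= -simplex_map_comp.
by apply/BBd/coboundary_predP; rewrite submod_valB.
Qed.

End CohomologyMaps.

Section CohomologyCosets.
Variables (R : comPzRingType) (W : lmodType R) (A B : groupType).
Variables (N' : resmod W B) (n : nat).

Lemma cochain_sub (N1 N2 : resmod W A) : (forall f, f \in N1 -> f \in N2) ->
  forall u : cochains N1 n, val u \in @cochain_pred _ _ _ N2 n.
Proof. by move=> N12 u; apply/cochain_predP => g; exact/N12/cochain_slice. Qed.

Lemma pull_coset_sub (bor : set (set A)) (N1 N2 : resmod W A)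
    (Bd1 : submodClosed (cochains N1 n)) (Bd2 : submodClosed (cochains N2 n))
    (theta1 theta2 : A -> B) (z : submod (cocycle_pred N' n))
    (z1 : submod (cocycle_pred N1 n)) (z2 : submod (cocycle_pred N2 n)) :
  local_for bor N2 ->
  (forall f, f \in N1 -> f \in N2) ->
  (forall (u1 : cochains N1 n) (u2 : cochains N2 n), val u2 = val u1 ->
     u1 \in Bd1 -> u2 \in Bd2) ->
  (forall u, u \in coboundary_pred N2 n -> u \in Bd2) ->
  tame_pull bor N2 N' theta2 -> close_on bor theta1 theta2 ->
  val (val z1) = pullf (@simplex_map A B theta1 n) (val (val z)) ->
  val (val z2) = pullf (@simplex_map A B theta2 n) (val (val z)) ->
  coset (\pi_(subquot (cocycle_pred N1 n) Bd1) z1) `<=`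
  coset (\pi_(subquot (cocycle_pred N2 n) Bd2) z2).
Proof.
move=> lN2 N12 B12 BBd tm2 close z1E z2E.
have cyc (u : cochains N1 n) : u \in cocycle_pred N1 n ->
    (Submod (cochain_sub N12 u) : cochains N2 n) \in cocycle_pred N2 n.
  by move=> /cocycle_predP uZ; apply/cocycle_predP.
apply: coset_sub => [v|].
  exists (Submod (cyc _ (submodP v))) => // vB.
  exact: (B12 (val v)).
have cb := prism_cohomotopy lN2 tm2 close ((cocycle_predP _).1 (submodP z)).
have wc : (Submod (cochain_sub N12 (val z1)) - val z2 : cochains N2 n) \in cocycle_pred N2 n.
  by rewrite -scaleN1r rpredD ?rpredZ ?cyc//; exact: submodP.
exists (Submod wc); first by rewrite submod_valB.
by apply/BBd/coboundary_predP; rewrite submod_valB; move: cb; rewrite -z1E -z2E.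
Qed.

End CohomologyCosets.

(** * Topologies on cochains *)

Section Final.
Variables (I : Type) (S : I -> topologicalType) (T : choiceType).
Variable f : forall i, S i -> T.

Lemma final_from (X : topologicalType) (g : T -> X) :
  (forall i, continuous (g \o @f i)) ->
  continuous (g : top_space (final_topology f) -> X).
Proof.
move=> cg; apply/continuousP => U oU.
suff : opens (final_topology f) (g @^-1` U) by [].
by move=> i; have /continuousP := cg i; exact.
Qed.

Lemma final_to i : continuous (@f i : S i -> top_space (final_topology f)).
Proof. by apply/continuousP => U oU; have : opens (final_topology f) U by []; exact. Qed.

End Final.

Lemma continuous_ext (X Y : topologicalType) (f g : X -> Y) :
  (forall x, f x = g x) -> continuous f -> continuous g.
Proof. by move=> /funext ->. Qed.

Section WellTopologized.
Variables (R : comPzRingType) (W : lmodType R).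

(* [push_topmod] need not have this property: its addition is only known to be
   separately continuous. *)
Definition continuous_ops (G : groupType) (Q : topmod W G) : Prop :=
  [/\ continuous (fun p : topmod_space Q * topmod_space Q =>
        (p.1 : submod Q) + p.2 : topmod_space Q),
      forall A, continuous (submod_restr A : topmod_space Q -> topmod_space Q) &
      forall g, continuous (submod_translate g : topmod_space Q -> topmod_space Q)].

Variables (G : groupType) (Q : topmod W G) (good : continuous_ops Q).

Lemma continuous_add (S : topologicalType) (f g : S -> topmod_space Q) :
  continuous f -> continuous g ->
  continuous (fun s => (f s : submod Q) + g s : topmod_space Q).
Proof.
have [cD _ _] := good; move=> cf cg s.
apply: (@continuous_comp _ _ _ (fun s => (f s, g s))
  (fun p => (p.1 : submod Q) + p.2 : topmod_space Q)); last exact: cD.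
exact: cvg_pair (cf s) (cg s).
Qed.

Lemma continuous_sum (S : topologicalType) (I : Type) (r : seq I)
    (f : I -> S -> topmod_space Q) :
  (forall i, continuous (f i)) ->
  continuous (fun s => \sum_(i <- r) (f i s : submod Q) : topmod_space Q).
Proof.
move=> cf; elim: r => [|i r IH].
  apply: (@continuous_ext S (topmod_space Q) (fun=> 0 : submod Q)); last exact: cst_continuous.
  by move=> s; rewrite big_nil.
apply: (@continuous_ext S (topmod_space Q) _ _ _ (continuous_add (cf i) IH)) => s.
by rewrite big_cons.
Qed.

(** The topological counterpart of [resmod_piecewise]. The index may depend on the point [x] but not
    on [s], so [F] is a finite sum of restrictions, to fixed sets, of the maps [k i]. *)
Lemma piecewise_continuous (S : topologicalType) (I : choiceType) (D : set I)
    (k : I -> S -> topmod_space Q) (F : S -> topmod_space Q) :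
  finite_set D -> (forall i, D i -> continuous (k i)) ->
  (forall x, (forall s, val (F s : submod Q) x = 0) \/
     exists2 i, D i & forall s, val (F s : submod Q) x = val (k i s : submod Q) x) ->
  continuous F.
Proof.
have [_ cres _] := good.
move=> /finite_seqP[r ->]; elim: r F => [|i r IH] F ck FD.
  apply: (@continuous_ext S (topmod_space Q) (fun=> 0 : submod Q)); last exact: cst_continuous.
  move=> s.
  by apply: val_inj; apply/funext => x; have [->|[]] := FD x.
pose B := [set x | forall s, val (F s : submod Q) x = val (k i s : submod Q) x].
apply: (@continuous_ext S (topmod_space Q) (fun s => submod_restr B (k i s) + submod_restr (~` B) (F s))).
  move=> s; apply: val_inj; rewrite submod_valD; apply/funext => x.
  rewrite (_ : (_ + _) x = restr B (val (k i s : submod Q)) x +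
                           restr (~` B) (val (F s : submod Q)) x)//.
  have [Bx|nBx] := pselect (B x).
    by rewrite restr_in// restr_out ?addr0// => -[].
  by rewrite restr_out// restr_in// add0r.
apply: continuous_add.
  by apply: continuous_compose (cres B); apply: ck; rewrite /= mem_head.
apply: IH => [j rj|x]; first by apply: ck; rewrite /= in_cons rj orbT.
have [Bx|nBx] := pselect (B x).
  by left=> s; rewrite [LHS]restr_out => // nB; exact: nB Bx.
have [F0|[j]] := FD x; first by left=> s; rewrite [LHS]restr_in//; exact: F0.
rewrite /= in_cons => /predU1P[-> //|rj Fj].
by right; exists j => // s; rewrite [LHS]restr_in//; exact: Fj.
Qed.

End WellTopologized.

Lemma topological_continuous_ops (R : comPzRingType) (W : lmodType R) (tR : topology R)
  (G : groupType) (L : topmod W G) : topological_resmod tR L -> continuous_ops L.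
Proof. by case. Qed.

Section CutLift.
Variables (R : pzRingType) (W : lmodType R) (G : groupType) (L : topmod W G).
Variables (B : set G) (S : topologicalType).

Definition cut_lift (F : S -> submod L) (FB : forall s, restr B (val (F s)) = val (F s))
  (s : S) : cut_space L B := exist (fun f => f \in cut L B) _ (cut_in (FB s)).

Lemma cut_lift_continuous F FB : continuous (F : S -> topmod_space L) ->
  continuous (@cut_lift F FB).
Proof. by move=> cF; apply: continuous_comp_initial. Qed.

End CutLift.

Section PullTopology.
Variables (R : comPzRingType) (W : lmodType R) (G H : groupType).
Variables (phi : G -> H) (emb : coarse_embedding phi) (E : choices phi).
Variables (P : section_partition E) (M : topmod W H).
Local Notation PM := (pull_topmod emb P M).

Definition spread_sub i (F : submod PM) : submod M :=
  Submod ((pull_spread emb P (submodP F)).1 i).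

Lemma spread_restr_eq i (F : submod PM) :
  restr (phi @` piece P i) (val (spread_sub i F)) = val (spread_sub i F).
Proof.
apply/funext => y; have [Zy|nZ] := pselect ((phi @` piece P i) y); first by rewrite restr_in.
by rewrite restr_out//= spread_out.
Qed.

(** The components invert the bijection [pull_sum], so its final topology can also be tested by maps
    into it. *)
Lemma continuous_into_pull (S : topologicalType) (F : S -> topmod_space PM) :
  (forall i, continuous (fun s => spread_sub i (F s) : topmod_space M)) -> continuous F.
Proof.
move=> cF.
pose k s : pull_source P M := fun i => cut_lift (fun s => spread_restr_eq i (F s)) s.
apply: (@continuous_ext S (topmod_space PM) (@pull_sum _ _ _ _ _ _ P M \o k)).
  move=> s; apply: val_inj.
  by rewrite /= /pull_sum submod_val_sum [RHS](pull_spread emb P (submodP (F s))).2.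
apply: continuous_compose; last exact: (@final_to unit _ _ _ tt).
by apply: continuous_into_prod => i; apply: cut_lift_continuous.
Qed.

Lemma spread_continuous i : continuous (spread_sub i : topmod_space PM -> topmod_space M).
Proof.
apply: final_from => -[].
apply: (@continuous_ext (pull_source P M) (topmod_space M) (fun s : pull_source P M => cut_val (s i))).
  move=> s; apply: val_inj; apply/funext => y /=.
  have [[x Zx <-]|nZ] := pselect ((phi @` piece P i) y); last first.
    by rewrite spread_out// -cut_restr restr_out.
  rewrite spread_in// /pull_sum submod_val_sum fct_sumE (bigD1 i)//= restr_in//.
  rewrite big1 ?addr0// => j /eqP ji; rewrite restr_out// => Zj; apply: ji.
  by apply: (@piece_trivIset _ _ _ _ P) => //; exists x.
apply: (@continuous_compose _ (cut_space M (phi @` piece P i)) _ (fun s : pull_source P M => s i)).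
  exact: continuous_proj.
exact: cut_val_continuous.
Qed.

Hypothesis good : continuous_ops M.

(** This lets pull-backs be iterated: the results for [M] apply again to [PM]. *)
Lemma pull_continuous_ops : continuous_ops PM.
Proof.
split.
- apply: continuous_into_pull => i.
  apply: (@continuous_ext (topmod_space PM * topmod_space PM)%type (topmod_space M)
    (fun p => spread_sub i p.1 + spread_sub i p.2)).
    move=> [F F']; apply: val_inj; apply/funext => y; rewrite submod_valD /=.
    rewrite (_ : (_ + _) y = spread i (val F) y + spread i (val F') y)//.
    have [[x Zx <-]|nZ] := pselect ((phi @` piece P i) y); last by rewrite !spread_out// addr0.
    by rewrite !spread_in// submod_valD.
  apply: (continuous_add good).
    apply: (@continuous_compose _ (topmod_space PM) _ fst); last exact: spread_continuous.
    by move=> p; exact: cvg_fst.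
  apply: (@continuous_compose _ (topmod_space PM) _ snd); last exact: spread_continuous.
  by move=> p; exact: cvg_snd.
- move=> B; apply: continuous_into_pull => i.
  apply: (@piecewise_continuous _ _ _ _ good (topmod_space PM) unit [set tt] (fun=> spread_sub i)).
  + exact: finite_set1.
  + by move=> _ _; exact: spread_continuous.
  + move=> y; have [[x Zx <-]|nZ] := pselect ((phi @` piece P i) y); last first.
      by left=> s; rewrite /= spread_out.
    have [Bx|nBx] := pselect (B x).
      by right; exists tt => // s; rewrite /= !spread_in// restr_in.
    by left=> s; rewrite /= spread_in// restr_out.
- move=> g; apply: continuous_into_pull => i.
  (* At phi(x), the translate uses the value at g^-1 x. The index (k, c) records the piece that
     contains g^-1 x and the displacement c between phi(g^-1 x) and phi(x); finitely many pairs
     occur. *)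
  apply: (@piecewise_continuous _ _ _ _ good (topmod_space PM) _
    ([set: 'I_(pieces P).+1] `*` coarse_shift phi g^-1%g)
    (fun q s => submod_translate q.2^-1%g (spread_sub q.1 s))).
  + by apply: finite_setX; [exact: finite_finset|exact: coarse_shift_finite].
  + move=> q _; have [_ _ ct] := good.
    by apply: continuous_compose (ct _); exact: spread_continuous.
  + move=> y; have [[x Zx <-]|nZ] := pselect ((phi @` piece P i) y); last first.
      by left=> s; rewrite /= spread_out.
    right; have [k Zk] := piece_ex P (g^-1 * x)%g.
    exists (k, (phi (g^-1 * x) * (phi x)^-1)%g); first by split=> //; exists x.
    by move=> s; rewrite /= spread_in// /translate invgK mulgVK spread_in.
Qed.

Definition pullf_sub (F : submod M) : submod PM := Submod (pullf_pull phi (submodP F)).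

Lemma pullf_sub_continuous : continuous (pullf_sub : topmod_space M -> topmod_space PM).
Proof.
apply: continuous_into_pull => i.
have [_ cres _] := good.
apply: (@continuous_ext (topmod_space M) (topmod_space M) _ _ _ (cres (phi @` piece P i))) => F.
apply: val_inj; apply/funext => y /=.
have [[x Zx <-]|nZ] := pselect ((phi @` piece P i) y); last by rewrite spread_out// restr_out.
by rewrite spread_in// restr_in//; exists x.
Qed.

(** Compares the topology of [PM] with that of another module on the same functions: on each piece,
    [F] is [p] applied to a spread component, so continuity of the pull-back map [p] suffices. *)
Lemma continuous_from_pull (Q : topmod W G) (F : submod PM -> submod Q)
    (p : submod M -> submod Q) :
  continuous_ops Q -> continuous (p : topmod_space M -> topmod_space Q) ->
  (forall f, val (p f) = pullf phi (val f)) -> (forall f, val (F f) = val f) ->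
  continuous (F : topmod_space PM -> topmod_space Q).
Proof.
move=> gQ cp pE FE.
apply: (@piecewise_continuous _ _ _ _ gQ (topmod_space PM) _ [set: 'I_(pieces P).+1] (fun i s => p (spread_sub i s))).
- exact: finite_finset.
- by move=> i _; apply: continuous_compose cp; exact: spread_continuous.
- move=> x; right; have [i Zi] := piece_ex P x; exists i => // s.
  by rewrite FE pE /pullf /= spread_in.
Qed.

End PullTopology.

Section SliceTopology.
Variables (R : comPzRingType) (W : lmodType R) (A : groupType) (N : topmod W A) (n : nat).

Definition cochain_slice_at (g : n.-tuple A) (u : cochains N n) : submod N :=
  Submod (cochain_slice u g).

Definition chain_slice_at (g : n.-tuple A) (u : chains N n) : submod N :=
  Submod (chain_slice u g).

Lemma continuous_into_cochains (S : topologicalType) (F : S -> top_space (cochain_top N n)) :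
  (forall g, continuous (fun s => cochain_slice_at g (F s) : topmod_space N)) ->
  continuous F.
Proof.
move=> cF; suff /continuousP c : continuous (F : S -> initial_topology (@cochain_slices _ _ _ N n)).
  by apply/continuousP => U; exact: c.
by apply: continuous_comp_initial; apply: continuous_into_prod.
Qed.

Lemma continuous_into_chains (S : topologicalType) (F : S -> top_space (chain_top N n)) :
  (forall g, continuous (fun s => chain_slice_at g (F s) : topmod_space N)) ->
  continuous F.
Proof.
move=> cF; suff /continuousP c : continuous (F : S -> initial_topology (@chain_slices _ _ _ N n)).
  by apply/continuousP => U; exact: c.
by apply: continuous_comp_initial; apply: continuous_into_prod.
Qed.

Lemma cochain_slice_continuous g :
  continuous (cochain_slice_at g : top_space (cochain_top N n) -> topmod_space N).
Proof.
suff /continuousP c : continuous (cochain_slice_at g :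
    initial_topology (@cochain_slices _ _ _ N n) -> topmod_space N).
  by apply/continuousP => U; exact: c.
apply: (@continuous_compose (initial_topology (@cochain_slices _ _ _ N n)) (slices N n)
  (topmod_space N) (@cochain_slices _ _ _ N n) (fun e => e g)).
  exact: initial_continuous.
exact: continuous_proj.
Qed.

Lemma chain_slice_continuous g :
  continuous (chain_slice_at g : top_space (chain_top N n) -> topmod_space N).
Proof.
suff /continuousP c : continuous (chain_slice_at g :
    initial_topology (@chain_slices _ _ _ N n) -> topmod_space N).
  by apply/continuousP => U; exact: c.
apply: (@continuous_compose (initial_topology (@chain_slices _ _ _ N n)) (slices N n)
  (topmod_space N) (@chain_slices _ _ _ N n) (fun e => e g)).
  exact: initial_continuous.
exact: continuous_proj.
Qed.

End SliceTopology.

Section ReducedCohomologyMaps.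
Variables (R : comPzRingType) (W : lmodType R) (A B : groupType).
Variables (N : topmod W A) (N' : topmod W B) (n : nat).

Section Induced.
Variables (bor : set (set A)) (theta : A -> B).
Hypotheses (lN : local_for bor N) (tm : tame_pull bor N N' theta).
Hypothesis ct : continuous (pull_cochain lN tm (n := n) :
  top_space (cochain_top N' n) -> top_space (cochain_top N n)).

Lemma rcohomology_map :
  exists2 F : {linear rcohomology N' n -> rcohomology N n},
    induces (pullf (@simplex_map A B theta n)) F &
    continuous (F : rcohomology_space N' n -> rcohomology_space N n).
Proof.
have BB u : u \in closed_coboundaries N' n -> pull_cochain lN tm u \in closed_coboundaries N n.
  by apply: closure_pred_map => //; exact: pullf_coboundary.
have [F indF] := cohomology_map BB.
exists F => //; apply: (induces_continuous indF _ _ ct) => // u.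
exact: pullf_cocycle.
Qed.

End Induced.

(** For fixed [g] finitely many slices of the argument enter the slice at [g], uniformly over the
    whole group, because [theta] is controlled on all sets. *)
Lemma pull_cochain_continuous (theta : A -> B)
    (tm : tame_pull [set: set A] N N' theta) (p : submod N' -> submod N) :
  continuous_ops N -> continuous (p : topmod_space N' -> topmod_space N) ->
  (forall f, val (p f) = pullf theta (val f)) ->
  continuous (pull_cochain (local_all N) tm (n := n) :
    top_space (cochain_top N' n) -> top_space (cochain_top N n)).
Proof.
move=> good cp pE; apply: continuous_into_cochains => g.
apply: (@piecewise_continuous _ _ _ _ good (top_space (cochain_top N' n)) _
  [set (@simplex_map A B theta n (x, g)).2 | x in [set: A]]
  (fun h u => p (cochain_slice_at h u))).
- rewrite simplex_mapE.
  apply: (@finite_simplices _ _ [set: set A] _ _ theta) => //; first exact: tm.1.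
  by move=> _ S _; exact: near_refl.
- by move=> h _; apply: continuous_compose cp; exact: cochain_slice_continuous.
- move=> x; right; exists (@simplex_map A B theta n (x, g)).2; first by exists x.
  by move=> u; rewrite pE.
Qed.

End ReducedCohomologyMaps.

Lemma closed_coboundaries_sub (R : comPzRingType) (W : lmodType R) (A : groupType)
    (N1 N2 : topmod W A) n (p : submod N1 -> submod N2) :
  continuous (p : topmod_space N1 -> topmod_space N2) -> (forall f, val (p f) = val f) ->
  forall (u1 : cochains N1 n) (u2 : cochains N2 n), val u2 = val u1 ->
     u1 \in closed_coboundaries N1 n -> u2 \in closed_coboundaries N2 n.
Proof.
move=> cp pE u1 u2 uE.
have N12 f : f \in N1 -> f \in N2.
  by move=> fN; rewrite -[f]/(val (Submod fN)) -pE; exact: submodP.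
pose k m (u : cochains N1 m) : cochains N2 m := Submod (cochain_sub N12 u).
rewrite (_ : u2 = k n u1); last exact: val_inj.
apply: closure_pred_map => [|u /coboundary_predP Bu]; last first.
  apply/coboundary_predP; case: (n) u Bu => // m u [b uE'].
  by exists (k m b).
apply: continuous_into_cochains => g.
apply: (@continuous_ext (top_space (cochain_top N1 n)) (topmod_space N2)
  (p \o cochain_slice_at g)).
  by move=> u; apply: val_inj; rewrite pE.
apply: continuous_compose cp; exact: cochain_slice_continuous.
Qed.

(** * The topology of the inverse pull-back *)

Section PullInverseTopology.
Variables (R : comPzRingType) (W : lmodType R) (G H : groupType).
Variables (phi : G -> H) (coarse_phi : coarse_map phi).
Variables (emb : coarse_embedding phi) (E : choices phi).
Variables (L : topmod W G) (good : continuous_ops L).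
Local Notation PL := (pullinv_topmod emb E L).
Local Notation h := (enumeration E).

Definition component_sub j (F : submod PL) : submod L :=
  Submod ((pullinv_component E (submodP F)).1 j).

Lemma component_sub_continuous j :
  continuous (component_sub j : topmod_space PL -> topmod_space L).
Proof.
apply: final_from => -[].
apply: (@continuous_ext (pullinv_source E L) (topmod_space L)
  (fun s : pullinv_source E L => cut_val (s j))).
  move=> s; apply: val_inj; apply/funext => x /=.
  have [Xx|nXx] := pselect (Xpiece E j x).
    by rewrite component_in//; exact/esym/pullinv_glueE.
  by rewrite component_out// -cut_restr restr_out.
apply: (@continuous_compose _ (cut_space L (Xpiece E j)) _ (fun s : pullinv_source E L => s j)).
  exact: continuous_proj.
exact: cut_val_continuous.
Qed.

Lemma continuous_into_pullinv (S : topologicalType) (F : S -> topmod_space PL) :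
  (forall j, continuous (fun s => component_sub j (F s) : topmod_space L)) -> continuous F.
Proof.
move=> cF.
have cX j s : restr (Xpiece E j) (val (component_sub j (F s))) = val (component_sub j (F s)).
  exact: restr_id.
pose k s : pullinv_source E L := fun j => cut_lift (cX j) s.
apply: (@continuous_ext S (topmod_space PL) (@pullinv_glue _ _ _ _ _ emb E L \o k)).
  move=> s; apply: val_inj.
  exact: (pullinv_component E (submodP (F s))).2.
apply: continuous_compose; last exact: (@final_to unit _ _ _ tt).
by apply: continuous_into_prod => j; apply: cut_lift_continuous.
Qed.

Definition pullinv_sub (F : submod PL) : submod L := Submod (pullf_pullinv (submodP F)).

(** The piece Y_0 is the whole range of [phi], so component 0 determines the pull-back: phi(x) =
    phi(x') with x' in X_0 and x' x^-1 in the finite set [coarse_fibre phi 1]. *)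
Lemma pullinv_sub_continuous : continuous (pullinv_sub : topmod_space PL -> topmod_space L).
Proof.
apply: (@piecewise_continuous _ _ _ _ good (topmod_space PL) _ (coarse_fibre phi 1%g)
  (fun e F => submod_translate e^-1%g (component_sub 0 F))).
- exact: coarse_fibre_finite.
- move=> e _; have [_ _ ct] := good.
  by apply: continuous_compose (ct _); exact: component_sub_continuous.
- move=> x; right.
  have Y0 : Ypiece E 0 (phi x) by split; [exists x|].
  have [x' Xx' x'x] := Ypiece_Xpiece Y0.
  exists (x' * x^-1)%g; first by exists (x', x) => //=; rewrite mul1g.
  move=> F; rewrite /= /translate invgK mulgVK component_in// enumeration0 mul1g x'x.
  by [].
Qed.

(** The product topology allows one component to be tested at a time. This confines y to h_j Y_j, a
    bounded set, on which [omega] is controlled and finitely many slices occur. *)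
Lemma omega_cochain_continuous n :
  continuous (pull_cochain (local_pullinv emb E L) (tame_pull_omega emb E L) (n := n) :
    top_space (cochain_top L n) -> top_space (cochain_top PL n)).
Proof.
apply: continuous_into_cochains => g; apply: continuous_into_pullinv => j.
apply: (@piecewise_continuous _ _ _ _ good (top_space (cochain_top L n)) _
  [set (@simplex_map H G (omega E) n (y, g)).2 |
     y in [set y | Ypiece E j ((h j)^-1 * y)%g]]
  (fun g' u => cochain_slice_at g' u)).
- rewrite simplex_mapE.
  apply: (@finite_simplices _ _ (bounded_sets E) _ _ (omega E)).
  + exact: bounded_shift.
  + exact: omega_controlled.
  + by move=> _ S _; exact: near_refl.
  + by exists j.+1 => y Yj; apply/coveredP; exists j.
- by move=> g' _; exact: cochain_slice_continuous.
- move=> x; have [Xx|nXx] := pselect (Xpiece E j x); last first.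
    by left=> u; exact: component_out.
  right; exists (@simplex_map H G (omega E) n ((h j * phi x)%g, g)).2.
    by exists (h j * phi x)%g => //; exact: Xpiece_Ypiece.
  move=> u; rewrite [LHS]component_in// /slice /pullf /=.
  by congr (submod_val u (_, _)); rewrite /= omega_piece.
Qed.

Lemma rcohomology_pullinv_iso n :
  exists F : {linear rcohomology PL n -> rcohomology L n},
    induces (pullf (@simplex_map G H phi n)) F /\
    topological_isomorphism (F : rcohomology_space PL n -> rcohomology_space L n).
Proof.
have tm := tame_pull_pullinv L coarse_phi.
have [F indF cF] := rcohomology_map
  (@pull_cochain_continuous _ _ _ _ L PL n _ tm pullinv_sub good pullinv_sub_continuous
    (fun=> erefl)).
have [F' indF' cF'] := rcohomology_map (@omega_cochain_continuous n).
exists F; split=> //; exists F' => //; split.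
  apply: (pull_cancel (local_pullinv emb E L) _ indF indF').
    by move=> u Bu; exact/closure_predP/subset_closure.
  exact: phi_omega_close.
apply: (pull_cancel (local_all L) _ indF' indF).
  by move=> u Bu; exact/closure_predP/subset_closure.
by move=> S _; apply: near_sub (omega_phi_near emb E).
Qed.

End PullInverseTopology.

(** * Topologies on push-forwards and reduced homology *)

Section PullPush.
Variables (R : comPzRingType) (W : lmodType R) (G : groupType) (T : choiceType).
Variables (theta kappa : G -> T) (L : topmod W G).

(** The elements that move x into the fibre of [theta] over [kappa x]; if kappa = c theta this is
    [coarse_fibre theta c]. *)
Definition fibre_shifts : set G :=
  [set (p.1 * p.2^-1)%g | p in [set p : G * G | theta p.1 = kappa p.2]].

Hypothesis fin : finite_set fibre_shifts.

(** Writing the points of the fibre over [kappa x] as e x turns a sum over a varying fibre into a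
    fixed finite sum of restricted translates, which is visibly continuous in [f]. *)
Lemma pull_pushE (f : G -> W) : pullf kappa (pushf theta f) =
  \sum_(e <- fset_set fibre_shifts)
     restr [set x | theta (e * x)%g = kappa x] (translate e^-1%g f).
Proof.
apply/funext => x; rewrite fct_sumE /pullf /= /pushf -fsbig_finite//.
rewrite (@reindex_fsbig _ _ _ _ _ (fun e => (e * x)%g)
  (fibre_shifts `&` [set e | theta (e * x)%g = kappa x])).
  rewrite fsbig_mkcondr; apply: eq_fsbigr => e _.
  rewrite /restr (_ : (x \in [set x | theta (e * x)%g = kappa x]) =
    (e \in [set e | theta (e * x)%g = kappa x])).
    by case: ifP => // _; rewrite /translate invgK.
  by apply/idP/idP; rewrite !inE.
split=> [e [_]//|e e' _ _ /mulIg//|x' /= x'E].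
exists (x' * x^-1)%g; last by rewrite mulgVK.
by split; [exists (x', x)|rewrite /= mulgVK].
Qed.

Lemma pull_push_in (f : G -> W) : f \in L -> pullf kappa (pushf theta f) \in L.
Proof.
by move=> fL; rewrite pull_pushE; apply: rpred_sum => e _; apply/resmod_restr/resmod_translate.
Qed.

Definition pull_push (f : submod L) : submod L := Submod (pull_push_in (submodP f)).

Lemma pull_push_continuous : continuous_ops L ->
  continuous (pull_push : topmod_space L -> topmod_space L).
Proof.
move=> good; have [_ cres ct] := good.
apply: (@continuous_ext (topmod_space L) (topmod_space L)
  (fun f => \sum_(e <- fset_set fibre_shifts)
    submod_restr [set x | theta (e * x)%g = kappa x] (submod_translate e^-1%g f))).
  by move=> f; apply: val_inj; rewrite submod_val_sum /= pull_pushE.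
apply: (continuous_sum good) => e; exact: continuous_compose (ct _) (cres _).
Qed.

End PullPush.

Section PushTopology.
Variables (R : comPzRingType) (W : lmodType R) (G H : groupType).
Variables (phi : G -> H) (emb : coarse_embedding phi) (E : choices phi).
Variables (L : topmod W G).
Local Notation PL := (push_topmod emb E L).
Local Notation h := (enumeration E).

Definition push_component j (F : submod PL) : submod L := Submod (component_in_L emb E j F).

(** Here the length of the sum is prescribed by a bound on the support, so one [J] serves a whole
    family of functions, unlike in [push_sum_surj]. *)
Lemma push_sum_components (J : nat) (v : submod PL) : supp (val v) `<=` covered E J.+1 ->
  v = push_sum (fun j : 'I_J.+1 => component_cut emb E v j).
Proof.
move=> vJ; apply: val_inj; rewrite /push_sum submod_val_sum.
apply/funext => y; rewrite fct_sumE.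
under eq_bigr => j _ do rewrite (@push_term_component _ _ _ _ _ E _ _ (val v))//.
have [vy|nvy] := pselect (supp (val v) y); last first.
  by rewrite suppN// big1// => j _; rewrite /restr; case: ifP => // _; rewrite suppN.
have /coveredP[j0 j0J Yj0] := vJ _ vy.
rewrite (bigD1 (Ordinal j0J))//= restr_in// big1 ?addr0// => j /eqP jj0.
rewrite restr_out// => Yj; apply: jj0; apply: val_inj.
exact: Ypiece_uniq Yj Yj0.
Qed.

(** The bound [J] must be uniform in [s]: what the final topology supplies is the continuity of
    [push_sum] for each fixed length. *)
Lemma continuous_into_push (S : topologicalType) (J : nat) (F : S -> topmod_space PL) :
  (forall s, supp (val (F s : submod PL)) `<=` covered E J.+1) ->
  (forall j, continuous (fun s => push_component j (F s) : topmod_space L)) ->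
  continuous F.
Proof.
move=> FJ cF.
have cX j s : restr (Xpiece E j) (val (push_component j (F s))) = val (push_component j (F s)).
  exact: restr_id.
pose k s : push_source E L J := fun j : 'I_J.+1 => cut_lift (cX j) s.
apply: (@continuous_ext S (topmod_space PL) (@push_sum _ _ _ _ _ E L J \o k)).
  move=> s; rewrite /= [RHS](push_sum_components (FJ s)); apply: eq_bigr => j _.
  by congr (push_term _ _); apply: val_inj.
apply: continuous_compose; last exact: (@final_to nat _ _ (@push_sum _ _ _ _ _ E L) J).
by apply: continuous_into_prod => j; apply: cut_lift_continuous.
Qed.

(** Additivity splits [q] along [push_sum]; the finite sum is then formed in [Q], so joint
    continuity of addition is asked of the target. *)
Lemma continuous_from_push (K : groupType) (Q : topmod W K) (q : submod PL -> submod Q) :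
  continuous_ops Q -> (forall u v, q (u + v) = q u + q v) ->
  (forall j, continuous (fun u : cut_space L (Xpiece E j) =>
     q (push_term E j (cut_val u)) : topmod_space Q)) ->
  continuous (q : topmod_space PL -> topmod_space Q).
Proof.
move=> gQ qD cq; apply: final_from => J.
have q0 : q 0 = 0 by apply: (@addIr _ (q 0)); rewrite -qD !add0r.
apply: (@continuous_ext (push_source E L J) (topmod_space Q)
  (fun s => \sum_(j < J.+1) q (push_term E j (cut_val (s j))))).
  move=> s; rewrite /= /push_sum; elim/big_rec2: _ => [|j u v _ ->]; first by rewrite q0.
  by rewrite qD.
apply: (continuous_sum gQ) => j.
apply: (@continuous_compose (push_source E L J) (cut_space L (Xpiece E j)) (topmod_space Q)
  (fun s => s j) (fun u => q (push_term E j (cut_val u)))); last exact: cq.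
exact: continuous_proj.
Qed.

Definition pushf_sub (f : submod L) : submod PL := Submod (pushf_push phi (submodP f)).

Lemma componentE j (F : H -> W) : component E j F =
  restr (Xpiece E j) (pullf (fun x => h j * phi x)%g F).
Proof. by rewrite /component; congr restr; apply/funext => x; rewrite /pullf /translate /= invgK. Qed.

(** All values are supported on the range of [phi], which is h_0 Y_0, so [J] = 0 works. The
    components are restrictions of the finite sums of [pull_pushE]. *)
Lemma pushf_sub_continuous : continuous_ops L ->
  continuous (pushf_sub : topmod_space L -> topmod_space PL).
Proof.
move=> good; have [_ cres _] := good; apply: (@continuous_into_push _ 0) => [f y fy|j].
  apply: covered_range; apply: contrapT => ny; move: fy; apply/negP/negPn/eqP.
  by apply: pushf_out => x xy; case: ny; exists x.
have fin : finite_set (fibre_shifts phi (fun x => h j * phi x)%g) by exact: coarse_fibre_finite.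
apply: (@continuous_ext (topmod_space L) (topmod_space L) _ _ _
  (continuous_compose (@pull_push_continuous _ _ _ _ _ _ L fin good) (cres (Xpiece E j)))).
by move=> f; apply: val_inj; rewrite /= componentE.
Qed.

Definition omega_sub (F : submod PL) : submod L :=
  Submod (let: And3 _ _ p := tame_omega emb E L in p _ (submodP F)).

Lemma omega_subD u v : omega_sub (u + v) = omega_sub u + omega_sub v.
Proof.
have [_ prop _] := tame_omega emb E L.
have uv : val (u + v) = 1 *: val u + val v by rewrite submod_valD scale1r.
apply: val_inj; rewrite submod_valD.
rewrite [LHS](_ : _ = pushf (omega E) (val (u + v)))// uv.
rewrite pushf_linear ?scale1r//; apply: prop.
  by exists (val u) => //; exact: submodP.
by exists (val v) => //; exact: submodP.
Qed.

Lemma omega_sub_term j (u : cut_space L (Xpiece E j)) :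
  omega_sub (push_term E j (cut_val u)) = cut_val u.
Proof.
apply: val_inj; rewrite /= -pushf_shift.
have uX x : supp (val (cut_val u)) x -> omega E (h j * phi x)%g = x.
  by rewrite -cut_restr => ux; have [Xx _] := supp_restr ux; exact: omega_piece.
rewrite -pushf_comp; last first.
  by move=> x; apply: (sub_finite_set _ (finite_set1 x)) => x' [/uX /= e <-].
rewrite (@eq_pushf _ _ _ _ _ id) ?pushf_id//.
Qed.

Lemma omega_sub_continuous : continuous_ops L ->
  continuous (omega_sub : topmod_space PL -> topmod_space L).
Proof.
move=> good; apply: continuous_from_push => // [|j]; first exact: omega_subD.
apply: (@continuous_ext (cut_space L (Xpiece E j)) (topmod_space L) _ _ _
  (@cut_val_continuous _ _ _ L (Xpiece E j))) => u.
by rewrite omega_sub_term.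
Qed.

End PushTopology.

Section ReducedHomologyMaps.
Variables (R : comPzRingType) (W : lmodType R) (A B : groupType).
Variables (N : topmod W A) (N' : topmod W B) (theta : A -> B).
Hypothesis tm : tame N theta N'.

(* [D_n(theta)] need not be continuous, but it respects the closures of the
   boundaries as far as cycles are concerned. *)
Definition respects_closures n : Prop := forall u, u \in cycle_pred N n ->
  u \in closed_boundaries N n -> push_chain tm u \in closed_boundaries N' n.

Lemma rhomology_map n : respects_closures n ->
  exists F : {linear rhomology N n -> rhomology N' n},
    induces (pushf (@simplex_map A B theta n)) F.
Proof. exact: homology_map. Qed.

Lemma boundary_closed (C : groupType) (M : topmod W C) n u :
  u \in boundary_pred M n -> u \in closed_boundaries M n.
Proof. by move=> Bu; exact/closure_predP/subset_closure. Qed.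

Variable p : submod N -> submod N'.
Hypothesis cp : continuous (p : topmod_space N -> topmod_space N').
Hypothesis pE : forall f, val (p f) = pushf theta (val f).

(** A 0-chain consists of one slice, indexed by the empty tuple, on which the map is [p]. *)
Lemma push_chain0_continuous : continuous (push_chain tm (n := 0) :
  top_space (chain_top N 0) -> top_space (chain_top N' 0)).
Proof.
apply: continuous_into_chains => g.
apply: (@continuous_ext (top_space (chain_top N 0)) (topmod_space N')
  (p \o chain_slice_at [tuple])).
  move=> u; apply: val_inj; rewrite /= pE; apply/funext => y; rewrite /slice.
  have -> : pushf theta (fun x => val u (x, [tuple])) =
      (fun y => pushf (@simplex_map A B theta 0) (val u) (y, [tuple])); last by rewrite [g]tuple0.
  apply/funext => {}y; rewrite /pushf.
  rewrite (@reindex_fsbig _ _ _ _ _ (fun x : A => (x, [tuple] : 0.-tuple A))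
    (theta @^-1` [set y]))//.
  split=> [x /= <-|x x' _ _ []//|[x t] /= e]; first by congr (_, _); rewrite [LHS]tuple0.
  by exists x; [case: e|rewrite [t]tuple0].
apply: continuous_compose cp; exact: chain_slice_continuous.
Qed.

(** Continuity settles degree 0; in positive degrees the image is a cycle, and all cycles of the
    target lie in the closure of the boundaries. *)
Lemma continuous_respects_closures n : respects_closures n.
Proof.
move=> u Zu; case: n u Zu => [|n] u Zu clu; last exact/rhomology_vanish/pushf_cycle.
apply: closure_pred_map clu; first exact: push_chain0_continuous.
exact: pushf_boundary.
Qed.

Lemma rhomology_map_continuous n (F : rhomology N n -> rhomology N' n) :
  induces (pushf (@simplex_map A B theta n)) F ->
  continuous (F : rhomology_space N n -> rhomology_space N' n).
Proof.
case: n F => [|n] F indF.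
  by apply: (induces_continuous indF _ _ push_chain0_continuous) => // u; exact: pushf_cycle.
(* The target is a trivial module in positive degrees, so [F] is constant. *)
apply: (@continuous_ext (rhomology_space N n.+1) (rhomology_space N' n.+1) (fun=> F 0)).
  move=> c; elim/quotW: (F 0) => x; elim/quotW: (F c) => y.
  by apply/subquotP; rewrite -submod_valB; apply/rhomology_vanish/submodP.
exact: cst_continuous.
Qed.

End ReducedHomologyMaps.

(** On cycles, [theta] and [sigma \o eta] induce maps that differ by boundaries. Factoring through
    [L] moves the continuity questions to maps out of and into a module with good operations. *)
Lemma respects_closures_via (R : comPzRingType) (W : lmodType R) (A B C : groupType)
    (N : topmod W A) (N' : topmod W B) (L : topmod W C) (theta : A -> B)
    (eta : A -> C) (sigma : C -> B) (tm : tame N theta N')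
    (te : tame N eta L) (ts : tame L sigma N') n :
  close_on (supports N) (sigma \o eta) theta ->
  respects_closures te n -> respects_closures ts n -> respects_closures tm n.
Proof.
move=> close re rs u Zu clu.
have [b bE] := prism_homotopy tm close ((cycle_predP _).1 Zu).
have tse : tame N (sigma \o eta) N'.
  by apply: (tame_push_close (bounded_supports N) _ tm) => S bS; apply/near_sym/close.
have -> : push_chain tm u = push_chain ts (push_chain te u) -
    (push_chain ts (push_chain te u) - push_chain tm u) by rewrite opprB addrC subrK.
rewrite -scaleN1r rpredD//; first by apply: rs; [exact: pushf_cycle|exact: re].
rewrite rpredZ//; apply/boundary_closed/boundary_predP; exists b.
by rewrite -bE submod_valB /= (push_push _ tse).
Qed.

Section ReducedHomologyCosets.
Variables (R : comPzRingType) (W : lmodType R) (A : groupType).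

Lemma tame_inclusion (N1 N2 : resmod W A) : (forall f, f \in N1 -> f \in N2) ->
  tame N1 id N2.
Proof.
move=> N12; have [ctl prop push] := tame_id N1; split=> // f fN.
exact/N12/push.
Qed.

Lemma closed_boundaries_sub (N1 N2 : topmod W A) n (tm : tame N1 id N2) :
  respects_closures tm n ->
  forall (u1 : chains N1 n) (u2 : chains N2 n), val u2 = val u1 ->
    u1 \in cycle_pred N1 n -> u1 \in closed_boundaries N1 n ->
    u2 \in closed_boundaries N2 n.
Proof.
move=> rc u1 u2 uE Zu clu; rewrite (_ : u2 = push_chain tm u1); first exact: rc.
by apply: val_inj; rewrite uE /= pushf_simplex_id.
Qed.

End ReducedHomologyCosets.

Section PushClosures.
Variables (R : comPzRingType) (W : lmodType R) (G H : groupType).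
Variables (phi : G -> H) (coarse_phi : coarse_map phi).
Variables (emb : coarse_embedding phi) (E : choices phi).
Variables (L : topmod W G) (good : continuous_ops L).
Local Notation PL := (push_topmod emb E L).

Lemma phi_respects n : respects_closures (N' := PL) (tame_coarse coarse_phi L) n.
Proof. exact: (continuous_respects_closures _ (pushf_sub_continuous (emb := emb) (E := E) good)). Qed.

Lemma omega_respects n : respects_closures (N := PL) (tame_omega emb E L) n.
Proof. exact: (continuous_respects_closures _ (omega_sub_continuous good)). Qed.

Lemma rhomology_push_iso n :
  exists F : {linear rhomology L n -> rhomology PL n},
    induces (pushf (@simplex_map G H phi n)) F /\
    topological_isomorphism (F : rhomology_space L n -> rhomology_space PL n).
Proof.
have [F indF] := rhomology_map (phi_respects (n := n)).
have [F' indF'] := rhomology_map (omega_respects (n := n)).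
exists F; split=> //; exists F' => //; split.
- apply: (push_cancel (@boundary_closed _ _ _ L n) indF indF') => S _.
  exact: near_sub (omega_phi_near emb E).
- apply: (push_cancel (@boundary_closed _ _ _ PL n) indF' indF) => S bS.
  exact/phi_omega_close/(supports_bounded emb E bS).
- exact: (rhomology_map_continuous (N' := PL) (tame_coarse coarse_phi L)
    (pushf_sub_continuous (emb := emb) (E := E) good)
    (fun=> erefl) indF).
- exact: (rhomology_map_continuous (N := PL) (tame_omega emb E L) (omega_sub_continuous good)
    (fun=> erefl) indF').
Qed.

(* The topologies for two close embeddings have the same closed boundaries:
   both are detected by [omega] followed by the other embedding. *)
Lemma close_respects (phi' : G -> H) (coarse_phi' : coarse_map phi')
    (emb' : coarse_embedding phi') (E' : choices phi') n :
  near_on setT phi phi' ->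
  forall (u1 : chains PL n) (u2 : chains (push_topmod emb' E' L) n), val u2 = val u1 ->
    u1 \in cycle_pred PL n -> u1 \in closed_boundaries PL n ->
    u2 \in closed_boundaries (push_topmod emb' E' L) n.
Proof.
move=> close; have N12 := push_close coarse_phi' (near_sym close) (L := L).
apply: (@closed_boundaries_sub _ _ _ PL (push_topmod emb' E' L) n (tame_inclusion N12)).
have r' : respects_closures (N' := push_topmod emb' E' L) (tame_coarse coarse_phi' L) n.
  exact: (continuous_respects_closures _ (pushf_sub_continuous (emb := emb') (E := E') good)).
apply: respects_closures_via (@omega_respects n) r' => S bS.
apply: near_trans (phi_omega_close (supports_bounded emb E bS)).
by apply: (near_comp (f := phi') (g := phi)); apply: near_sub (near_sym close).
Qed.

End PushClosures.

Lemma bounded_bigcup (G H : groupType) (phi : G -> H) (E : choices phi) (I : choiceType)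
    (D : set I) (S : I -> set H) : finite_set D ->
  (forall i, bounded_sets E (S i)) -> bounded_sets E (\bigcup_(i in D) S i).
Proof.
move=> + bS => /finite_seqP[r ->]; elim: r => [|i r [J IH]].
  by exists 0%N => y [].
have [J' SJ'] := bS i; exists (maxn J J') => y [j /=].
rewrite in_cons => /predU1P[->|rj] Sy.
  by apply: covered_mono (SJ' _ Sy); exact: leq_maxr.
by apply: covered_mono (IH y _); [exact: leq_maxl|exists j].
Qed.

(** * Topologies of iterated push-forwards *)

Section PushCompTopology.
Variables (R : comPzRingType) (W : lmodType R) (G H K : groupType).
Variables (phi : G -> H) (coarse_phi : coarse_map phi).
Variables (emb : coarse_embedding phi) (E : choices phi).
Variables (psi : H -> K) (coarse_psi : coarse_map psi).
Variables (emb_psi : coarse_embedding psi) (E_psi : choices psi).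
Variables (L : topmod W G) (good : continuous_ops L).
Local Notation PL := (push_topmod emb E L).
Local Notation PPL := (push_topmod emb_psi E_psi PL).
Local Notation h := (enumeration E).
Local Notation k := (enumeration E_psi).

Lemma tame_comp : tame L (psi \o phi) PPL.
Proof.
have [ctl prop push] := tame_coarse (coarse_comp coarse_phi coarse_psi) L.
by split=> // f fL; apply: push_comp_sub => //; exact: push.
Qed.

Definition pushf_comp_sub (f : submod L) : submod PPL :=
  Submod (let: And3 _ _ p := tame_comp in p _ (submodP f)).

Lemma comp_near (T : Type) (S : set T) (f g : T -> G) :
  near_on S (psi \o phi \o f) (psi \o phi \o g) -> near_on S f g.
Proof. by move=> fg; apply/(embedding_near emb)/(embedding_near emb_psi). Qed.

(** The factors h_j inside [psi] and k_i outside it change psi(phi(x)) by finitely many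
    displacements, and [psi \o phi] reflects nearness. *)
Lemma comp_fibre_finite i j :
  finite_set (fibre_shifts (psi \o phi) (fun x => k i * psi (h j * phi x))%g).
Proof.
set S := [set p : G * G | (psi \o phi) p.1 = (k i * psi (h j * phi p.2))%g].
suff : near_on S fst snd by [].
apply: comp_near; apply: (@near_trans _ _ _ _ (fun p => psi (h j * phi p.2)%g)).
  apply: (@near_eq _ _ _ (fun p => k i * psi (h j * phi p.2))%g); last exact: near_shift.
  by move=> p Sp; exact: esym Sp.
exact: (coarse_near coarse_psi (near_shift S (fun p => phi p.2) (h j))).
Qed.

(** The two nested final topologies are handled one after the other: [continuous_into_push] for
    [psi], then for [phi] on each component, with a bound on the supports that is uniform in [f] at
    both levels. *)
Lemma pushf_comp_sub_continuous :
  continuous (pushf_comp_sub : topmod_space L -> topmod_space PPL).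
Proof.
have [_ cres _] := good; apply: (@continuous_into_push _ _ _ _ _ _ _ _ _ 0) => [f z fz|i].
  apply: covered_range; apply: contrapT => nz; move: fz; apply/negP/negPn/eqP.
  by apply: pushf_out => x xz; case: nz; exists (phi x).
(* If the i-th component is nonzero at y, then psi(phi(x)) = k_i psi(y) for some x, so phi(x) y^-1
   lies in the finite set [coarse_fibre psi (k i)]. *)
have [J bJ] : bounded_sets E
    (\bigcup_(e in coarse_fibre psi (k i)) [set (e^-1 * y)%g | y in range phi]).
  apply: bounded_bigcup; first exact: coarse_fibre_finite.
  by move=> e; apply: bounded_shift; exists 1%N; exact: covered_range.
apply: (@continuous_into_push _ _ _ _ _ _ _ _ _ J) => [f y fy|j].
  apply: (@covered_mono _ _ _ _ J) => //; apply: bJ; apply: contrapT => ny.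
  move: fy; apply/negP/negPn/eqP; rewrite /= componentE.
  have [Xy|nXy] := pselect (Xpiece E_psi i y); last by rewrite restr_out.
  rewrite restr_in// /pullf /=; apply: pushf_out => x /= xy; case: ny.
  exists (phi x * y^-1)%g; first by exists (phi x, y).
  by exists (phi x); [exists x|rewrite invgM invgK mulgVK].
apply: (@continuous_ext (topmod_space L) (topmod_space L) _ _ _
  (continuous_compose (@pull_push_continuous _ _ _ _ _ _ L (comp_fibre_finite i j) good)
    (cres (Xpiece E j `&` [set x | Xpiece E_psi i (h j * phi x)%g])))).
by move=> f; apply: val_inj; rewrite /= !componentE -restr_restr.
Qed.

Lemma comp_respects n : respects_closures (N' := PPL) tame_comp n.
Proof. exact: (continuous_respects_closures _ pushf_comp_sub_continuous). Qed.

Lemma tame_psi : tame PL psi PPL.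
Proof. exact: (tame_coarse coarse_psi). Qed.

Lemma psi_respects n : respects_closures (N := PL) (N' := PPL) tame_psi n.
Proof.
apply: respects_closures_via (@omega_respects _ _ _ _ _ emb E L good n) (@comp_respects n).
move=> S bS.
exact: (coarse_near coarse_psi (phi_omega_close (supports_bounded emb E bS))).
Qed.

Section Comparison.
Variables (emb_comp : coarse_embedding (psi \o phi)) (E_comp : choices (psi \o phi)).
Local Notation CL := (push_topmod emb_comp E_comp L).

Lemma comp_closed_sub n (u1 : chains CL n) (u2 : chains PPL n) : val u2 = val u1 ->
  u1 \in cycle_pred CL n -> u1 \in closed_boundaries CL n ->
  u2 \in closed_boundaries PPL n.
Proof.
have N12 := push_comp_sub coarse_phi coarse_psi (L := L).
apply: (@closed_boundaries_sub _ _ _ CL PPL n (tame_inclusion N12)).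
apply: respects_closures_via (@omega_respects _ _ _ _ _ emb_comp E_comp L good n)
  (@comp_respects n) => S bS.
exact: (phi_omega_close (supports_bounded emb_comp E_comp bS)).
Qed.

Lemma supports_comp S : supports PPL S -> supports CL S.
Proof. by move=> [f fP <-]; exists f => //; exact: (push_comp_sup coarse_phi coarse_psi). Qed.

Let eta := omega E \o omega E_psi.

Lemma comp_eta_close : close_on (supports PPL) (psi \o phi \o eta) id.
Proof.
move=> S bS; apply: near_trans (phi_omega_close (supports_bounded emb_psi E_psi bS)).
apply: (coarse_near coarse_psi (f := phi \o eta) (g := omega E_psi)).
apply: (near_comp (f := phi \o omega E) (g := id)).
have [f fP fS] := bS; have [J fJ] := push_supp_covered emb_psi E_psi fP.
(* [omega E_psi] maps the support of [f] into the supports of finitely many components of [f]. These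
   components belong to [push phi L], so [phi \o omega E] is near the identity on each support. *)
apply: (@near_bigcup _ _ _ _ _ (fun i => supp (component E_psi i f)) J) => [x|i].
  move=> [z Sz <-]; have /coveredP[i iJ Yi] : covered E_psi J z by apply: fJ; rewrite fS.
  exists i => //; have [Xz zE] := omegaP E_psi z.
  rewrite (piece_indexE Yi) in Xz zE.
  by rewrite /supp /= component_in// -zE; move: Sz; rewrite -fS.
apply/phi_omega_close/(supports_bounded emb E (L := L)); exists (component E_psi i f) => //.
by have /assembled_predP[_] := push_assembled emb_psi E_psi fP; exact.
Qed.

(** Tameness is inherited from [omega E_comp]: both maps become near the identity after
    [psi \o phi], which reflects nearness, so they are close to each other. *)
Lemma tame_eta : tame PPL eta L.
Proof.
have [ctl prop push] := tame_omega emb_comp E_comp L.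
have tm : tame PPL (omega E_comp) L.
  split=> [S e bS|S bS|f fP].
  - exact/ctl/supports_comp.
  - exact/prop/supports_comp.
  - exact/push/(push_comp_sup coarse_phi coarse_psi).
apply: (tame_push_close (bounded_supports PPL) _ tm) => S bS.
apply: comp_near; apply: near_trans (near_sym (comp_eta_close bS)).
exact: (phi_omega_close (supports_bounded emb_comp E_comp (supports_comp bS))).
Qed.

Definition eta_sub (F : submod PPL) : submod L :=
  omega_sub (omega_sub F : submod PL).

(** This is the reason to use [eta] instead of [omega E_comp]: on each summand of [PPL],
    [omega_sub_term] undoes the outer assembly exactly and leaves the continuous map [omega_sub]
    from [PL] to [L]. *)
Lemma eta_sub_continuous : continuous (eta_sub : topmod_space PPL -> topmod_space L).
Proof.
apply: continuous_from_push => // [u v|j]; first by rewrite /eta_sub !omega_subD.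
apply: (@continuous_ext (cut_space PL (Xpiece E_psi j)) (topmod_space L) _ _ _
  (continuous_compose (@cut_val_continuous _ _ _ PL (Xpiece E_psi j))
    (@omega_sub_continuous _ _ _ _ _ emb E L good))) => u.
by rewrite /eta_sub omega_sub_term.
Qed.

Lemma eta_respects n : respects_closures (N := PPL) tame_eta n.
Proof.
apply: (continuous_respects_closures _ eta_sub_continuous) => f.
have [_ prop _] := tame_eta; rewrite pushf_comp//.
by apply: prop; exists (val f) => //; exact: submodP.
Qed.

Lemma comp_closed_sup n (u1 : chains PPL n) (u2 : chains CL n) : val u2 = val u1 ->
  u1 \in cycle_pred PPL n -> u1 \in closed_boundaries PPL n ->
  u2 \in closed_boundaries CL n.
Proof.
have N12 := push_comp_sup coarse_phi coarse_psi (L := L).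
apply: (@closed_boundaries_sub _ _ _ PPL CL n (tame_inclusion N12)).
have coarse_c := coarse_comp coarse_phi coarse_psi.
exact: respects_closures_via comp_eta_close (@eta_respects n)
  (@phi_respects _ _ _ _ _ coarse_c emb_comp E_comp L good n).
Qed.

End Comparison.
End PushCompTopology.

(** * Functoriality *)

Section CosetEquality.
Variables (R : comPzRingType) (W : lmodType R) (A B : groupType).

Lemma push_coset_eq (N : resmod W A) (N1 N2 : resmod W B) n
    (Bd : submodClosed (chains N n)) (Bd1 : submodClosed (chains N1 n))
    (Bd2 : submodClosed (chains N2 n)) (theta1 theta2 : A -> B)
    (F1 : subquot (cycle_pred N n) Bd -> subquot (cycle_pred N1 n) Bd1)
    (F2 : subquot (cycle_pred N n) Bd -> subquot (cycle_pred N2 n) Bd2) :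
  induces (pushf (@simplex_map A B theta1 n)) F1 ->
  induces (pushf (@simplex_map A B theta2 n)) F2 ->
  tame N theta1 N1 -> tame N theta2 N2 -> close_on (supports N) theta1 theta2 ->
  (forall f, f \in N1 -> f \in N2) -> (forall f, f \in N2 -> f \in N1) ->
  (forall (u1 : chains N1 n) (u2 : chains N2 n), val u2 = val u1 ->
     u1 \in cycle_pred N1 n -> u1 \in Bd1 -> u2 \in Bd2) ->
  (forall (u2 : chains N2 n) (u1 : chains N1 n), val u1 = val u2 ->
     u2 \in cycle_pred N2 n -> u2 \in Bd2 -> u1 \in Bd1) ->
  (forall u, u \in boundary_pred N1 n -> u \in Bd1) ->
  (forall u, u \in boundary_pred N2 n -> u \in Bd2) ->
  forall c, coset (F1 c) = coset (F2 c).
Proof.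
move=> ind1 ind2 tm1 tm2 close N12 N21 B12 B21 BB1 BB2 c; elim/quotW: c => z.
have [z1 z1E ->] := ind1 z; have [z2 z2E ->] := ind2 z.
apply/seteqP; split.
  exact: (push_coset_sub N12 B12 BB2 tm2 close z1E z2E).
apply: (push_coset_sub N21 B21 BB1 tm1 _ z2E z1E) => S bS.
exact/near_sym/close.
Qed.

Lemma boundary_sub (N1 N2 : resmod W B) n : (forall f, f \in N1 -> f \in N2) ->
  forall (u1 : chains N1 n) (u2 : chains N2 n), val u2 = val u1 ->
     u1 \in cycle_pred N1 n -> u1 \in boundary_pred N1 n -> u2 \in boundary_pred N2 n.
Proof.
move=> N12 u1 u2 uE _ /boundary_predP[b bE]; apply/boundary_predP.
by exists (Submod (chain_sub N12 b)); rewrite uE.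
Qed.

Lemma coboundary_sub (N1 N2 : resmod W B) n : (forall f, f \in N1 -> f \in N2) ->
  forall (u1 : cochains N1 n) (u2 : cochains N2 n), val u2 = val u1 ->
     u1 \in coboundary_pred N1 n -> u2 \in coboundary_pred N2 n.
Proof.
move=> N12 u1 u2 uE /coboundary_predP Bu; apply/coboundary_predP; rewrite uE.
case: n u1 u2 uE Bu => // n u1 u2 uE [b bE].
by exists (Submod (cochain_sub N12 b)).
Qed.

Lemma pull_coset_eq (N' : resmod W B) (N1 N2 : resmod W A) n
    (Bd : submodClosed (cochains N' n)) (Bd1 : submodClosed (cochains N1 n))
    (Bd2 : submodClosed (cochains N2 n)) (theta1 theta2 : A -> B)
    (F1 : subquot (cocycle_pred N' n) Bd -> subquot (cocycle_pred N1 n) Bd1)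
    (F2 : subquot (cocycle_pred N' n) Bd -> subquot (cocycle_pred N2 n) Bd2) :
  induces (pullf (@simplex_map A B theta1 n)) F1 ->
  induces (pullf (@simplex_map A B theta2 n)) F2 ->
  tame_pull [set: set A] N1 N' theta1 -> tame_pull [set: set A] N2 N' theta2 ->
  near_on setT theta1 theta2 ->
  (forall f, f \in N1 -> f \in N2) -> (forall f, f \in N2 -> f \in N1) ->
  (forall (u1 : cochains N1 n) (u2 : cochains N2 n), val u2 = val u1 ->
     u1 \in Bd1 -> u2 \in Bd2) ->
  (forall (u2 : cochains N2 n) (u1 : cochains N1 n), val u1 = val u2 ->
     u2 \in Bd2 -> u1 \in Bd1) ->
  (forall u, u \in coboundary_pred N1 n -> u \in Bd1) ->
  (forall u, u \in coboundary_pred N2 n -> u \in Bd2) ->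
  forall c, coset (F1 c) = coset (F2 c).
Proof.
move=> ind1 ind2 tm1 tm2 close N12 N21 B12 B21 BB1 BB2 c; elim/quotW: c => z.
have [z1 z1E ->] := ind1 z; have [z2 z2E ->] := ind2 z.
apply/seteqP; split.
  apply: (pull_coset_sub (local_all N2) N12 B12 BB2 tm2 _ z1E z2E) => S _.
  exact: near_sub close.
apply: (pull_coset_sub (local_all N1) N21 B21 BB1 tm1 _ z2E z1E) => S _.
by apply/near_sym; exact: near_sub close.
Qed.

Lemma induces_comp (A1 A2 A3 : Type) (C1 : submodClosed (A1 -> W))
    (C2 : submodClosed (A2 -> W)) (C3 : submodClosed (A3 -> W))
    (Z1 N1 : submodClosed (submod C1)) (Z2 N2 : submodClosed (submod C2))
    (Z3 N3 : submodClosed (submod C3)) T T' T''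
    (F : subquot Z1 N1 -> subquot Z2 N2) (F' : subquot Z2 N2 -> subquot Z3 N3) :
  induces T F -> induces T' F' -> (forall z : submod Z1, T' (T (val (val z))) = T'' (val (val z))) ->
  induces T'' (F' \o F).
Proof.
move=> indF indF' TT z; have [z1 z1E z1F] := indF z; have [z2 z2E z2F] := indF' z1.
by exists z2; [rewrite z2E z1E TT|rewrite /= z1F].
Qed.

End CosetEquality.

Section Functoriality.
Variables (G H K : groupType) (R : comPzRingType) (W : lmodType R).
Variables (phi : G -> H) (coarse_phi : coarse_map phi).
Variables (L : resmod W G) (M : resmod W H).

Lemma homology_functorial n : exists Hphi : {linear homology L n -> homology (push phi L) n},
  [/\ induces (pushf (@simplex_map G H phi n)) Hphi,
      forall (emb : coarse_embedding phi) (E : choices phi),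
        exists2 Homega : {linear homology (push phi L) n -> homology L n},
          induces (pushf (@simplex_map H G (omega E) n)) Homega &
          cancel Hphi Homega /\ cancel Homega Hphi,
      forall phi' : G -> H, coarse_map phi' -> coarsely_equal phi phi' ->
        exists2 Hphi' : {linear homology L n -> homology (push phi' L) n},
          induces (pushf (@simplex_map G H phi' n)) Hphi' &
          forall c, coset (Hphi c) = coset (Hphi' c) &
      forall psi : H -> K, coarse_map psi ->
        exists (Hpsi : {linear homology (push phi L) n ->
                               homology (push psi (push phi L)) n})
               (Hcomp : {linear homology L n -> homology (push (psi \o phi) L) n}),
          [/\ induces (pushf (@simplex_map H K psi n)) Hpsi,
              induces (pushf (@simplex_map G K (psi \o phi) n)) Hcomp &
              forall c, coset (Hcomp c) = coset (Hpsi (Hphi c))]].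
Proof.
have exF (A B : groupType) (N : resmod W A) (N' : resmod W B) theta : tame N theta N' ->
    exists F : {linear homology N n -> homology N' n},
      induces (pushf (@simplex_map A B theta n)) F.
  by move=> tm; apply: (homology_map (tm := tm)) => u _; exact: pushf_boundary.
have tm := tame_coarse coarse_phi L.
have [F indF] := exF _ _ _ _ _ tm; exists F; split=> //.
- move=> emb E; have [F' indF'] := exF _ _ _ _ _ (tame_omega emb E L).
  exists F' => //; split.
    apply: (push_cancel _ indF indF') => // S _.
    exact: near_sub (omega_phi_near emb E).
  apply: (push_cancel _ indF' indF) => // S bS.
  exact/phi_omega_close/(supports_bounded emb E bS).
- move=> phi' coarse_phi' close; have [F' indF'] := exF _ _ _ _ _ (tame_coarse coarse_phi' L).
  exists F' => //.
  have N12 := push_close coarse_phi' (near_sym close) (L := L).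
  have N21 := push_close coarse_phi close (L := L).
  apply: (push_coset_eq indF indF' tm (tame_coarse coarse_phi' L)) => //.
  + by move=> S _; exact: near_sub close.
  + exact: boundary_sub.
  + exact: boundary_sub.
- move=> psi coarse_psi; have [F' indF'] := exF _ _ _ _ _ (tame_coarse coarse_psi (push phi L)).
  have tc := tame_coarse (coarse_comp coarse_phi coarse_psi) L.
  have [F'' indF''] := exF _ _ _ _ _ tc.
  exists F', F''; split=> //.
  have N12 := push_comp_sub coarse_phi coarse_psi (L := L).
  have N21 := push_comp_sup coarse_phi coarse_psi (L := L).
  have tp : tame L (psi \o phi) (push psi (push phi L)).
    by case: tc => ctl prop push; split=> // f fL; exact/N12/push.
  (* The composite of the two maps is itself induced by the simplex map of [psi \o phi].
     Functoriality thus becomes a comparison of two maps given by the same formula with values in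
     two constructions of one module. *)
  have indc : induces (pushf (@simplex_map G K (psi \o phi) n)) (F' \o F).
    by apply: (induces_comp indF indF') => z; rewrite (push_push _ tc).
  apply: (push_coset_eq indF'' indc tc tp) => //.
  + by move=> S _; exact: near_refl.
  + exact: boundary_sub.
  + exact: boundary_sub.
Qed.

Lemma rhomology_functorial (TL : topmod W G) : continuous_ops TL ->
  forall (emb : coarse_embedding phi) (E : choices phi) (n : nat),
  exists Hphi : {linear rhomology TL n -> rhomology (push_topmod emb E TL) n},
  [/\ induces (pushf (@simplex_map G H phi n)) Hphi,
      topological_isomorphism
        (Hphi : rhomology_space TL n -> rhomology_space (push_topmod emb E TL) n),
      forall (phi' : G -> H) (emb' : coarse_embedding phi') (E' : choices phi'),
        coarse_map phi' -> coarsely_equal phi phi' ->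
        exists2 Hphi' : {linear rhomology TL n -> rhomology (push_topmod emb' E' TL) n},
          induces (pushf (@simplex_map G H phi' n)) Hphi' &
          forall c, coset (Hphi c) = coset (Hphi' c) &
      forall (psi : H -> K) (emb_psi : coarse_embedding psi) (E_psi : choices psi)
             (emb_comp : coarse_embedding (psi \o phi)) (E_comp : choices (psi \o phi)),
        coarse_map psi ->
        exists (Hpsi : {linear rhomology (push_topmod emb E TL) n ->
                  rhomology (push_topmod emb_psi E_psi (push_topmod emb E TL)) n})
               (Hcomp : {linear rhomology TL n -> rhomology (push_topmod emb_comp E_comp TL) n}),
          [/\ induces (pushf (@simplex_map H K psi n)) Hpsi,
              induces (pushf (@simplex_map G K (psi \o phi) n)) Hcomp &
              forall c, coset (Hcomp c) = coset (Hpsi (Hphi c))]].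
Proof.
move=> good emb E n.
have [F [indF isoF]] := rhomology_push_iso coarse_phi emb E good n.
have tm := tame_coarse coarse_phi TL.
exists F; split=> //.
- move=> phi' emb' E' coarse_phi' close.
  have [F' [indF' _]] := rhomology_push_iso coarse_phi' emb' E' good n.
  exists F' => //.
  have N12 := push_close coarse_phi' (near_sym close) (L := TL).
  have N21 := push_close coarse_phi close (L := TL).
  apply: (push_coset_eq indF indF' tm (tame_coarse coarse_phi' TL)) => //.
  + by move=> S _; exact: near_sub close.
  + exact: (close_respects good coarse_phi' close).
  + exact: (close_respects good coarse_phi (near_sym close)).
  + exact: (@boundary_closed _ _ _ (push_topmod emb E TL)).
  + exact: (@boundary_closed _ _ _ (push_topmod emb' E' TL)).
- move=> psi emb_psi E_psi emb_comp E_comp coarse_psi.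
  have tc := tame_coarse (coarse_comp coarse_phi coarse_psi) TL.
  have [F' indF'] := rhomology_map (@psi_respects _ _ _ _ _ _ coarse_phi emb E _ coarse_psi
    emb_psi E_psi TL good n).
  have [F'' [indF'' _]] := rhomology_push_iso (coarse_comp coarse_phi coarse_psi)
    emb_comp E_comp good n.
  exists F', F''; split=> //.
  have N12 := push_comp_sub coarse_phi coarse_psi (L := TL).
  have N21 := push_comp_sup coarse_phi coarse_psi (L := TL).
  have indc : induces (pushf (@simplex_map G K (psi \o phi) n)) (F' \o F).
    by apply: (induces_comp indF indF') => z; rewrite (push_push _ tc).
  apply: (push_coset_eq indF'' indc tc (tame_comp coarse_phi emb E coarse_psi emb_psi E_psi TL)) => //.
  + by move=> S _; exact: near_refl.
  + exact: (comp_closed_sub coarse_phi coarse_psi good).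
  + exact: (comp_closed_sup coarse_phi coarse_psi good).
  + exact: (@boundary_closed _ _ _ (push_topmod emb_comp E_comp TL)).
  + exact: (@boundary_closed _ _ _ (push_topmod emb_psi E_psi (push_topmod emb E TL))).
Qed.

Lemma cohomology_functorial n :
  [/\ exists2 Hphi : {linear cohomology M n -> cohomology (pull phi M) n},
        induces (pullf (@simplex_map G H phi n)) Hphi &
        forall phi' : G -> H, coarse_map phi' -> coarsely_equal phi phi' ->
          exists2 Hphi' : {linear cohomology M n -> cohomology (pull phi' M) n},
            induces (pullf (@simplex_map G H phi' n)) Hphi' &
            forall c, coset (Hphi c) = coset (Hphi' c),
      forall (emb : coarse_embedding phi) (E : choices phi),
        exists (Hphi : {linear cohomology (pullinv phi L) n -> cohomology L n})
               (Homega : {linear cohomology L n -> cohomology (pullinv phi L) n}),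
          [/\ induces (pullf (@simplex_map G H phi n)) Hphi,
              induces (pullf (@simplex_map H G (omega E) n)) Homega,
              cancel Hphi Homega & cancel Homega Hphi] &
      forall (N : resmod W K) (psi : H -> K), coarse_map psi ->
        exists (Hpsi : {linear cohomology N n -> cohomology (pull psi N) n})
               (Hphi : {linear cohomology (pull psi N) n ->
                               cohomology (pull phi (pull psi N)) n})
               (Hcomp : {linear cohomology N n -> cohomology (pull (psi \o phi) N) n}),
          [/\ induces (pullf (@simplex_map H K psi n)) Hpsi,
              induces (pullf (@simplex_map G H phi n)) Hphi,
              induces (pullf (@simplex_map G K (psi \o phi) n)) Hcomp &
              forall c, coset (Hcomp c) = coset (Hphi (Hpsi c))]].
Proof.
have exF (A B : groupType) bor (N : resmod W A) (N' : resmod W B) theta :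
    local_for bor N -> tame_pull bor N N' theta ->
    exists F : {linear cohomology N' n -> cohomology N n},
      induces (pullf (@simplex_map A B theta n)) F.
  by move=> lN tm; apply: (cohomology_map (lN := lN) (tm := tm)); exact: pullf_coboundary.
split.
- have tm := tame_pull_coarse coarse_phi M.
  have [F indF] := exF _ _ _ _ _ _ (local_all _) tm; exists F => //.
  move=> phi' coarse_phi' close; have tm' := tame_pull_coarse coarse_phi' M.
  have [F' indF'] := exF _ _ _ _ _ _ (local_all _) tm'; exists F' => //.
  have N12 := pull_close coarse_phi' (near_sym close) (M := M).
  have N21 := pull_close coarse_phi close (M := M).
  apply: (pull_coset_eq indF indF' tm tm') => //; exact: coboundary_sub.
- move=> emb E.
  have [F indF] := exF _ _ _ _ _ _ (local_all L) (tame_pull_pullinv L coarse_phi).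
  have [F' indF'] := exF _ _ _ _ _ _ (local_pullinv emb E L) (tame_pull_omega emb E L).
  exists F, F'; split=> //.
    by apply: (pull_cancel (local_pullinv emb E L) _ indF indF') => //; exact: phi_omega_close.
  apply: (pull_cancel (local_all L) _ indF' indF) => // S _.
  exact: near_sub (omega_phi_near emb E).
- move=> N psi coarse_psi.
  have [F indF] := exF _ _ _ _ _ _ (local_all _) (tame_pull_coarse coarse_psi N).
  have [F' indF'] := exF _ _ _ _ _ _ (local_all _) (tame_pull_coarse coarse_phi (pull psi N)).
  have tc := tame_pull_coarse (coarse_comp coarse_phi coarse_psi) N.
  have [F'' indF''] := exF _ _ _ _ _ _ (local_all _) tc.
  exists F, F', F''; split=> //.
  have N12 := pull_comp_sub (phi := phi) (psi := psi) (N := N).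
  have N21 := pull_comp_sup coarse_phi coarse_psi (N := N).
  have tp : tame_pull [set: set G] (pull phi (pull psi N)) N (psi \o phi).
    by split; [exact: tc.1|move=> f fN; exact/N12/tc.2].
  have indc : induces (pullf (@simplex_map G K (psi \o phi) n)) (F' \o F).
    by apply: (induces_comp indF indF') => z; rewrite -simplex_map_comp.
  by apply: (pull_coset_eq indF'' indc tc tp (near_refl _ _)) => //; exact: coboundary_sub.
Qed.

End Functoriality.

(** * Comparison of pull-back topologies *)

Section PullInclusions.
Variables (R : comPzRingType) (W : lmodType R) (G H K : groupType).
Variables (phi : G -> H) (emb : coarse_embedding phi) (E : choices phi).
Variable P : section_partition E.

Lemma pull_close_inclusion (M : topmod W H) (phi' : G -> H) (coarse_phi' : coarse_map phi')
    (emb' : coarse_embedding phi') (E' : choices phi') (P' : section_partition E') n :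
  continuous_ops M -> near_on setT phi phi' ->
  forall (u1 : cochains (pull_topmod emb P M) n) (u2 : cochains (pull_topmod emb' P' M) n),
    val u2 = val u1 -> u1 \in closed_coboundaries (pull_topmod emb P M) n ->
    u2 \in closed_coboundaries (pull_topmod emb' P' M) n.
Proof.
move=> good close; set Q := pull_topmod emb' P' M.
have gQ : continuous_ops Q by exact: pull_continuous_ops.
have N12 := pull_close coarse_phi' (near_sym close) (M := M).
pose p (f : submod M) : submod Q := Submod (N12 _ (pullf_pull phi (submodP f))).
(* Where the displacement phi(x) phi'(x)^-1 equals c, the pull-back of [f] along [phi] is that of
   [translate c^-1 f] along [phi']; finitely many c occur. *)
have cp : continuous (p : topmod_space M -> topmod_space Q).
  apply: (@piecewise_continuous _ _ _ _ gQ (topmod_space M) _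
    [set phi x * (phi' x)^-1 | x in [set: G]]%g
    (fun c f => pullf_sub emb' P' (submod_translate c^-1%g f))).
  - exact: close.
  - move=> c _; have [_ _ ct] := good.
    by apply: continuous_compose (ct _) _; exact: pullf_sub_continuous.
  - move=> x; right; exists (phi x * (phi' x)^-1)%g; first by exists x.
    by move=> f; rewrite /= /pullf /translate /= invgK mulgVK.
pose i (f : submod (pull_topmod emb P M)) : submod Q := Submod (N12 _ (submodP f)).
apply: (@closed_coboundaries_sub _ _ _ _ _ n i) => //.
exact: (continuous_from_pull gQ cp).
Qed.

Variables (psi : H -> K) (emb_psi : coarse_embedding psi) (E_psi : choices psi).
Variables (P_psi : section_partition E_psi) (N : topmod W K) (good : continuous_ops N).
Variables (emb_comp : coarse_embedding (psi \o phi)) (E_comp : choices (psi \o phi)).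
Variable P_comp : section_partition E_comp.
Local Notation PN := (pull_topmod emb_psi P_psi N).
Local Notation PPN := (pull_topmod emb P PN).
Local Notation CN := (pull_topmod emb_comp P_comp N).
Hypotheses (coarse_phi : coarse_map phi) (coarse_psi : coarse_map psi).

Lemma pull_comp_inclusion n (u1 : cochains CN n) (u2 : cochains PPN n) :
  val u2 = val u1 -> u1 \in closed_coboundaries CN n -> u2 \in closed_coboundaries PPN n.
Proof.
have gPN := pull_continuous_ops emb_psi P_psi good.
have gQ := pull_continuous_ops emb P gPN.
pose i (f : submod CN) : submod PPN :=
  Submod (pull_comp_sub (phi := phi) (psi := psi) (N := N) (submodP f)).
apply: (@closed_coboundaries_sub _ _ _ _ _ n i) => //.
have cp := continuous_compose (pullf_sub_continuous (emb := emb_psi) (P := P_psi) good)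
  (pullf_sub_continuous (emb := emb) (P := P) gPN).
exact: (continuous_from_pull gQ cp).
Qed.

Lemma comp_pull_inclusion n (u1 : cochains PPN n) (u2 : cochains CN n) :
  val u2 = val u1 -> u1 \in closed_coboundaries PPN n -> u2 \in closed_coboundaries CN n.
Proof.
have gQ := pull_continuous_ops emb_comp P_comp good.
have N12 := pull_comp_sup coarse_phi coarse_psi (N := N).
pose p (f : submod PN) : submod CN :=
  Submod (N12 _ (@pullf_pull _ _ _ _ phi (pull psi N) _ (submodP f))).
(* If phi(x) lies in the piece [j] of [psi], the value f(phi(x)) equals that of [spread_sub j f] at
   psi(phi(x)). So on finitely many sets [p] is the pull-back along [psi \o phi] of a spread
   component. *)
have cp : continuous (p : topmod_space PN -> topmod_space CN).
  apply: (@piecewise_continuous _ _ _ _ gQ (topmod_space PN) _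
    [set: 'I_(pieces P_psi).+1]
    (fun j f => pullf_sub emb_comp P_comp (spread_sub j f))).
  - exact: finite_finset.
  - move=> j _; apply: continuous_compose (pullf_sub_continuous (emb := emb_comp) (P := P_comp) good).
    exact: spread_continuous.
  - move=> x; right; have [j Zj] := piece_ex P_psi (phi x); exists j => // f.
    by rewrite /= /pullf /= spread_in.
pose i (f : submod PPN) : submod CN := Submod (N12 _ (submodP f)).
apply: (@closed_coboundaries_sub _ _ _ _ _ n i) => //.
exact: (continuous_from_pull gQ cp).
Qed.

End PullInclusions.

Section ReducedCohomology.
Variables (R : comPzRingType) (W : lmodType R) (G H K : groupType).
Variables (phi : G -> H) (coarse_phi : coarse_map phi).
Variables (emb : coarse_embedding phi) (E : choices phi) (n : nat).

Lemma coboundary_closed (C : groupType) (M : topmod W C) m u :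
  u \in coboundary_pred M m -> u \in closed_coboundaries M m.
Proof. by move=> Bu; exact/closure_predP/subset_closure. Qed.

Lemma rcohomology_pull_map (P : section_partition E) (M : topmod W H) : continuous_ops M ->
  exists2 F : {linear rcohomology M n -> rcohomology (pull_topmod emb P M) n},
    induces (pullf (@simplex_map G H phi n)) F &
    continuous (F : rcohomology_space M n -> rcohomology_space (pull_topmod emb P M) n).
Proof.
move=> good; exact: (rcohomology_map (@pull_cochain_continuous _ _ _ _ (pull_topmod emb P M) M n
  phi (tame_pull_coarse coarse_phi M) (pullf_sub emb P (M := M))
  (pull_continuous_ops emb P good) (pullf_sub_continuous (emb := emb) (P := P) good) (fun=> erefl))).
Qed.

End ReducedCohomology.

Section ReducedFunctoriality.
Variables (G H K : groupType) (R : comPzRingType) (W : lmodType R).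
Variables (phi : G -> H) (coarse_phi : coarse_map phi).

Lemma rcohomology_functorial :
  forall (tR : topology R) (emb : coarse_embedding phi) (E : choices phi) (n : nat),
  [/\ forall (P : section_partition E) (TM : topmod W H),
        topological_resmod tR TM ->
        exists Hphi : {linear rcohomology TM n ->
                              rcohomology (pull_topmod emb P TM) n},
        [/\ induces (pullf (@simplex_map G H phi n)) Hphi,
            continuous (Hphi : rcohomology_space TM n ->
                          rcohomology_space (pull_topmod emb P TM) n) &
            forall (phi' : G -> H) (emb' : coarse_embedding phi')
                   (E' : choices phi') (P' : section_partition E'),
              coarse_map phi' -> coarsely_equal phi phi' ->
              exists2 Hphi' : {linear rcohomology TM n ->
                                 rcohomology (pull_topmod emb' P' TM) n},
                induces (pullf (@simplex_map G H phi' n)) Hphi' &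
                forall c, coset (Hphi c) = coset (Hphi' c)],
      forall TL : topmod W G, topological_resmod tR TL ->
        exists Hphi : {linear rcohomology (pullinv_topmod emb E TL) n ->
                              rcohomology TL n},
          induces (pullf (@simplex_map G H phi n)) Hphi /\
          topological_isomorphism
            (Hphi : rcohomology_space (pullinv_topmod emb E TL) n ->
                    rcohomology_space TL n) &
      forall (P : section_partition E)
             (TN : topmod W K) (psi : H -> K)
             (emb_psi : coarse_embedding psi)
             (E_psi : choices psi) (P_psi : section_partition E_psi)
             (emb_comp : coarse_embedding (psi \o phi))
             (E_comp : choices (psi \o phi)) (P_comp : section_partition E_comp),
        topological_resmod tR TN -> coarse_map psi ->
        exists (Hpsi : {linear rcohomology TN n ->
                          rcohomology (pull_topmod emb_psi P_psi TN) n})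
               (Hphi : {linear
                  rcohomology (pull_topmod emb_psi P_psi TN) n ->
                  rcohomology
                    (pull_topmod emb P (pull_topmod emb_psi P_psi TN)) n})
               (Hcomp : {linear rcohomology TN n ->
                           rcohomology (pull_topmod emb_comp P_comp TN) n}),
          [/\ induces (pullf (@simplex_map H K psi n)) Hpsi,
              induces (pullf (@simplex_map G H phi n)) Hphi,
              induces (pullf (@simplex_map G K (psi \o phi) n)) Hcomp &
              forall c, coset (Hcomp c) = coset (Hphi (Hpsi c))]].
Proof.
move=> tR emb E n; split.
- move=> P TM /topological_continuous_ops good.
  have [F indF cF] := rcohomology_pull_map coarse_phi emb n P good.
  exists F; split=> // phi' emb' E' P' coarse_phi' close.
  have [F' indF' _] := rcohomology_pull_map coarse_phi' emb' n P' good.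
  exists F' => //.
  apply: (pull_coset_eq indF indF' (tame_pull_coarse coarse_phi TM)
    (tame_pull_coarse coarse_phi' TM) close).
  + exact: (pull_close coarse_phi' (near_sym close)).
  + exact: (pull_close coarse_phi close).
  + exact: (pull_close_inclusion coarse_phi' good close).
  + exact: (pull_close_inclusion coarse_phi good (near_sym close)).
  + exact: (@coboundary_closed _ _ _ (pull_topmod emb P TM)).
  + exact: (@coboundary_closed _ _ _ (pull_topmod emb' P' TM)).
- move=> TL /topological_continuous_ops good.
  exact: rcohomology_pullinv_iso.
- move=> P TN psi emb_psi E_psi P_psi emb_comp E_comp P_comp
    /topological_continuous_ops good coarse_psi.
  have coarse_c := coarse_comp coarse_phi coarse_psi.
  have [F indF _] := rcohomology_pull_map coarse_psi emb_psi n P_psi good.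
  have [F' indF' _] := rcohomology_pull_map coarse_phi emb n P
    (pull_continuous_ops emb_psi P_psi good).
  have [F'' indF'' _] := rcohomology_pull_map coarse_c emb_comp n P_comp good.
  exists F, F', F''; split=> //.
  have N12 := pull_comp_sub (phi := phi) (psi := psi) (N := TN).
  have N21 := pull_comp_sup coarse_phi coarse_psi (N := TN).
  have tc := tame_pull_coarse coarse_c TN.
  have tp : tame_pull [set: set G] (pull phi (pull psi TN)) TN (psi \o phi).
    by split; [exact: tc.1|move=> f fN; exact/N12/tc.2].
  have indc : induces (pullf (@simplex_map G K (psi \o phi) n)) (F' \o F).
    by apply: (induces_comp indF indF') => z; rewrite -simplex_map_comp.
  apply: (pull_coset_eq indF'' indc tc tp (near_refl _ _) N12 N21).
  + exact: (pull_comp_inclusion good).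
  + exact: (comp_pull_inclusion good coarse_phi coarse_psi).
  + exact: (@coboundary_closed _ _ _ (pull_topmod emb_comp P_comp TN)).
  + exact: (@coboundary_closed _ _ _ (pull_topmod emb P (pull_topmod emb_psi P_psi TN))).
Qed.

End ReducedFunctoriality.

Theorem theorem4p38 (G H K : groupType)
    (countG : countable [set: G]) (countH : countable [set: H])
    (countK : countable [set: K])
    (R : comPzRingType) (W : lmodType R)
    (phi : G -> H) (coarse_phi : coarse_map phi)
    (L : resmod W G) (M : resmod W H) :
  (* (i) *)
  ((forall n : nat, exists Hphi : {linear homology L n -> homology (push phi L) n},
      [/\ induces (pushf (@simplex_map G H phi n)) Hphi,
          forall (emb : coarse_embedding phi) (E : choices phi),
            exists2 Homega : {linear homology (push phi L) n -> homology L n},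
              induces (pushf (@simplex_map H G (omega E) n)) Homega &
              cancel Hphi Homega /\ cancel Homega Hphi,
          forall phi' : G -> H, coarse_map phi' -> coarsely_equal phi phi' ->
            exists2 Hphi' : {linear homology L n -> homology (push phi' L) n},
              induces (pushf (@simplex_map G H phi' n)) Hphi' &
              forall c, coset (Hphi c) = coset (Hphi' c) &
          forall psi : H -> K, coarse_map psi ->
            exists (Hpsi : {linear homology (push phi L) n ->
                                   homology (push psi (push phi L)) n})
                   (Hcomp : {linear homology L n ->
                                    homology (push (psi \o phi) L) n}),
              [/\ induces (pushf (@simplex_map H K psi n)) Hpsi,
                  induces (pushf (@simplex_map G K (psi \o phi) n)) Hcomp &
                  forall c, coset (Hcomp c) = coset (Hpsi (Hphi c))]])
   /\
   (forall (tR : topology R) (TL : topmod W G),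
      topological_field tR -> topological_resmod tR TL ->
      forall (emb : coarse_embedding phi) (E : choices phi) (n : nat),
      exists Hphi : {linear rhomology TL n ->
                            rhomology (push_topmod emb E TL) n},
      [/\ induces (pushf (@simplex_map G H phi n)) Hphi,
          topological_isomorphism
            (Hphi : rhomology_space TL n ->
                    rhomology_space (push_topmod emb E TL) n),
          forall (phi' : G -> H) (emb' : coarse_embedding phi')
                 (E' : choices phi'),
            coarse_map phi' -> coarsely_equal phi phi' ->
            exists2 Hphi' : {linear rhomology TL n ->
                                    rhomology (push_topmod emb' E' TL) n},
              induces (pushf (@simplex_map G H phi' n)) Hphi' &
              forall c, coset (Hphi c) = coset (Hphi' c) &
          forall (psi : H -> K) (emb_psi : coarse_embedding psi)
                 (E_psi : choices psi)
                 (emb_comp : coarse_embedding (psi \o phi))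
                 (E_comp : choices (psi \o phi)),
            coarse_map psi ->
            exists (Hpsi : {linear rhomology (push_topmod emb E TL) n ->
                      rhomology
                        (push_topmod emb_psi E_psi (push_topmod emb E TL)) n})
                   (Hcomp : {linear rhomology TL n ->
                                    rhomology (push_topmod emb_comp E_comp TL) n}),
              [/\ induces (pushf (@simplex_map H K psi n)) Hpsi,
                  induces (pushf (@simplex_map G K (psi \o phi) n)) Hcomp &
                  forall c, coset (Hcomp c) = coset (Hpsi (Hphi c))]]))
  /\
  (* (ii) *)
  ((forall n : nat,
      [/\ exists2 Hphi : {linear cohomology M n -> cohomology (pull phi M) n},
            induces (pullf (@simplex_map G H phi n)) Hphi &
            forall phi' : G -> H, coarse_map phi' -> coarsely_equal phi phi' ->
              exists2 Hphi' : {linear cohomology M n ->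
                                      cohomology (pull phi' M) n},
                induces (pullf (@simplex_map G H phi' n)) Hphi' &
                forall c, coset (Hphi c) = coset (Hphi' c),
          forall (emb : coarse_embedding phi) (E : choices phi),
            exists (Hphi : {linear cohomology (pullinv phi L) n ->
                                   cohomology L n})
                   (Homega : {linear cohomology L n ->
                                     cohomology (pullinv phi L) n}),
              [/\ induces (pullf (@simplex_map G H phi n)) Hphi,
                  induces (pullf (@simplex_map H G (omega E) n)) Homega,
                  cancel Hphi Homega & cancel Homega Hphi] &
          forall (N : resmod W K) (psi : H -> K), coarse_map psi ->
            exists (Hpsi : {linear cohomology N n -> cohomology (pull psi N) n})
                   (Hphi : {linear cohomology (pull psi N) n ->
                                   cohomology (pull phi (pull psi N)) n})
                   (Hcomp : {linear cohomology N n ->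
                                    cohomology (pull (psi \o phi) N) n}),
              [/\ induces (pullf (@simplex_map H K psi n)) Hpsi,
                  induces (pullf (@simplex_map G H phi n)) Hphi,
                  induces (pullf (@simplex_map G K (psi \o phi) n)) Hcomp &
                  forall c, coset (Hcomp c) = coset (Hphi (Hpsi c))]])
   /\
   (forall (tR : topology R), topological_field tR ->
      forall (emb : coarse_embedding phi) (E : choices phi) (n : nat),
      [/\ forall (P : section_partition E) (TM : topmod W H),
            topological_resmod tR TM ->
            exists Hphi : {linear rcohomology TM n ->
                                  rcohomology (pull_topmod emb P TM) n},
            [/\ induces (pullf (@simplex_map G H phi n)) Hphi,
                continuous (Hphi : rcohomology_space TM n ->
                              rcohomology_space (pull_topmod emb P TM) n) &
                forall (phi' : G -> H) (emb' : coarse_embedding phi')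
                       (E' : choices phi') (P' : section_partition E'),
                  coarse_map phi' -> coarsely_equal phi phi' ->
                  exists2 Hphi' : {linear rcohomology TM n ->
                                     rcohomology (pull_topmod emb' P' TM) n},
                    induces (pullf (@simplex_map G H phi' n)) Hphi' &
                    forall c, coset (Hphi c) = coset (Hphi' c)],
          forall TL : topmod W G, topological_resmod tR TL ->
            exists Hphi : {linear rcohomology (pullinv_topmod emb E TL) n ->
                                  rcohomology TL n},
              induces (pullf (@simplex_map G H phi n)) Hphi /\
              topological_isomorphism
                (Hphi : rcohomology_space (pullinv_topmod emb E TL) n ->
                        rcohomology_space TL n) &
          forall (P : section_partition E)
                 (TN : topmod W K) (psi : H -> K)
                 (emb_psi : coarse_embedding psi)
                 (E_psi : choices psi) (P_psi : section_partition E_psi)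
                 (emb_comp : coarse_embedding (psi \o phi))
                 (E_comp : choices (psi \o phi)) (P_comp : section_partition E_comp),
            topological_resmod tR TN -> coarse_map psi ->
            exists (Hpsi : {linear rcohomology TN n ->
                              rcohomology (pull_topmod emb_psi P_psi TN) n})
                   (Hphi : {linear
                      rcohomology (pull_topmod emb_psi P_psi TN) n ->
                      rcohomology
                        (pull_topmod emb P (pull_topmod emb_psi P_psi TN)) n})
                   (Hcomp : {linear rcohomology TN n ->
                               rcohomology (pull_topmod emb_comp P_comp TN) n}),
              [/\ induces (pullf (@simplex_map H K psi n)) Hpsi,
                  induces (pullf (@simplex_map G H phi n)) Hphi,
                  induces (pullf (@simplex_map G K (psi \o phi) n)) Hcomp &
                  forall c, coset (Hcomp c) = coset (Hphi (Hpsi c))]])).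
Proof.
split; split.
- by move=> n; exact: homology_functorial.
- move=> tR TL _ /topological_continuous_ops good; exact: rhomology_functorial.
- by move=> n; exact: cohomology_functorial.
- by move=> tR _; exact: rcohomology_functorial.
Qed.
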